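(* Let $n\ge3$, let $\Omega\subset\mathbb{R}^n$ be open, and let $(u_i)$ be a sequence of smooth solutions of $-\Delta u=u|u|^{4/(n-2)}$ in $\Omega$ such that $\|u_i\|_{H^1(\Omega)}+\|u_i\|_{L^{2n/(n-2)}(\Omega)}$ is bounded, with weak limit $u$ in $H^1(\Omega)\cap L^{2n/(n-2)}(\Omega)$, and such that (up to a subsequence) the measures $\eta_i=\big(\frac12|\nabla u_i|^2+\frac{n-2}{2n}|u_i|^{2n/(n-2)}\big)dx$ converge to $\eta$ in the sense of measures. Write $$\eta=\Big(\tfrac12|\nabla u|^2+\tfrac{n-2}{2n}|u|^{2n/(n-2)}\Big)dx+\nu ,$$ where $\nu$ is a nonnegative Radon measure, and let $\Sigma\subset\Omega$ and $\varepsilon_0>0$ be the singular set and the constant described in the context. Let $\delta>0$ be such that $B_\delta\subset\Omega$, where $B_\delta$ is a ball of radius $\delta$. Then: (i) $\Sigma\subset\operatorname{spt}(\nu)$; (ii) there exists a measurable, upper semicontinuous function $\Theta$ such that $\nu(x)=\Theta(x)\,\mathcal{H}^0\lfloor\Sigma$ for $x\in\Sigma$. Moreover, there exist constants $c>0$ and $C>0$, depending only on $n$ and $\Omega$, such that $$c\,\varepsilon_0<\Theta(x)<C\qquad \mathcal{H}^0\text{-a.e. in }\Sigma .$$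
   Context: $B(x,r)$ is the ball of center $x$ and radius $r$; $\mathcal{H}^0\lfloor\Sigma$ is the restriction to $\Sigma$ of the $0$-dimensional Hausdorff measure; $\Theta$ is a measurable function on $\Sigma$; $\operatorname{spt}(\nu)$ is the support of $\nu$. Convergence in the sense of measures means $\int_\Omega\phi\,d\eta_i\to\int_\Omega\phi\,d\eta$ for every continuous $\phi$ with compact support in $\Omega$. For a solution $u$, set $$E_u(x,r)=\int_{B(x,r)}|u|^{2n/(n-2)}\,dy+\frac{d}{dr}\int_{\partial B(x,r)}u^2\,ds+r^{-1}\int_{B(x,r)}u^2\,ds ,$$ where $ds$ denotes the element of integration over the indicated set. Singular set: it is known (Guo and Li) that the weak limit $u$ is smooth and satisfies $-\Delta u=u|u|^{4/(n-2)}$ outside a closed singular subset $\Sigma$ of $\Omega$, and that there exist $r_0>0$ and $\varepsilon_0>0$ such that $$\Sigma=\bigcap_{0<r<r_0}\Big\{x\in\Omega:\ \liminf_{i\to\infty}E_{u_i}(x,r)\ge\varepsilon_0\Big\}.$$ These are the $\Sigma$ and $\varepsilon_0$ of the claim.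
   Formalization: The constant C is allowed to depend, besides n and Ω, on the bound for the norms of the sequence (u_i); with C depending only on n and Ω the claim fails, e.g. for n=3, by rescaling entire sign-changing solutions of arbitrarily large energy (Ding). c depends only on n and Ω. *)

(* Defs.v *)
From HB Require Import structures.
From mathcomp Require Import all_boot all_order all_algebra finmap ring lra.
From mathcomp Require Import all_classical all_reals all_analysis.
From mathcomp Require Import measurable_realfun.

Set Implicit Arguments.
Unset Strict Implicit.
Unset Printing Implicit Defensive.
Import Order.TTheory GRing.Theory Num.Theory.
Import numFieldNormedType.Exports.
Local Open Scope classical_set_scope.
Local Open Scope ring_scope.

HB.instance Definition _ (R : realType) (n : nat) :=
  @isMeasurable.Build ((@open 'rV[R]_n).-sigma)%mdisp 'rV[R]_n
    <<s @open 'rV[R]_n >> (@sigma_algebra0 _ setT (@open 'rV[R]_n))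
    (@sigma_algebraC _ (@open 'rV[R]_n))
    (@sigma_algebra_bigcup _ setT (@open 'rV[R]_n)).

Section borel.
Context {R : realType}.

Lemma open_measurable_rV n (A : set 'rV[R]_n) : open A -> measurable A.
Proof. exact: sub_sigma_algebra. Qed.

Lemma closed_measurable_rV n (A : set 'rV[R]_n) : closed A -> measurable A.
Proof.
move=> cA; rewrite -[A]setCK; apply: measurableC.
by apply: open_measurable_rV; exact: closed_openC.
Qed.

Lemma continuous_measurable_rV n (f : 'rV[R]_n -> R) :
  continuous f -> measurable_fun setT f.
Proof.
move=> /continuousP cf.
apply: (measurability _ (RGenOpens.measurableE R)).
move=> _ [_ [a [b ->]] <-]; rewrite setTI.
by apply: open_measurable_rV; apply: cf; exact: itv_open.
Qed.

Let ratball n (q : 'rV[rat]_n) (k : nat) : set 'rV[R]_n :=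
  [set x | forall j, `|x ord0 j - ratr (q ord0 j)| < k.+1%:R^-1].

Let open_ratball n (A : set 'rV[R]_n) : open A ->
  A = \bigcup_(qk : 'rV[rat]_n * nat)
        (if `[< ratball qk.1 qk.2 `<=` A >] then ratball qk.1 qk.2 else set0).
Proof.
move=> oA; apply/seteqP; split => [x Ax|x [qk _]]; last first.
  by case: ifPn => // /asboolP; exact.
have /nbhs_ballP[e /= e0 xeA] : nbhs x A by exact: open_nbhs_nbhs.
have [k ke] : exists k : nat, k.+1%:R^-1 < e / 2.
  exists (Num.truncn (e / 2)^-1); rewrite invf_plt ?posrE ?divr_gt0//.
  exact: truncnS_gt.
have /choice[q qP] : forall j : 'I_n, exists q : rat,
    `|x ord0 j - ratr q| < k.+1%:R^-1.
  move=> j.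
  have : 0 < k.+1%:R^-1 :> R by rewrite invr_gt0.
  move: (k.+1%:R^-1 : R) => r r0.
  have /rat_in_itvoo[q] : x ord0 j - r < x ord0 j + r by lra.
  rewrite in_itv/= => /andP[q1 q2]; exists q.
  by rewrite ltr_norml; apply/andP; split; lra.
exists (\row_j q j, k) => //=; case: ifPn => [_ j|/negP]; first by rewrite mxE.
case; apply/asboolP => y yq; apply: xeA; split => // i j; rewrite (ord1 i) /ball/=.
have := qP j; have := yq j; rewrite mxE distrC.
move: (k.+1%:R^-1 : R) ke => r re h1 h2.
rewrite -(subrKA (ratr (q j))) (le_lt_trans (ler_normD _ _))//; lra.
Qed.

Lemma measurable_fun_rV d (T : measurableType d) n (f : T -> 'rV[R]_n) :
  (forall j, measurable_fun setT (fun t => f t ord0 j)) -> measurable_fun setT f.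
Proof.
move=> mf; apply: (measurability (@open 'rV[R]_n)) => //.
move=> _ [A /open_ratball -> <-]; rewrite setTI preimage_bigcup.
apply: countable_bigcupT_measurable => // -[q k] /=.
case: ifPn => _; last by rewrite preimage_set0.
rewrite (_ : _ @^-1` _ = \bigcap_(j in [set: 'I_n])
    (setT `&` (fun t => f t ord0 j) @^-1` ball (ratr (q ord0 j) : R) k.+1%:R^-1)).
  apply: fin_bigcap_measurable => // j _; apply: mf => //.
  exact: measurable_ball.
apply/seteqP; split => t /= h j.
- by move=> _; split => //=; rewrite /ball/= distrC; exact: h.
- by have [_] := h j I; rewrite /ball/= distrC.
Qed.

Definition rV_cons n (p : R * 'rV[R]_n) : 'rV[R]_n.+1 :=
  \row_j if unlift ord0 j is Some i then p.2 ord0 i else p.1.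

Definition rV_uncons n (x : 'rV[R]_n.+1) : R * 'rV[R]_n :=
  (x ord0 ord0, \row_j x ord0 (lift ord0 j)).

Lemma rV_cons0 n (p : R * 'rV[R]_n) : rV_cons p ord0 ord0 = p.1.
Proof. by rewrite mxE unlift_none. Qed.

Lemma rV_consS n (p : R * 'rV[R]_n) j : rV_cons p ord0 (lift ord0 j) = p.2 ord0 j.
Proof. by rewrite mxE liftK. Qed.

Lemma rV_consK n : cancel (@rV_cons n) (@rV_uncons n).
Proof.
case=> a v; rewrite /rV_uncons rV_cons0; congr pair.
by apply/rowP => j; rewrite mxE rV_consS.
Qed.

Lemma measurable_coord n (j : 'I_n) :
  measurable_fun setT (fun x : 'rV[R]_n => x ord0 j).
Proof. by apply: continuous_measurable_rV; exact: coord_continuous. Qed.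

Lemma measurable_rV_cons n : measurable_fun setT (@rV_cons n).
Proof.
apply: measurable_fun_rV => j; case: (unliftP ord0 j) => [i ->|->].
- under eq_fun do rewrite rV_consS.
  exact: (measurableT_comp (measurable_coord i) measurable_snd).
- by under eq_fun do rewrite rV_cons0; exact: measurable_fst.
Qed.

Lemma measurable_rV_uncons n : measurable_fun setT (@rV_uncons n).
Proof.
apply: measurable_fun_pair; first exact: measurable_coord.
apply: measurable_fun_rV => j.
by under eq_fun do rewrite mxE; exact: measurable_coord.
Qed.

Section leb_step.
Variables (n : nat) (mu : {sigma_finite_measure set 'rV[R]_n -> \bar R}).

Definition leb_step : set 'rV[R]_n.+1 -> \bar R :=
  pushforward (lebesgue_measure \x mu)%E (@rV_cons n).

Let leb_step0 : leb_step set0 = 0%E.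
Proof. by rewrite /leb_step /pushforward preimage_set0 measure0. Qed.

Let leb_step_ge0 A : (0 <= leb_step A)%E.
Proof. exact: (measure_ge0 (lebesgue_measure \x mu)%E). Qed.

Let mpre A : measurable A -> measurable (@rV_cons n @^-1` A).
Proof. by move=> mA; rewrite -[X in measurable X]setTI; exact: measurable_rV_cons. Qed.

Let leb_step_sigma_additive : semi_sigma_additive leb_step.
Proof.
move=> F mF tF mUF; rewrite /leb_step /pushforward preimage_bigcup.
apply: measure_semi_sigma_additive => [k||]; first exact: mpre.
- apply/trivIsetP => i j _ _ ij; rewrite -preimage_setI.
  by move/trivIsetP : tF => /(_ _ _ _ _ ij) ->//; rewrite preimage_set0.
- by rewrite -preimage_bigcup; exact: mpre.
Qed.

HB.instance Definition _ := isMeasure.Build _ _ _ leb_step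
  leb_step0 leb_step_ge0 leb_step_sigma_additive.

Let leb_step_sigma_finite : sigma_finite setT leb_step.
Proof.
have /sigma_finiteP[F [TF ndF Foo]] := sigma_finiteT (@lebesgue_measure R).
have /sigma_finiteP[G [TG ndG Goo]] := sigma_finiteT mu.
exists (fun k => @rV_uncons n @^-1` (F k `*` G k)).
  rewrite -preimage_bigcup (_ : \bigcup_k _ = setT) ?preimage_setT//.
  rewrite -setXTT TF TG; apply/seteqP; split => -[x y] /=.
    by move=> [k _ []/= ? ?]; split; exists k.
  move=> [/= [i _ Fix_] [k _ Gky]]; exists (maxn i k) => //; split.
    by move: x Fix_; exact/subsetPset/ndF/leq_maxl.
  by move: y Gky; exact/subsetPset/ndG/leq_maxr.
move=> k; have [mF Fk] := Foo k; have [mG Gk] := Goo k; split.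
  rewrite -[X in measurable X]setTI; apply: measurable_rV_uncons => //.
  exact: measurableX.
rewrite /leb_step /pushforward -comp_preimage (_ : _ \o _ = id); last first.
  by apply/funext => p /=; rewrite rV_consK.
by rewrite preimage_id product_measure1E// lte_mul_pinfty// ge0_fin_numE.
Qed.

HB.instance Definition _ :=
  Measure_isSigmaFinite.Build _ _ _ leb_step leb_step_sigma_finite.

End leb_step.

Fixpoint leb n : {sigma_finite_measure set 'rV[R]_n -> \bar R} :=
  if n is m.+1 then leb_step (leb m) else \d_ (0 : 'rV[R]_0).

Lemma leb_box n (a b : 'rV[R]_n) : (forall j, a ord0 j <= b ord0 j) ->
  leb n [set x : 'rV[R]_n | forall j, x ord0 j \in `[a ord0 j, b ord0 j]] =
  (\prod_(j < n) (b ord0 j - a ord0 j))%:E.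
Proof.
elim: n a b => [|n IH] a b ab.
  rewrite big_ord0 /= diracE mem_set//= => j; by case: j.
set a' := (rV_uncons a).2; set b' := (rV_uncons b).2.
pose B' := [set x : 'rV[R]_n | forall j, x ord0 j \in `[a' ord0 j, b' ord0 j]].
transitivity ((lebesgue_measure \x leb n)%E
    (`[a ord0 ord0, b ord0 ord0]%classic `*` B')).
  set B := (X in leb n.+1 X).
  rewrite -[LHS]/((lebesgue_measure \x leb n)%E (@rV_cons n @^-1` B)).
  congr ((lebesgue_measure \x leb n)%E _).
  apply/seteqP; split => -[t x] /= h.
  - split; first by have := h ord0; rewrite rV_cons0.
    by move=> j; have := h (lift ord0 j); rewrite rV_consS /a' /b' !mxE.
  - move=> j; case: (unliftP ord0 j) => [i ->|->].
    + by rewrite rV_consS; have := h.2 i; rewrite /a' /b' !mxE.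
    + by rewrite rV_cons0; exact: h.1.
rewrite product_measure1E//; last first.
  rewrite (_ : B' = \bigcap_(j in [set: 'I_n])
      (setT `&` (fun x : 'rV[R]_n => x ord0 j) @^-1` `[a' ord0 j, b' ord0 j])).
    by apply: fin_bigcap_measurable => // j _; exact: measurable_coord.
  apply/seteqP; split => x /= h j; first by move=> _; split => //; exact: h.
  by have [_] := h j I.
rewrite [X in (_ * X)%E]IH; last by move=> j; rewrite /a' /b' !mxE.
rewrite [X in (X * _)%E](lebesgue_measure_itv `[a ord0 ord0, b ord0 ord0])/= lte_fin.
rewrite big_ord_recl EFinM; congr (_ * _)%E.
  case: ltP => // ba; rewrite (_ : b _ _ = a ord0 ord0) ?subrr//.
  by apply/eqP; rewrite eq_le ba ab.
by congr EFin; apply: eq_bigr => j _; rewrite /a' /b' !mxE.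
Qed.

End borel.

Section euclid.
Context {R : realType} {n : nat}.
Implicit Types (x y : 'rV[R]_n) (r s : R) (A : set 'rV[R]_n).

Definition enorm x : R := Num.sqrt (\sum_j x ord0 j ^+ 2).

Lemma enorm_gt0 x : x != 0 -> 0 < enorm x.
Proof.
move=> x0; rewrite sqrtr_gt0 lt0r sumr_ge0 ?andbT; last by move=> *; exact: sqr_ge0.
apply: contra x0; rewrite psumr_eq0 => [/allP h|j _]; last exact: sqr_ge0.
apply/eqP/rowP => j; rewrite mxE.
by have := h j (mem_index_enum _); rewrite sqrf_eq0 => /eqP.
Qed.

Definition eball x r : set 'rV[R]_n := [set y | enorm (y - x) < r].

Definition closed_eball x r : set 'rV[R]_n := [set y | enorm (y - x) <= r].

Definition diam A : \bar R :=
  ereal_sup [set z | exists x y, [/\ A x, A y & z = (enorm (x - y))%:E]].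

(* Every nonempty covering set contributes (diam C)^0 = 1, the empty set 0. *)
Definition hausdorff0_pre (delta : R) A : \bar R :=
  ereal_inf [set (\sum_(0 <= k <oo) (C k != set0)%:R%:E)%E | C in
    [set C : (set 'rV[R]_n)^nat | A `<=` \bigcup_k C k /\
       forall k, (diam (C k) <= delta%:E)%E]].

Definition hausdorff0 A : \bar R :=
  ereal_sup [set hausdorff0_pre delta A | delta in [set d : R | 0 < d]].

Let finite_measurable A : finite_set A -> measurable A.
Proof.
move=> fA; apply: closed_measurable_rV; move: fA.
by apply: (iffLR accessible_finite_set_closed); exact/hausdorff_accessible/norm_hausdorff.
Qed.

Let lower_positive (s : seq R) : exists2 d, 0 < d &
  forall z, z \in s -> 0 < z -> d < z.
Proof.
elim: s => [|a s [d d0 ds]]; first by exists 1.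
have [a0|a0] := ltP 0 a; last first.
  exists d => // z; rewrite inE => /predU1P[->|/ds//].
  by rewrite ltNge a0.
exists (Num.min d (a / 2)) => [|z]; first by rewrite lt_min d0 divr_gt0.
rewrite inE => /predU1P[-> _|/ds /[apply] dz]; rewrite gt_min ?dz//.
by apply/orP; right; lra.
Qed.

Let separated (s : seq 'rV[R]_n) : exists2 d : R, 0 < d &
  forall x y, x \in s -> y \in s -> enorm (x - y) <= d -> x = y.
Proof.
have [d d0 ds] := lower_positive [seq enorm (x - y) | x <- s, y <- s].
exists d => // x y xs ys; apply: contraPP => xy; apply/negP; rewrite -ltNge.
apply: ds; first by apply/allpairsP; exists (x, y).
by rewrite enorm_gt0// subr_eq0; exact/eqP.
Qed.

Let diam1 x : (diam [set x] <= 0)%E.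
Proof.
apply: ge_ereal_sup => _ [_ [_ [-> -> ->]]]; rewrite lee_fin subrr.
by rewrite /enorm big1 ?sqrtr0// => j _; rewrite mxE expr0n.
Qed.

Let diam0 : (diam set0 <= 0)%E.
Proof. by apply: ge_ereal_sup => _ [x [y [[]]]]. Qed.

Let hausdorff0_ge (B : {fset 'rV[R]_n}) A : [set` B] `<=` A ->
  ((#|` B|)%:R%:E <= hausdorff0 A)%E.
Proof.
move=> BA; have [d d0 dB] := separated B.
apply: (@le_trans _ _ (hausdorff0_pre d A)); last first.
  by apply: ereal_sup_ubound; exists d.
apply: le_ereal_inf_tmp => _ [C [AC Cd] <-].
have -> : ((#|` B|)%:R%:E = counting [set` B] :> \bar R)%E.
  by rewrite /counting asboolT// set_fsetK.
have mCB k : measurable (C k `&` [set` B]).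
  by apply: finite_measurable; exact: finite_setIr.
apply: (@le_trans _ _ (\sum_(0 <= k <oo) counting (C k `&` [set` B]))%E).
  apply: (@measure_sigma_subadditive _ _ _ (@counting _ R)) => //.
    exact: finite_measurable.
  by rewrite -setI_bigcupl => x Bx; split => //; apply: AC; exact: BA.
apply: lee_nneseries => [k _ _|k _]; first exact: (measure_ge0 (@counting _ R)).
have [->|C0] := eqVneq (C k) set0.
  by rewrite set0I (measure0 (@counting _ R)).
have [->|/set0P[x [Cx Bx]]] := eqVneq (C k `&` [set` B]) set0.
  by rewrite (measure0 (@counting _ R)).
apply: (@le_trans _ _ (counting [set x])).
  apply: (@le_measure _ _ _ (@counting _ R)); rewrite ?inE//.
    exact: finite_measurable.
  move=> y [Cy By]; apply: dB => //; rewrite -lee_fin (le_trans _ (Cd k))//.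
  by apply: ereal_sup_ubound; exists y, x.
by rewrite /counting asboolT// fset_set1 cardfs1.
Qed.

Let hausdorff0_le A : (hausdorff0 A <= counting A)%E.
Proof.
have [fA|iA] := pselect (finite_set A); last by rewrite /counting asboolF// leey.
rewrite /counting asboolT//.
apply: ge_ereal_sup => _ [d /= d0 <-]; apply: ereal_inf_lbound.
pose s : seq 'rV[R]_n := fset_set A.
have sA x : (x \in s) = (x \in A) by exact: in_fset_set.
pose C k := if (k < size s)%N then [set nth 0 s k] else set0.
exists C; first split.
- move=> x Ax; have xs : x \in s by rewrite sA inE.
  by exists (index x s) => //; rewrite /C index_mem xs /= nth_index.
- move=> k; apply: (@le_trans _ _ 0%E); last by rewrite lee_fin ltW.
  by rewrite /C; case: ifPn => _; [exact: diam1|exact: diam0].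
rewrite (nneseries_split 0 (size s)) => [|k _]; last by rewrite lee_fin.
rewrite add0n eseries0 ?adde0 => [|k + _]; last first.
  by rewrite leqNgt /C => /negbTE ->; rewrite eqxx.
rewrite big_mkord (eq_bigr (fun=> 1%:E)) => [|k _].
  by rewrite sumEFin big_const_ord iter_addr_0.
rewrite /C ltn_ord (_ : _ != set0)//.
by apply/set0P; exists (nth 0 s k).
Qed.

Lemma hausdorff0E : hausdorff0 = @counting _ R.
Proof.
apply/funext => A; apply/eqP; rewrite eq_le hausdorff0_le andTb.
have [fA|iA] := pselect (finite_set A).
  rewrite /counting asboolT//; apply: hausdorff0_ge.
  by rewrite fset_setK.
rewrite /counting asboolF// leye_eq; apply/eqP/eq_infty => r.
have [B BA Br] := infinite_set_fset (Num.truncn r).+1 iA.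
apply: (@le_trans _ _ (#|` B|%:R%:E)%E); last exact: hausdorff0_ge.
by rewrite lee_fin (le_trans (ltW (truncnS_gt r)))// ler_nat.
Qed.

Let hausdorff0_set0 : hausdorff0 set0 = 0%E.
Proof. by rewrite hausdorff0E (measure0 (@counting _ R)). Qed.

Let hausdorff0_ge0 A : (0 <= hausdorff0 A)%E.
Proof. by rewrite hausdorff0E; exact: (measure_ge0 (@counting _ R)). Qed.

Let hausdorff0_sigma_additive : semi_sigma_additive hausdorff0.
Proof. by rewrite hausdorff0E; exact: measure_semi_sigma_additive. Qed.

HB.instance Definition _ := isMeasure.Build _ _ _ hausdorff0
  hausdorff0_set0 hausdorff0_ge0 hausdorff0_sigma_additive.

End euclid.

Section calculus.
Context {R : realType} {n : nat}.
Local Notation E := 'rV[R]_n.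
Implicit Types (f u v phi : E -> R) (g : 'I_n -> E -> R) (D : set E).

Definition partial (j : 'I_n) f : E -> R := fun x => 'D_(delta_mx ord0 j) f x.

Definition smooth_on D f := forall s : seq 'I_n, forall x, D x ->
  {for x, continuous (foldr partial f s)} /\
  forall j, derivable (foldr partial f s) x (delta_mx ord0 j).

Definition laplacian f : E -> R := fun x => \sum_j partial j (partial j f) x.

(* 2n/(n-2) *)
Definition crit_exp : R := (2 * n%:R) / (n%:R - 2).

(* - Delta f = f |f|^(4/(n-2)) pointwise in D *)
Definition solves_on D f := forall x, D x ->
  - laplacian f x = f x * `|f x| `^ (4 / (n%:R - 2)).

(* |f| and its support are taken in the whole space: a function with compact
   support in D is identified with its extension by zero. *)
Definition compact_support_in D f :=
  compact (closure [set x | f x != 0]) /\ closure [set x | f x != 0] `<=` D.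

Definition norm_on D (p : R) f : \bar R := 'N[leb n]_(p%:E)[(EFin \o f) \_ D].

Definition in_Lp D (p : R) f := measurable_fun D f /\ (norm_on D p f < +oo)%E.

Definition weak_gradient D u g := forall phi j,
  smooth_on setT phi -> compact_support_in D phi ->
  \int[leb n]_(x in D) (u x * partial j phi x) =
  - \int[leb n]_(x in D) (g j x * phi x).

Definition H1_norm D u g : \bar R :=
  ((norm_on D 2 u `^ 2 + \sum_j norm_on D 2 (g j) `^ 2) `^ 2^-1)%E.

(* u belongs to H^1(D) \cap L^(2n/(n-2))(D), with weak gradient g. *)
Definition in_H1Lcrit D u g := [/\ in_Lp D 2 u, forall j, in_Lp D 2 (g j),
  weak_gradient D u g & in_Lp D crit_exp u].

Definition H1Lcrit_norm D u g : \bar R :=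
  (H1_norm D u g + norm_on D crit_exp u)%E.

(* Bounded linear functionals on H^1(D) \cap L^(2n/(n-2))(D); by boundedness
   they do not distinguish functions that agree almost everywhere in D. *)
Definition bounded_functional D (l : (E -> R) -> R) :=
  (forall a v gv w gw, in_H1Lcrit D v gv -> in_H1Lcrit D w gw ->
     l (fun x => a * v x + w x) = a * l v + l w) /\
  exists K : R, forall v gv, in_H1Lcrit D v gv ->
    (`|l v|%:E <= K%:E * H1Lcrit_norm D v gv)%E.

Definition weakly_converges D (u_ : nat -> E -> R) u :=
  forall l, bounded_functional D l -> (l \o u_) i @[i --> \oo] --> l u.

(* Density of the energy, for a function u with gradient g. *)
Definition energy_density u g : E -> R := fun x =>
  2^-1 * (\sum_j g j x ^+ 2) +
  (n%:R - 2) / (2 * n%:R) * `|u x| `^ crit_exp.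

(* Integral of f over the sphere of center x and radius r: the surface measure
   of a subset S of the unit sphere is n times the volume of the cone
   {t w | 0 < t < 1, w in S}, and ds scales like r^(n-1). *)
Definition sphere_integral (x : E) (r : R) f : R :=
  n%:R * r ^+ n.-1 *
  \int[leb n]_(y in eball 0 1) f (x + (r / enorm y) *: y).

(* E_u(x, r) *)
Definition local_energy u (x : E) (r : R) : R :=
  \int[leb n]_(y in eball x r) (`|u y| `^ crit_exp)
  + derive1 (fun s => sphere_integral x s (fun y => u y ^+ 2)) r
  + r^-1 * \int[leb n]_(y in eball x r) (u y ^+ 2).

(* The condition on liminf E_{u_i}(x, r) is imposed on those r < r0 for which
   E_{u_i}(x, r) makes sense, i.e. the closed ball lies in D. *)
Definition concentration_set D (u_ : nat -> E -> R) (r0 eps0 : R) : set E :=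
  \bigcap_(r in `]0, r0[%classic) [set x | D x /\
    (closed_eball x r `<=` D ->
     (eps0%:E <= limn_einf (fun i => (local_energy (u_ i) x r)%:E))%E)].

(* As u is only determined almost everywhere, its regularity off Sigma is that
   of a representative. *)
Definition singular_set D (u_ : nat -> E -> R) u (r0 eps0 : R) (Sigma : set E) :=
  [/\ exists2 F : set E, closed F & Sigma = D `&` F,
      exists v, [/\ smooth_on (D `\` Sigma) v, solves_on (D `\` Sigma) v &
        {ae leb n, forall x, (D `\` Sigma) x -> u x = v x}] &
      Sigma = concentration_set D u_ r0 eps0].

Definition upper_semicontinuous_on D f := forall x, D x ->
  forall a, f x < a -> \forall y \near within D (nbhs x), f y < a.

End calculus.
Arguments crit_exp {R} n.

Section radon.
Context {R : realType} {n : nat}.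
Local Notation E := 'rV[R]_n.
Implicit Types (mu : {measure set E -> \bar R}) (D : set E).

(* A Radon measure on the open set D is represented by the Borel measure on
   the whole space that vanishes outside D. *)
Definition radon_on D mu :=
  mu (~` D) = 0%E /\ forall K, compact K -> K `<=` D -> (mu K < +oo)%E.

Definition support_in D mu : set E :=
  [set x | D x /\ forall U, open U -> U x -> (0 < mu (U `&` D))%E].

Definition has_density_on D mu (f : E -> R) := forall A, measurable A ->
  mu A = (\int[leb n]_(x in A `&` D) (f x)%:E)%E.

Definition vaguely_converges D (mu_ : nat -> {measure set E -> \bar R}) mu :=
  forall phi : E -> R, continuous phi -> compact_support_in D phi ->
  \int[mu_ i]_(x in D) phi x @[i --> \oo] --> \int[mu]_(x in D) phi x.

End radon.

(* Main.v *)
(* Fix x in Sigma and a small rho, and integrate E_{u_i}(x, r) >= eps0 against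
   the weight 2 rho - r over rho < r < 2 rho. The derivative of the sphere
   integral is then absorbed by (d/dr) ((2 rho - r) S(r)), whose integral is
   - rho S(rho) <= 0, and Fatou's lemma moves the liminf out of the integral: a
   cube Q of half-side 3 rho around x satisfies
     eps0 <= 24 (energy of u_i on Q + rho^-2 int_Q u_i^2)
   up to a factor depending on n, for large i. By the Poincaré inequality,
   rho^-2 int_Q u_i^2 is controlled by the energy and by
   rho^(-n-2) (int_Q u_i)^2. The latter converges by weak convergence, and the
   energy is at most eta of a larger cube up to a small error. As rho tends to
   0, eta of the cube tends to eta({x}) = nu({x}) because Lebesgue measure has
   no atoms, and rho^(-n-2) (int_Q u)^2 tends to 0 because u is in
   L^(2n/(n-2)). Hence every point of Sigma is an atom of nu of mass at least a
   dimensional constant times eps0. Finite sets have eta-mass at most the energy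
   bound, so Sigma is finite, and Theta(x) = nu({x}) works. *)

Require Import Defs.
From HB Require Import structures.
From mathcomp Require Import all_boot all_order all_algebra finmap ring lra.
From mathcomp Require Import all_classical all_reals all_analysis.
From mathcomp Require Import measurable_realfun.
Set Implicit Arguments.
Unset Strict Implicit.
Unset Printing Implicit Defensive.
Import Order.TTheory GRing.Theory Num.Theory.
Import numFieldNormedType.Exports.
Local Open Scope classical_set_scope.
Local Open Scope ring_scope.

(** The local energy contains a derivative of a sphere integral, which has no sign, whereas Fatou's
    lemma needs nonnegative integrands. Each weighted local energy is therefore replaced by the
    larger [averaged_energy], whose sign comes from AM-GM. The weight [2 * rho - r] vanishes at the
    outer radius, so the only boundary term left is the one at [rho], which has the good sign. Weak
    convergence is available only through bounded linear functionals, so strong L^2 convergence of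
    the sequence is not at hand. The Poincaré inequality reduces the L^2 term to the energy and a
    mean, and a mean is such a functional. The coefficient rho^(-n-2) of the squared mean is exactly
    the scale-invariant one for the critical exponent, so no spare power of rho makes this term
    small. It is beaten by the smallness of the critical integral of u near x, which is read off
    from eta(cube) - nu({x}). The limit in i is taken at fixed rho, and rho is made small only
    afterwards. *)

(** * Affine changes of variables, Tonelli and measurability for [leb] *)

Lemma ge0_integral_lebesgue_affine (R : realType) (a b : R) (f : R -> \bar R) :
  0 < a -> measurable_fun setT f -> (forall x, 0 <= f x)%E ->
  (\int[lebesgue_measure]_x f (b + a * x)%R
   = (a^-1)%:E * \int[lebesgue_measure]_x f x)%E.
Proof.
move=> a0 mf f0.
pose phi (x : R) : measurableTypeR R := b + a * x.
have mphi : measurable_fun setT phi.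
  by apply: measurable_funD => //; exact: measurable_funM.
pose nu := mscale (NngNum (ltW a0))
  (pushforward (@lebesgue_measure R) phi).
(* By uniqueness of Lebesgue measure it is enough that [a] times the image measure gives half-open
   intervals their length. *)
have nuE A : measurable A -> lebesgue_measure A = nu mphi A.
  apply: lebesgue_measure_unique => _ [[c d]] _ <-.
  rewrite /nu /= /mscale /= /pushforward.
  rewrite (_ : phi @^-1` _ = `](c - b) / a, (d - b) / a]%classic); last first.
    apply/seteqP; split => x /=; rewrite !in_itv/= ltr_pdivrMr// ler_pdivlMr//;
      by rewrite ltrBlDl lerBrDl (mulrC x).
  rewrite [LHS](lebesgue_measure_itv `]c, d])/=.
  rewrite [X in (_ * X)%E](lebesgue_measure_itv `](c - b) / a, (d - b) / a])/= !lte_fin.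
  rewrite ltr_pM2r ?invr_gt0// ltrD2r; case: ifPn => cd; last by rewrite mule0.
  rewrite -!EFinB -EFinM; congr EFin; field; exact: lt0r_neq0.
rewrite [in RHS](eq_measure_integral (nu mphi)); last by move=> A mA _; exact: nuE.
rewrite ge0_integral_mscale//= muleA -EFinM mulVf ?mul1e ?gt_eqF//.
rewrite ge0_integral_pushforward//=.
Qed.

Lemma measurable_ge0_integral d1 d2 (T1 : measurableType d1)
    (T2 : measurableType d2) (R : realType)
    (m : {sigma_finite_measure set T2 -> \bar R}) (f : T1 -> T2 -> \bar R) :
  measurable_fun setT (fun p : T1 * T2 => f p.1 p.2) ->
  (forall x y, 0 <= f x y)%E ->
  measurable_fun setT (fun x => \int[m]_y f x y)%E.
Proof.
move=> mf f0.
exact: (measurable_fun_fubini_tonelli_F _ mf (fun p => f0 p.1 p.2)).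
Qed.

(** [leb] in one more dimension is by construction the image of a product measure under [rV_cons],
    so Tonelli applies. Inductions on the dimension run through this recursion. *)
Lemma ge0_integral_lebS (R : realType) n (f : 'rV[R]_n.+1 -> \bar R) :
  measurable_fun setT f -> (forall x, 0 <= f x)%E ->
  (\int[leb n.+1]_x f x =
   \int[lebesgue_measure]_t \int[leb n]_y f (rV_cons (t, y)))%E.
Proof.
move=> mf f0; have mc : measurable_fun setT (@rV_cons R n : measurableTypeR R * _ -> _).
  exact: measurable_rV_cons.
transitivity (\int[(lebesgue_measure \x leb n)%E]_p (f \o @rV_cons R n) p)%E.
  rewrite -[in RHS](preimage_setT (@rV_cons R n)).
  by rewrite -(ge0_integral_pushforward mc).
apply: (fubini_tonelli1 (f \o (@rV_cons R n : measurableTypeR R * _ -> _))).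
- exact: measurableT_comp.
- by move=> p; exact: f0.
Qed.

Lemma measurable_affine_rV (R : realType) n (a : R) (b : 'rV[R]_n) :
  measurable_fun setT (fun y : 'rV[R]_n => b + a *: y).
Proof.
apply: measurable_fun_rV => j; under eq_fun do rewrite !mxE.
by apply: measurable_funD => //; apply: measurable_funM => //; exact: measurable_coord.
Qed.

Lemma ge0_integral_leb_affine (R : realType) n (a : R) (b : 'rV[R]_n)
    (f : 'rV[R]_n -> \bar R) :
  0 < a -> measurable_fun setT f -> (forall x, 0 <= f x)%E ->
  (\int[leb n]_x f (b + a *: x)%R = (a ^- n)%:E * \int[leb n]_x f x)%E.
Proof.
move=> a0; elim: n b f => [|n IH] b f mf f0.
  rewrite expr0 invr1 mul1e; apply: eq_integral => x _; congr f.
  by apply/rowP; case.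
have mfa : measurable_fun setT (fun x : 'rV[R]_n.+1 => f (b + a *: x)).
  by apply: measurableT_comp => //; exact: measurable_affine_rV.
rewrite !ge0_integral_lebS//.
have mfc : measurable_fun setT (fun p : R * 'rV[R]_n => f (rV_cons p)).
  by apply: measurableT_comp => //; exact: measurable_rV_cons.
pose g (t : R) := (\int[leb n]_y f (rV_cons (t, y)))%E.
have mg : measurable_fun setT g.
  apply: (@measurable_ge0_integral _ _ _ _ _ _ (fun (t : R) y => f (rV_cons (t, y)))) => //.
have g0 t : (0 <= g t)%E by apply: integral_ge0.
transitivity (\int[lebesgue_measure]_t ((a ^- n)%:E * g (b ord0 ord0 + a * t)%R))%E.
  apply: eq_integral => t _.
  (* The induction hypothesis is read from right to left: the last [n] coordinates account for the
     factor [a ^- n], and the first one is left to the one-dimensional case. *)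
  rewrite /g -(IH (\row_j b ord0 (lift ord0 j)))//; last first.
    by apply: (measurableT_comp mfc); exact: pair1_measurable.
  apply: eq_integral => y _; congr f; apply/rowP => j; rewrite !mxE.
  by case: unliftP => [i ->|->] /=; rewrite ?mxE.
rewrite (@ge0_integralZl _ _ _ lebesgue_measure setT measurableT
  (fun t => g (b ord0 ord0 + a * t)%R)); first last.
- by rewrite lee_fin invr_ge0 exprn_ge0// ltW.
- by move=> t _; exact: g0.
- by apply: measurableT_comp => //; exact: measurable_funD.
by rewrite ge0_integral_lebesgue_affine// muleA -EFinM exprSr invfM.
Qed.

Lemma enorm_ge0 (R : realType) n (x : 'rV[R]_n) : 0 <= enorm x.
Proof. exact: sqrtr_ge0. Qed.

Lemma enormZ (R : realType) n (a : R) (x : 'rV[R]_n) :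
  enorm (a *: x) = `|a| * enorm x.
Proof.
rewrite /enorm -sqrtr_sqr -sqrtrM ?sqr_ge0// mulr_sumr; congr Num.sqrt.
by apply: eq_bigr => j _; rewrite mxE exprMn.
Qed.

Lemma enorm_continuous (R : realType) n : continuous (@enorm R n).
Proof.
move=> x; apply: continuous_comp; last exact: sqrt_continuous.
apply: continuous_big => [|j _ y]; first exact: add_continuous.
exact: (continuous_comp (@coord_continuous _ _ _ ord0 j y) (@exprn_continuous R 2 _)).
Qed.

Lemma measurable_enorm (R : realType) n : measurable_fun setT (@enorm R n).
Proof. by apply: continuous_measurable_rV; exact: enorm_continuous. Qed.

Lemma open_eball (R : realType) n (x : 'rV[R]_n) r : open (eball x r).
Proof.
have cf : continuous (fun y : 'rV[R]_n => enorm (y - x)).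
  move=> y.
  apply: (@cvg_comp _ _ _ (fun z : 'rV[R]_n => z - x) (@enorm R n) _ (nbhs (y - x))).
    by apply: (@cvgB _ 'rV[R]_n _ (nbhs y) _ id (cst x)) => //; exact: cvg_cst.
  exact: enorm_continuous.
rewrite (_ : eball x r = (fun y : 'rV[R]_n => enorm (y - x)) @^-1` [set t | t < r])//.
by apply: open_comp => [y _|]; [exact: cf|exact: open_lt].
Qed.

Lemma measurable_eball (R : realType) n (x : 'rV[R]_n) r :
  measurable (eball x r).
Proof. by apply: open_measurable_rV; exact: open_eball. Qed.

(** A singleton is a degenerate box. The dimension is a successor because in dimension 0 the measure
    is a Dirac mass. *)
Lemma leb_set1 (R : realType) n (x : 'rV[R]_n.+1) : leb n.+1 [set x] = 0%E.
Proof.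
rewrite (_ : [set x] = [set y | forall j, y ord0 j \in `[x ord0 j, x ord0 j]]).
  by rewrite leb_box// big_ord_recl subrr mul0r.
apply/seteqP; split => [_ -> j|y /= h]; first by rewrite in_itv/= lexx.
apply/rowP => j; have := h j; rewrite in_itv/= => /andP[h1 h2].
by apply/le_anti; rewrite h1 h2.
Qed.

(** The primitive -t^(-n-1) vanishes at infinity. This is the normalisation of polar coordinates:
    with [a] the norm of z, the value cancels the factor |z|^(n+1) carried by [M] below. *)
Lemma integral_powN_tail (R : realType) n (a : R) : 0 < a ->
  (\int[lebesgue_measure]_(t in `]a, +oo[) (n.+1%:R * t ^- n.+2)%:E
   = (a ^- n.+1)%:E)%E.
Proof.
move=> a0.
have dF (x : R) : 0 < x ->
    is_derive x 1 (fun t => - t ^- n.+1) (n.+1%:R * x ^- n.+2).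
  move=> x0.
  have D1 : is_derive x (1 : R) (fun t : R => t ^+ n.+1) (n.+1%:R * x ^+ n).
    have := is_deriveX n.+1 (@is_derive_id _ R x 1).
    by rewrite /GRing.scale/= mulr1 exprfctE.
  have D2 := @is_deriveV _ (fun t : R => t ^+ n.+1) x _ _ (lt0r_neq0 (exprn_gt0 n.+1 x0)) D1.
  apply: (is_derive_eq (is_deriveN D2)).
  rewrite scaleNr opprK /GRing.scale/= !exprS.
  have xn : x ^+ n != 0 by rewrite expf_neq0// gt_eqF.
  by field; rewrite xn gt_eqF.
have cV (k : nat) (x : R) : 0 < x -> {for x, continuous (fun t : R => t ^- k)}.
  move=> x0; apply: cvgV; first by rewrite expf_neq0// gt_eqF.
  exact: exprn_continuous.
have cf (x : R) : 0 < x -> {for x, continuous (fun t : R => n.+1%:R * t ^- n.+2)}.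
  by move=> x0; apply: cvgM; [exact: cvg_cst|exact: cV].
rewrite integral_itv_obnd_cbnd; last first.
  apply/measurable_EFinP; apply: open_continuous_measurable_fun => // x.
  by rewrite inE/= in_itv/= andbT => ax; apply: cf; exact: lt_trans ax.
rewrite (@ge0_continuous_FTC2y _ _ (fun t => - t ^- n.+1) a 0) ?sub0e ?opprK//.
- by rewrite EFinN oppeK.
- move=> x ax; rewrite mulr_ge0// invr_ge0 exprn_ge0//.
  by rewrite (le_trans (ltW a0)).
- apply: continuous_in_subspaceT => x; rewrite inE/= in_itv/= andbT => ax.
  by apply: cf; exact: lt_le_trans ax.
- rewrite -oppr0; apply: cvgN; apply/gtr0_cvgV0.
    by near=> t; rewrite exprn_gt0.
  apply/cvgryPge => A; near=> t; apply: (@le_trans _ _ t) => //.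
  by rewrite exprS ler_peMr ?exprn_ege1//.
- by move=> x ax; have [] := dF _ (lt_trans a0 ax).
- by apply: cvg_at_right_filter; apply: cvgN; exact: cV.
- move=> x; rewrite in_itv/= andbT => ax; rewrite derive1E.
  exact: (@derive_val _ _ _ _ _ _ _ (dF _ (lt_trans a0 ax))).
Unshelve. all: by end_near. Qed.

Lemma measurable_set1_rV (R : realType) n (x : 'rV[R]_n) : measurable [set x].
Proof.
apply: closed_measurable_rV; apply: accessible_closed_set1.
exact/hausdorff_accessible/norm_hausdorff.
Qed.

Lemma ge0_exchange_integral d1 d2 (T1 : measurableType d1)
    (T2 : measurableType d2) (R : realType)
    (m1 : {sigma_finite_measure set T1 -> \bar R})
    (m2 : {sigma_finite_measure set T2 -> \bar R}) (f : T1 -> T2 -> \bar R) :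
  measurable_fun setT (fun p : T1 * T2 => f p.1 p.2) ->
  (forall x y, 0 <= f x y)%E ->
  (\int[m1]_x \int[m2]_y f x y = \int[m2]_y \int[m1]_x f x y)%E.
Proof.
by move=> mf f0; exact: (fubini_tonelli _ mf (fun p => f0 p.1 p.2)).
Qed.

(** [powR] is measurable but inverts only nonnegative bases, hence the detour 1/t = t (t^2)^(-1),
    which also agrees with the convention that 0 has inverse 0. *)
Lemma measurable_inv (R : realType) : measurable_fun setT (fun t : R => t^-1).
Proof.
rewrite (_ : (fun t : R => t^-1) = (fun t => t * (t ^+ 2) `^ (-1))).
  apply: measurable_funM => //; apply: (measurableT_comp (measurable_powR (-1))).
  exact: measurable_funX.
apply/funext => t; rewrite powR_inv1 ?sqr_ge0// expr2 invfM.
by have [->|t0] := eqVneq t 0; rewrite ?mul0r ?invr0// mulrA divff// mul1r.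
Qed.

Lemma measurable_scale_rV (R : realType) d (T : measurableType d) n
    (a : T -> R) (v : T -> 'rV[R]_n) :
  measurable_fun setT a -> measurable_fun setT v ->
  measurable_fun setT (fun x => a x *: v x).
Proof.
move=> ma mv; apply: measurable_fun_rV => j; under eq_fun do rewrite !mxE.
by apply: measurable_funM => //; exact: (measurableT_comp (measurable_coord j)).
Qed.

Lemma measurable_add_rV (R : realType) d (T : measurableType d) n
    (u v : T -> 'rV[R]_n) :
  measurable_fun setT u -> measurable_fun setT v ->
  measurable_fun setT (fun x => u x + v x).
Proof.
move=> mu mv; apply: measurable_fun_rV => j; under eq_fun do rewrite !mxE.
by apply: measurable_funD; exact: (measurableT_comp (measurable_coord j)).
Qed.

(** * Polar coordinates *)

Section polar.
Context (R : realType) (n : nat).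
Variable h : 'rV[R]_n.+1 -> \bar R.
Hypothesis mh : measurable_fun setT h.
Hypothesis h0 : (forall x, 0 <= h x)%E.
Local Notation E := 'rV[R]_n.+1.
Local Notation P := (`]0%R, +oo[%classic : set R).
Local Notation B := (eball (0 : E) 1).
Local Notation RR := (measurableTypeR R).

(** Integrands of the successive forms of one double integral. [K] is the polar integrand, [L]
    results from t -> |y| t at fixed y, and [M] from z = t y at fixed t, where |y| < 1 becomes |z| <
    t. Integrating [M] over t > |z| leaves [h z], so that no surface measure enters. *)
Let K (t : RR) (y : E) : \bar R :=
  ((\1_P t * (n.+1%:R * t ^+ n) * \1_B y)%:E * h ((t / enorm y) *: y))%E.
Let L (t : RR) (y : E) : \bar R :=
  ((\1_P t * (n.+1%:R * t ^+ n) * (\1_B y * enorm y ^+ n.+1))%:E * h (t *: y))%E.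
Let M (t : RR) (z : E) : \bar R :=
  ((\1_P t * (n.+1%:R * (t^-1) ^+ n.+2) * ((enorm z < t)%R%:R * enorm z ^+ n.+1))%:E
   * h z)%E.

Let mP : measurable_fun setT (fun t : RR => \1_P t : R).
Proof. exact: measurable_indic. Qed.

Let mB : measurable_fun setT (fun y : E => \1_B y : R).
Proof. by apply: measurable_indic; exact: measurable_eball. Qed.

Let P1 (t : R) : 0 < t -> \1_P t = 1 :> R.
Proof. by move=> t0; rewrite indicE mem_set//= in_itv/= andbT. Qed.

Let P0 (t : R) : t <= 0 -> \1_P t = 0 :> R.
Proof.
move=> t0; rewrite indicE memNset//= in_itv/= andbT.
by apply/negP; rewrite -leNgt.
Qed.

Let mK : measurable_fun setT (fun p : RR * E => K p.1 p.2).
Proof.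
apply: emeasurable_funM.
  apply/measurable_EFinP; apply: measurable_funM.
    apply: measurable_funM; first exact: (measurableT_comp mP).
    by apply: measurable_funM => //; exact: measurable_funX.
  exact: (measurableT_comp mB).
apply: (measurableT_comp mh); apply: measurable_scale_rV => //.
apply: measurable_funM => //; apply: (measurableT_comp (@measurable_inv R)).
exact: (measurableT_comp (@measurable_enorm R n.+1)).
Qed.

Let mL : measurable_fun setT (fun p : RR * E => L p.1 p.2).
Proof.
apply: emeasurable_funM.
  apply/measurable_EFinP; apply: measurable_funM.
    apply: measurable_funM; first exact: (measurableT_comp mP).
    by apply: measurable_funM => //; exact: measurable_funX.
  apply: measurable_funM; first exact: (measurableT_comp mB).
  by apply: measurable_funX; exact: (measurableT_comp (@measurable_enorm R n.+1)).
by apply: (measurableT_comp mh); exact: measurable_scale_rV.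
Qed.

Let mM : measurable_fun setT (fun p : RR * E => M p.1 p.2).
Proof.
have me : measurable_fun setT (fun p : RR * E => enorm p.2).
  exact: (measurableT_comp (@measurable_enorm R n.+1)).
apply: emeasurable_funM; last exact: (measurableT_comp mh).
apply/measurable_EFinP; apply: measurable_funM.
  apply: measurable_funM; first exact: (measurableT_comp mP).
  apply: measurable_funM => //; apply: measurable_funX.
  exact: (measurableT_comp (@measurable_inv R)).
apply: measurable_funM; last exact: measurable_funX.
rewrite (_ : (fun _ => _) = \1_[set p : RR * E | enorm p.2 < p.1]); last first.
  by apply/funext => p; rewrite indicE; congr ((nat_of_bool _)%:R); apply/idP/idP; rewrite inE.
apply: measurable_indic; rewrite -[X in measurable X]setTI.
under eq_set do rewrite -lte_fin.
by apply: measurable_lte => //; exact/measurable_EFinP.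
Qed.

Let K0 t y : (0 <= K t y)%E.
Proof.
rewrite /K mule_ge0// lee_fin indicE; case: (boolP (t \in P)); rewrite ?mul0r//.
rewrite inE/= in_itv/= andbT => t0.
by rewrite mul1r !mulr_ge0 ?exprn_ge0// ltW.
Qed.

Let L0 t y : (0 <= L t y)%E.
Proof.
rewrite /L mule_ge0// lee_fin indicE; case: (boolP (t \in P)); rewrite ?mul0r//.
rewrite inE/= in_itv/= andbT => t0.
by rewrite mul1r !mulr_ge0 ?exprn_ge0 ?enorm_ge0// ltW.
Qed.

Let M0 t y : (0 <= M t y)%E.
Proof.
rewrite /M mule_ge0// lee_fin indicE; case: (boolP (t \in P)); rewrite ?mul0r//.
rewrite inE/= in_itv/= andbT => t0.
rewrite mul1r; apply: mulr_ge0; apply: mulr_ge0 => //.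
  by rewrite exprn_ge0// invr_ge0 ltW.
by rewrite exprn_ge0// enorm_ge0.
Qed.

Let integralK : (\int[lebesgue_measure]_t \int[leb n.+1]_y K t y =
  \int[lebesgue_measure]_(t in P) \int[leb n.+1]_(y in B)
    ((n.+1%:R * t ^+ n)%:E * h ((t / enorm y) *: y)))%E.
Proof.
rewrite [RHS]integral_mkcond; apply: eq_integral => t _; rewrite patchE.
case: ifPn => tP; last first.
  by rewrite integral0_eq// => y _; rewrite /K indicE (negbTE tP) !mul0r mul0e.
rewrite [RHS]integral_mkcond; apply: eq_integral => y _; rewrite patchE /K.
rewrite !indicE tP mul1r; case: ifPn => yB; first by rewrite mulr1.
by rewrite mulr0 mul0e.
Qed.

Let integralKL y : y != 0 ->
  (\int[lebesgue_measure]_t K t y = \int[lebesgue_measure]_t L t y)%E.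
Proof.
move=> y0; have c0 := enorm_gt0 y0; set c := enorm y in c0 *.
have mKy : measurable_fun setT (K ^~ y).
  exact: (measurableT_comp mK (pair2_measurable y)).
have -> : (\int[lebesgue_measure]_t K t y =
    c%:E * \int[lebesgue_measure]_t K (0 + c * t)%R y)%E.
  rewrite (ge0_integral_lebesgue_affine 0 c0 mKy (fun t => K0 t y)).
  by rewrite muleA -EFinM (mulfV (lt0r_neq0 c0)) mul1e.
transitivity (\int[lebesgue_measure]_t (c%:E * K (0 + c * t)%R y))%E.
  apply/esym/(@ge0_integralZl _ _ _ lebesgue_measure setT measurableT
    (fun t => K (0 + c * t) y)).
  - by apply: (measurableT_comp mKy); exact: measurable_funD.
  - by move=> t _; exact: K0.
  - by rewrite lee_fin ltW.
apply: eq_integral => t _; rewrite /K /L add0r.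
rewrite muleA -EFinM -/c [c * t / c]mulrAC (mulfV (lt0r_neq0 c0)) mul1r.
congr (_%:E * _)%E.
rewrite (_ : \1_P (c * t) = \1_P t :> R); last first.
  rewrite !indicE; congr ((nat_of_bool _)%:R).
  by apply/idP/idP; rewrite !inE/= !in_itv/= !andbT pmulr_rgt0.
rewrite exprMn exprS; ring.
Qed.

Let integralLM t : (\int[leb n.+1]_y L t y = \int[leb n.+1]_y M t y)%E.
Proof.
have [t0|t0] := ltP 0 t; last first.
  by apply: eq_integral => y _; rewrite /L /M (P0 t0) !mul0r !mul0e.
(* [g] is [L t] written as a function of z = t y, so that the scaling formula applies; its factor
   t^(-n-1) then turns [g] into [M t]. *)
pose g (z : E) := ((n.+1%:R * t ^+ n * ((enorm z < t)%R%:R * (enorm z / t) ^+ n.+1))%:E * h z)%E.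
have gE (z : E) : ((t ^- n.+1)%:E * g z)%E = M t z.
  rewrite /g /M muleA -EFinM; congr (_%:E * _)%E.
  rewrite (P1 t0) expr_div_n !exprVn !exprS; field.
  by rewrite expf_neq0 ?gt_eqF.
have g0 z : (0 <= g z)%E.
  apply: mule_ge0; [rewrite lee_fin|exact: h0].
  apply: mulr_ge0; apply: mulr_ge0; [exact: ler0n|exact: exprn_ge0 (ltW t0)|exact: ler0n|].
  exact: exprn_ge0 (divr_ge0 (enorm_ge0 z) (ltW t0)).
have mMt : measurable_fun setT (M t).
  exact: (measurableT_comp mM (pair1_measurable t)).
have mg : measurable_fun setT g.
  rewrite (_ : g = fun z => ((t ^+ n.+1)%:E * M t z)%E).
    exact: measurable_funeM.
  by apply/funext => z; rewrite -gE muleA -EFinM (mulfV (lt0r_neq0 (exprn_gt0 _ t0))) mul1e.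
transitivity (\int[leb n.+1]_y g (0 + t *: y)%R)%E.
  apply: eq_integral => y _; rewrite /g /L add0r enormZ (gtr0_norm t0).
  rewrite (P1 t0) mul1r.
  rewrite [t * _ / t]mulrAC (mulfV (lt0r_neq0 t0)) mul1r.
  have -> : (t * enorm y < t) = (y \in B).
    rewrite -[X in _ < X]mulr1 (ltr_pM2l t0).
    by apply/idP/idP; rewrite inE/= /eball/= subr0.
  by rewrite indicE.
rewrite (ge0_integral_leb_affine 0 t0 mg g0).
rewrite -(@ge0_integralZl _ _ _ (leb n.+1) setT measurableT g mg).
- by apply: eq_integral => z _; exact: gE.
- by move=> z _; exact: g0.
- by rewrite lee_fin invr_ge0; exact: exprn_ge0 (ltW t0).
Qed.

Let integralM z : z != 0 -> (\int[lebesgue_measure]_t M t z = h z)%E.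
Proof.
move=> z0; have c0 := enorm_gt0 z0; set c := enorm z in c0 *.
transitivity (\int[lebesgue_measure]_(t in `]c, +oo[)
    ((c ^+ n.+1)%:E * h z * (n.+1%:R * t ^- n.+2)%:E))%E.
  rewrite [RHS]integral_mkcond; apply: eq_integral => t _; rewrite patchE /M.
  case: ifPn => [|]; rewrite ?inE ?notin_setE/= in_itv/= andbT => ct.
    rewrite -/c ct (P1 (lt_trans c0 ct)) muleAC -EFinM exprVn.
    by congr (_%:E * _)%E; rewrite !mul1r mulrC.
  by rewrite -/c (negbTE (introN idP ct)) mul0r mulr0 mul0e.
have mf : measurable_fun `]c, +oo[ (fun t : RR => (n.+1%:R * t ^- n.+2)%:E).
  apply: measurable_funTS; apply/measurable_EFinP.
  apply: measurable_funM; first exact: measurable_cst.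
  under eq_fun do rewrite -exprVn.
  by apply: measurable_funX; exact: measurable_inv.
rewrite (@ge0_integralZl _ _ _ lebesgue_measure _ _ _ mf).
- rewrite (integral_powN_tail n c0).
  by rewrite muleAC -EFinM (mulfV (lt0r_neq0 (exprn_gt0 _ c0))) mul1e.
- exact: measurable_itv.
- move=> t /=; rewrite in_itv/= andbT => ct; rewrite lee_fin.
  apply: mulr_ge0; first exact: ler0n.
  by rewrite invr_ge0; exact: exprn_ge0 (ltW (lt_trans c0 ct)).
- by apply: mule_ge0; [rewrite lee_fin; exact: exprn_ge0 (ltW c0)|exact: h0].
Qed.

Lemma polar_coordinates :
  (\int[lebesgue_measure]_(t in P) \int[leb n.+1]_(y in B)
    ((n.+1%:R * t ^+ n)%:E * h ((t / enorm y) *: y)) = \int[leb n.+1]_z h z)%E.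
Proof.
(* The substitutions by |y| and |z| break down only at the origin, which is a null set. *)
have ae0 (F G : E -> \bar R) : (forall y, y != 0 -> F y = G y) ->
    ae_eq (leb n.+1) setT F G.
  move=> FG; exists [set 0]; split; [|exact: leb_set1|].
    exact: measurable_set1_rV.
  move=> y /= /not_implyP[_ FGy]; apply: contrapT => /eqP y0.
  exact/FGy/FG.
have msw (F : RR -> E -> \bar R) :
    measurable_fun setT (fun p : RR * E => F p.1 p.2) ->
    (forall t y, 0 <= F t y)%E ->
    measurable_fun setT (fun y => \int[lebesgue_measure]_t F t y)%E.
  move=> mF F0.
  apply: (@measurable_ge0_integral _ _ _ _ _ _ (fun y t => F t y)) => [|y t].
    exact: (measurableT_comp mF (@measurable_swap _ _ _ _)).
  exact: F0.
rewrite -integralK (ge0_exchange_integral _ _ mK K0).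
transitivity (\int[leb n.+1]_y \int[lebesgue_measure]_t L t y)%E.
  apply: ge0_ae_eq_integral; [exact: measurableT|exact: msw|exact: msw| | |].
  - by move=> y _; apply: integral_ge0 => t _; exact: K0.
  - by move=> y _; apply: integral_ge0 => t _; exact: L0.
  - by apply: ae0 => y; exact: integralKL.
rewrite -(ge0_exchange_integral _ _ mL L0); under eq_integral do rewrite integralLM.
rewrite (ge0_exchange_integral _ _ mM M0).
apply: ge0_ae_eq_integral; [exact: measurableT|exact: msw|exact: mh| | |].
- by move=> y _; apply: integral_ge0 => t _; exact: M0.
- by move=> y _; exact: h0.
- by apply: ae0 => y; exact: integralM.
Qed.

End polar.

(** * Directional derivatives of functions with continuous partial derivatives *)

Lemma is_derive_line (R : realType) n (f : 'rV[R]_n -> R) (y v : 'rV[R]_n) (t : R) :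
  derivable f (t *: v + y) v ->
  is_derive t (1 : R) (fun s : R => f (s *: v + y)) ('D_v f (t *: v + y)).
Proof.
have E : (fun h : R => h^-1 *: (f ((h *: (1 : R) + t) *: v + y) - f (t *: v + y))) =
         (fun h : R => h^-1 *: (f (h *: v + (t *: v + y)) - f (t *: v + y))).
  by apply/funext => h; rewrite [h *: 1]mulr1 scalerDl addrA.
move=> df; constructor; first by rewrite /derivable /= E.
by rewrite /derive /= E.
Qed.

Lemma mean_value_line (R : realType) n (f : 'rV[R]_n -> R) (y v : 'rV[R]_n) (c : R) :
  (forall t, `|t| <= `|c| -> derivable f (t *: v + y) v) ->
  exists2 t, `|t| <= `|c| & f (c *: v + y) - f y = c * 'D_v f (t *: v + y).
Proof.
move=> df; pose g (s : R) := f (s *: v + y).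
have dg (t : R) : `|t| <= `|c| -> is_derive t 1 g ('D_v f (t *: v + y)).
  by move=> tc; exact/is_derive_line/df.
have g0 : g 0 = f y by rewrite /g scale0r add0r.
have cg (a b : R) : (forall t, t \in `[a, b] -> `|t| <= `|c|) ->
    {within `[a, b], continuous g}.
  move=> ab; apply: derivable_within_continuous => t /ab tc.
  by have [] := dg _ tc.
have [c0|c0] := leP 0 c.
- have tc (t : R) : t \in `[0, c] -> `|t| <= `|c|.
    by rewrite in_itv/= => /andP[t0 tc]; rewrite !ger0_norm.
  have [|t tI E] := @MVT_segment _ g (fun t => 'D_v f (t *: v + y)) _ _ c0 _ (cg _ _ tc).
    by move=> t tI; apply/dg/tc/subset_itv_oo_cc.
  by exists t; [exact: tc|rewrite -g0 -/(g c) E subr0 mulrC].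
- have tc (t : R) : t \in `[c, 0] -> `|t| <= `|c|.
    by rewrite in_itv/= => /andP[t0 tc]; rewrite !ler0_norm ?lerN2// ltW.
  have [|t tI E] := @MVT_segment _ g (fun t => 'D_v f (t *: v + y)) _ _ (ltW c0) _ (cg _ _ tc).
    by move=> t tI; apply/dg/tc/subset_itv_oo_cc.
  exists t; first exact: tc.
  by rewrite -g0 -/(g c) -opprB E sub0r mulrN opprK mulrC.
Qed.

(** The increment is split at [h *: w + a]. The part along [w] is differentiable at [a] by
    hypothesis; the part along [v] starts at a moving point, so the mean value theorem is used
    there, and continuity of ['D_v f] gives the limit. *)
Lemma is_derive_add_dir (R : realType) n (f : 'rV[R]_n -> R)
    (a v w : 'rV[R]_n) (c l : R) :
  (\forall x \near a, derivable f x v) -> {for a, continuous ('D_v f)} ->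
  is_derive a w f l -> is_derive a (c *: v + w) f (c * 'D_v f a + l).
Proof.
move=> dv cv dw.
suff H : (h^-1 *: (f (h *: (c *: v + w) + a) - f a)) @[h --> 0^'] -->
    c * 'D_v f a + l.
  by constructor; [exact: cvgP H|exact: cvg_lim H].
pose F (h : R) := h^-1 *: (f (h *: (c *: v + w) + a) - f (h *: w + a)).
pose G (h : R) := h^-1 *: (f (h *: w + a) - f a).
rewrite (_ : (fun h => _) = F \+ G); last first.
  by apply/funext => h; rewrite /F /G/= -scalerDr subrKA.
have GL : G h @[h --> 0^'] --> l.
  by case: dw => dw <-; exact: dw.
apply: cvgD => //.
apply/cvgrPdist_le => e e0.
pose e' := e / (`|c| + 1).
have c1 : 0 < `|c| + 1 by rewrite ltr_wpDl.
have e'0 : 0 < e' by rewrite divr_gt0.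
have := cv; move/cvgrPdist_le => /(_ e' e'0) cv'.
have /nbhs_ballP[d /= d0 dP] : \forall x \near a, derivable f x v /\ `|'D_v f a - 'D_v f x| <= e'.
  by near=> x; split; near: x.
(* All intermediate points lie within [|h| * K] of [a]; the summand 1 keeps [K] positive. *)
pose K := `|c| * `|v| + `|w| + 1.
have K0 : 0 < K by rewrite ltr_wpDl// addr_ge0// mulr_ge0.
near=> h.
have hd : `|h| * K < d.
  rewrite -ltr_pdivlMr//; near: h; apply: dnbhs0_lt; exact: divr_gt0.
have hn0 : h != 0 by near: h; exact: nbhs_dnbhs_neq.
have inb t : `|t| <= `|h * c| -> ball a d (t *: v + (h *: w + a)).
  move=> th; rewrite -ball_normE/= addrA opprD addrCA subrr addr0 normrN.
  apply: le_lt_trans hd; rewrite (le_trans (ler_normD _ _))// !normrZ /K !mulrDr.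
  rewrite mulr1 -addrA lerD//; last by rewrite lerDl.
  by rewrite mulrA -normrM ler_wpM2r.
have [t th E] := @mean_value_line _ _ f (h *: w + a) v (h * c)
  (fun t th => (dP _ (inb t th)).1).
have -> : F h = c * 'D_v f (t *: v + (h *: w + a)).
  rewrite /F (_ : h *: (c *: v + w) + a = (h * c) *: v + (h *: w + a)).
    by rewrite E /GRing.scale/= -mulrA mulKf.
  by rewrite scalerDr scalerA addrA.
rewrite -mulrBr normrM.
have [_ h2] := dP _ (inb t th).
rewrite (le_trans (ler_wpM2l _ h2))// /e' mulrC -mulrA ler_piMr ?(ltW e0)//.
by rewrite mulrC ler_pdivrMr// mul1r lerDl.
Unshelve. all: by end_near. Qed.

(** The direction is built up from 0 by adding one multiple of a basis vector at a time. *)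
Lemma is_derive_dir (R : realType) n (f : 'rV[R]_n -> R) (a w : 'rV[R]_n) :
  (forall j, \forall x \near a, derivable f x (delta_mx ord0 j)) ->
  (forall j, {for a, continuous (partial j f)}) ->
  is_derive a w f (\sum_j w ord0 j * partial j f a).
Proof.
move=> df cf; rewrite {1}(row_sum_delta w).
elim/big_rec2 : _ => [|j l v _ dv]; first exact: is_derive0.
by apply: is_derive_add_dir => //; exact: cf.
Qed.

Lemma is_derive_ray (R : realType) n (f : 'rV[R]_n -> R) (D : set 'rV[R]_n)
    (x w : 'rV[R]_n) (t : R) :
  open D -> (forall j y, D y -> derivable f y (delta_mx ord0 j)) ->
  (forall j y, D y -> {for y, continuous (partial j f)}) ->
  D (x + t *: w) ->
  is_derive t (1 : R) (fun s => f (x + s *: w))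
    (\sum_j w ord0 j * partial j f (x + t *: w)).
Proof.
move=> oD df cf Dt.
have dw : is_derive (x + t *: w) w f (\sum_j w ord0 j * partial j f (x + t *: w)).
  apply: is_derive_dir => j; last exact: cf.
  near=> y; apply: df; near: y; exact: open_nbhs_nbhs.
have [dfw <-] := dw.
rewrite (_ : (fun s => _) = (fun s => f (s *: w + x))); last first.
  by apply/funext => s; rewrite addrC.
by rewrite addrC; apply: is_derive_line; rewrite addrC.
Unshelve. all: by end_near. Qed.

(** * Cubes, and continuous functions on them *)

(** For [a >= 0] this is the closed ball of the maximum norm. Cubes are convex and compact, and
    [leb_box] gives their volume exactly. *)
Definition cube (R : realType) n (x : 'rV[R]_n) (a : R) : set 'rV[R]_n :=
  [set y | forall j, y ord0 j \in `[x ord0 j - a, x ord0 j + a]].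

Section cubes.
Context {R : realType} {n : nat}.
Implicit Types (x y z : 'rV[R]_n) (a : R) (D : set 'rV[R]_n).

Lemma cubeP x a y : cube x a y <-> forall j, `|y ord0 j - x ord0 j| <= a.
Proof.
by split=> h j; have := h j; rewrite in_itv/= ler_distl.
Qed.

Lemma cube_center x a : 0 <= a -> cube x a x.
Proof. by move=> a0; apply/cubeP => j; rewrite subrr normr0. Qed.

Lemma compact_cube x a : compact (cube x a).
Proof.
apply: (@rV_compact _ _ (fun j => `[x ord0 j - a, x ord0 j + a]%classic)) => j.
exact: segment_compact.
Qed.

Lemma closed_cube x a : closed (cube x a).
Proof. by apply: compact_closed; [exact: norm_hausdorff|exact: compact_cube]. Qed.

Lemma measurable_cube x a : measurable (cube x a).
Proof. by apply: closed_measurable_rV; exact: closed_cube. Qed.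

Lemma leb_cube x a : 0 <= a -> leb n (cube x a) = ((2 * a) ^+ n)%:E.
Proof.
move=> a0; pose u := x - const_mx a; pose v := x + const_mx a.
have -> : cube x a = [set y | forall j, y ord0 j \in `[u ord0 j, v ord0 j]].
  by apply/seteqP; split => y h j; have := h j; rewrite /u /v !mxE.
rewrite leb_box => [|j]; last by rewrite /u /v !mxE; lra.
congr EFin; rewrite (eq_bigr (fun=> 2 * a)) ?prodr_const ?card_ord// => j _.
by rewrite /u /v !mxE; ring.
Qed.

Lemma leb_cube_lty x a : (leb n (cube x a) < +oo)%E.
Proof.
have [a0|a0] := leP 0 a; first by rewrite leb_cube// ltry.
apply: (@le_lt_trans _ _ (leb n (cube x 0))); last by rewrite leb_cube// ltry.
apply: le_measure; rewrite ?inE; [exact: measurable_cube|exact: measurable_cube|].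
by move=> y /cubeP h; apply/cubeP => j; exact: le_trans (h j) (ltW a0).
Qed.

Lemma sub_cube x a b : a <= b -> cube x a `<=` cube x b.
Proof. by move=> ab y /cubeP h; apply/cubeP => j; exact: le_trans ab. Qed.

Lemma cube_in_open x D : open D -> D x -> exists2 d, 0 < d & cube x d `<=` D.
Proof.
move=> oD Dx; have /nbhs_ballP[e /= e0 xe] : nbhs x D by exact: open_nbhs_nbhs.
exists (e / 2); first exact: divr_gt0.
move=> y /cubeP h; apply: xe; split => // i j; rewrite (ord1 i) /ball/= distrC.
by apply: le_lt_trans (h j) _; lra.
Qed.

Lemma bigcap_cube x : \bigcap_k cube x k.+1%:R^-1 = [set x].
Proof.
apply/seteqP; split => [y h|_ -> k _]; last exact: cube_center.
apply/rowP => j; apply/eqP; rewrite -subr_eq0 -normr_eq0; apply/negPn/negP => yx.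
have y0 : 0 < `|y ord0 j - x ord0 j| by rewrite lt0r yx normr_ge0.
have [k _ kP] := near_infty_natSinv_lt (PosNum y0).
have /cubeP/(_ j) := h k I; rewrite leNgt => /negP; apply.
exact: (kP k (leqnn k)).
Qed.

Lemma coord_le_enorm y j : `|y ord0 j| <= enorm y.
Proof.
rewrite -sqrtr_sqr ler_wsqrtr// (bigD1 j)//= lerDl.
by apply: sumr_ge0 => i _; exact: sqr_ge0.
Qed.

Lemma closed_eball_cube x a : closed_eball x a `<=` cube x a.
Proof.
move=> y /= xy; apply/cubeP => j; apply: le_trans xy.
by have := coord_le_enorm (y - x) j; rewrite !mxE.
Qed.

Lemma eball_closed_eball x a : eball x a `<=` closed_eball x a.
Proof. by move=> y /ltW. Qed.

Lemma cube_convex x a y z t : cube x a y -> cube x a z -> 0 <= t <= 1 ->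
  cube x a (z + t *: (y - z)).
Proof.
move=> xy xz /andP[t0 t1] j; have := xy j; have := xz j.
rewrite !in_itv/= !mxE => /andP[z1 z2] /andP[y1 y2].
by apply/andP; split; nra.
Qed.

Lemma continuous_on_measurable D (f : 'rV[R]_n -> R) : open D ->
  (forall y, D y -> {for y, continuous f}) -> measurable_fun D f.
Proof.
move=> oD cf; apply: (measurability _ (RGenOpens.measurableE R)).
move=> _ [_ [a [b ->]] <-]; apply: open_measurable_rV.
have openI (B : set 'rV[R]_n) : B `<=` interior B -> open B by rewrite openE.
apply: openI => y [Dy fy]; apply: filterI; first exact: open_nbhs_nbhs.
by apply: cf => //; apply: open_nbhs_nbhs; split => //; exact: itv_open.
Qed.

Lemma continuous_on_bounded D K (f : 'rV[R]_n -> R) : compact K -> K `<=` D ->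
  (forall y, D y -> {for y, continuous f}) ->
  exists M, forall y, K y -> `|f y| <= M.
Proof.
move=> cK KD cf.
have cwf : {within K, continuous f}.
  by apply: continuous_in_subspaceT => y /set_mem Ky; exact/cf/KD.
have /compact_bounded[M [_ MP]] := continuous_compact cwf cK.
by exists (M + 1) => y Ky; apply: (MP (M + 1)); [rewrite ltrDl|exists y].
Qed.

Lemma continuous_on_integrable D K (f : 'rV[R]_n -> R) : open D -> compact K ->
  K `<=` D -> (leb n K < +oo)%E ->
  (forall y, D y -> {for y, continuous f}) -> (leb n).-integrable K (EFin \o f).
Proof.
move=> oD cK KD Koo cf.
have mK : measurable K.
  apply: closed_measurable_rV; apply: compact_closed => //; exact: norm_hausdorff.
apply: measurable_bounded_integrable => //.
  by apply: (measurable_funS _ KD); [exact: open_measurable_rV|exact: continuous_on_measurable].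
have [M MP] := continuous_on_bounded cK KD cf.
by exists M; split => [|A /ltW MA y Ky /=]; [exact: num_real|exact: le_trans (MP _ Ky) MA].
Qed.

End cubes.

(** * Calculus on a real interval, and the Cauchy-Schwarz inequality *)

Section real_line.
Context {R : realType}.
Implicit Types (f F : R -> R) (a b : R).

Lemma continuous_on_itv_integrable f a b :
  (forall t, t \in `[a, b] -> {for t, continuous f}) ->
  lebesgue_measure.-integrable `[a, b] (EFin \o f).
Proof.
move=> cf; apply: continuous_compact_integrable; first exact: segment_compact.
by apply: continuous_in_subspaceT => t /set_mem; exact: cf.
Qed.

Lemma integral_is_derive F f a b : a < b ->
  (forall t, t \in `[a, b] -> is_derive t (1 : R) F (f t)) ->
  (forall t, t \in `[a, b] -> {for t, continuous f}) ->
  (\int[lebesgue_measure]_(t in `[a, b]) (f t)%:E = (F b - F a)%:E)%E.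
Proof.
move=> ab dF cf.
have cF t : t \in `[a, b] -> {for t, continuous F}.
  by move=> /dF[dFt _]; exact/differentiable_continuous/derivable1_diffP.
rewrite EFinB; apply: continuous_FTC2 => //.
- by apply: continuous_in_subspaceT => t /set_mem; exact: cf.
- split.
  + by move=> t /subset_itv_oo_cc /dF[].
  + by apply: cvg_at_right_filter; apply: cF; rewrite in_itv/= lexx ltW.
  + by apply: cvg_at_left_filter; apply: cF; rewrite in_itv/= lexx ltW.
- move=> t /subset_itv_oo_cc /dF dFt; rewrite derive1E.
  by case: dFt.
Qed.

(* Integrate [2 l f - l ^ 2 <= f ^ 2] where [l] is the slope of the chord. *)
Lemma sqr_increment_le F f a b : a < b ->
  (forall t, t \in `[a, b] -> is_derive t (1 : R) F (f t)) ->
  (forall t, t \in `[a, b] -> {for t, continuous f}) ->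
  (((F b - F a) ^+ 2)%:E <=
   (b - a)%:E * \int[lebesgue_measure]_(t in `[a, b]) (f t ^+ 2)%:E)%E.
Proof.
move=> ab dF cf; have ba0 : 0 < b - a by rewrite subr_gt0.
pose l := (F b - F a) / (b - a).
pose g t := 2 * l * f t - l ^+ 2.
have dG t : t \in `[a, b] ->
    is_derive t (1 : R) (fun t => 2 * l * F t - l ^+ 2 * t) (g t).
  move=> /dF dFt; apply: is_deriveB.
  by apply: is_derive_eq; rewrite /GRing.scale/= mulr1.
have cg t : t \in `[a, b] -> {for t, continuous g}.
  move=> /cf cft; apply: cvgB; last exact: cvg_cst.
  by apply: cvgM => //; exact: cvg_cst.
have cf2 t : t \in `[a, b] -> {for t, continuous (fun t => f t ^+ 2)}.
  by move=> /cf cft; apply: cvgM.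
have E : (\int[lebesgue_measure]_(t in `[a, b]) (g t)%:E =
    ((b - a) * l ^+ 2)%:E)%E.
  rewrite (integral_is_derive ab dG cg); congr EFin; rewrite /l.
  by field; rewrite gt_eqF.
have -> : ((F b - F a) ^+ 2)%:E = ((b - a)%:E * ((b - a) * l ^+ 2)%:E)%E.
  by rewrite -EFinM; congr EFin; rewrite /l; field; rewrite gt_eqF.
rewrite lee_pmul2l// ?lte_fin// -E; apply: le_integral => //.
- exact: continuous_on_itv_integrable.
- exact: (continuous_on_itv_integrable cf2).
- by move=> t _; rewrite lee_fin /g -subr_ge0; have := sqr_ge0 (f t - l); lra.
Qed.

End real_line.

(** Cauchy-Schwarz, from the nonnegative quadratic form [H] at (S, -A). When [A] is 0 this point
    carries no information, and points such as (-(B + 1), S) force [S] to vanish instead. *)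
Lemma sum_mul_sqr_le (R : realType) n (a b : 'I_n -> R) :
  (\sum_j a j * b j) ^+ 2 <= (\sum_j a j ^+ 2) * (\sum_j b j ^+ 2).
Proof.
set A := \sum_j a j ^+ 2; set B := \sum_j b j ^+ 2; set S := \sum_j a j * b j.
have H (x y : R) : 0 <= x ^+ 2 * A + 2 * x * y * S + y ^+ 2 * B.
  have -> : x ^+ 2 * A + 2 * x * y * S + y ^+ 2 * B =
      \sum_j (x * a j + y * b j) ^+ 2.
    rewrite !mulr_sumr -!big_split/=; apply: eq_bigr => j _; ring.
  by apply: sumr_ge0 => j _; exact: sqr_ge0.
have A0 : 0 <= A by apply: sumr_ge0 => j _; exact: sqr_ge0.
have [A0'|A0'] := eqVneq A 0.
  have := H (- (B + 1)) S; have := H (B + 1) (- S); rewrite A0'.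
  have B0 : 0 <= B by apply: sumr_ge0 => j _; exact: sqr_ge0.
  rewrite mulr0 mul0r; nra.
have {}A0 : 0 < A by rewrite lt0r A0'.
have := H S (- A); rewrite (_ : _ + _ = A * (A * B - S ^+ 2)); last by ring.
by rewrite pmulr_rge0// subr_ge0.
Qed.

Lemma continuous_at_sum (R : realType) (T : topologicalType) n
    (f : 'I_n -> T -> R) (y : T) :
  (forall j, {for y, continuous (f j)}) ->
  {for y, continuous (fun z => \sum_j f j z)}.
Proof.
move=> cf; apply: (@cvg_big _ _ _ _ _ _ _ (nbhs y)) => [|j _].
- exact: add_continuous.
- exact: cf.
Qed.

Lemma continuous_ray (R : realType) n (x w : 'rV[R]_n) :
  continuous (fun t : R => x + t *: w).
Proof.
move=> t; apply: (@cvgD R ('rV[R]_n : normedModType R) _ (nbhs t) _ (fun=> x)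
  (fun t => t *: w) x (t *: w)); first exact: cvg_cst.
by apply: cvgZr_tmp.
Qed.

Definition C1_on (R : realType) n (D : set 'rV[R]_n) (f : 'rV[R]_n -> R) :=
  [/\ forall y, D y -> {for y, continuous f},
      forall j y, D y -> derivable f y (delta_mx ord0 j) &
      forall j y, D y -> {for y, continuous (partial j f)}].

Definition sqr_grad (R : realType) n (f : 'rV[R]_n -> R) (y : 'rV[R]_n) : R :=
  \sum_j (partial j f y) ^+ 2.

Lemma sqr_grad_ge0 (R : realType) n (f : 'rV[R]_n -> R) y : 0 <= sqr_grad f y.
Proof. by apply: sumr_ge0 => j _; exact: sqr_ge0. Qed.

Lemma continuous_sqr_grad (R : realType) n (D : set 'rV[R]_n) f y :
  C1_on D f -> D y -> {for y, continuous (sqr_grad f)}.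
Proof.
move=> [_ _ cf] Dy; apply: continuous_at_sum => j.
have cfj := cf j y Dy; exact: (cvgM cfj cfj).
Qed.

(** * The Poincaré inequality on a cube *)

Section poincare.
Context {R : realType} {n : nat}.
Variables (D : set 'rV[R]_n) (v : 'rV[R]_n -> R) (x : 'rV[R]_n) (a : R).
Hypothesis oD : open D.
Hypothesis C1v : C1_on D v.
Hypothesis a0 : 0 < a.
Hypothesis QD : cube x a `<=` D.
Local Notation Q := (cube x a).
Local Notation mu := (leb n).
Local Notation RR := (measurableTypeR R).

Let cv y : D y -> {for y, continuous v}. Proof. by have [cv _ _] := C1v; exact: cv. Qed.
Let V := v \_ Q.
Let G := (EFin \o sqr_grad v) \_ Q.
Let q : 'rV[R]_n -> R := \1_Q.
(** An upper bound for the squared distance of two points of the cube: each coordinate varies by at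
    most [2 * a]. *)
Let d2 := n%:R * (2 * a) ^+ 2.
(** Two points are compared through their midpoint. The half of the segment next to y is z + t (y -
    z) with t >= 1/2, on which the Jacobian t^(-n) of the map y -> z + t (y - z) is at most 2^n;
    over the whole segment it would be unbounded. *)
Let m (z y : 'rV[R]_n) := z + 2^-1 *: (y - z).
Let F (z y : 'rV[R]_n) : \bar R := (q z * q y * (V y - V (m z y)) ^+ 2)%:E.

Let mQ : measurable Q. Proof. exact: measurable_cube. Qed.

Let mD : measurable D. Proof. exact: open_measurable_rV. Qed.

Let mV : measurable_fun setT V.
Proof.
apply/(measurable_restrictT _ _).1 => //.
by apply: (measurable_funS _ QD) => //; exact: continuous_on_measurable.
Qed.

Let mG : measurable_fun setT G.
Proof.
apply/(measurable_restrictT _ _).1 => //; apply/measurable_EFinP.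
apply: (measurable_funS _ QD) => //; apply: continuous_on_measurable => // y Dy.
exact: (continuous_sqr_grad C1v).
Qed.

Let mq : measurable_fun setT q. Proof. exact: measurable_indic. Qed.

Let G0 y : (0 <= G y)%E.
Proof. by apply: erestrict_ge0 => z _; rewrite lee_fin; exact: sqr_grad_ge0. Qed.

Let q0 y : 0 <= q y. Proof. by rewrite /q indicE. Qed.

Let d20 : 0 <= d2. Proof. by rewrite mulr_ge0// sqr_ge0. Qed.

Let F0 z y : (0 <= F z y)%E.
Proof. by rewrite lee_fin; apply: mulr_ge0; [exact: mulr_ge0|exact: sqr_ge0]. Qed.

Let msub : measurable_fun setT (fun p : 'rV[R]_n * 'rV[R]_n => p.2 - p.1).
Proof.
under eq_fun do rewrite -scaleN1r.
by apply: measurable_add_rV => //; apply: measurable_scale_rV.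
Qed.

Let mm : measurable_fun setT (fun p : 'rV[R]_n * 'rV[R]_n => m p.1 p.2).
Proof. by apply: measurable_add_rV => //; exact: measurable_scale_rV. Qed.

Let mF : measurable_fun setT (fun p : 'rV[R]_n * 'rV[R]_n => F p.1 p.2).
Proof.
apply/measurable_EFinP; apply: measurable_funM.
  by apply: measurable_funM; exact: (measurableT_comp mq).
apply: measurable_funX; apply: measurable_funB; first exact: (measurableT_comp mV).
exact: (measurableT_comp mV mm).
Qed.

Let h1 : 2^-1 < 1 :> R. Proof. by rewrite invf_lt1 ?ltr1n. Qed.

Let mGray z : measurable_fun setT (fun p : 'rV[R]_n * RR => G (z + p.2 *: (p.1 - z))).
Proof.
apply: (measurableT_comp mG); apply: measurable_add_rV => //.
by apply: measurable_scale_rV => //; apply: measurable_add_rV.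
Qed.

(** Cauchy-Schwarz twice: in t along the half segment, whose length 1/2 is bounded by 1, and in the
    coordinates for the derivative in direction y - z. *)
Let ray_le z y : Q z -> Q y ->
  (((V y - V (m z y)) ^+ 2)%:E <=
   \int[lebesgue_measure]_(t in `[2^-1%R, 1%R])
     (d2%:E * G (z + t *: (y - z))%R))%E.
Proof.
move=> Qz Qy; pose w := y - z.
have It (t : R) : t \in `[2^-1, 1] -> Q (z + t *: w).
  rewrite in_itv/= => /andP[t0 t1]; apply: cube_convex => //.
  by rewrite t1 andbT (le_trans _ t0).
pose f (t : R) := \sum_j w ord0 j * partial j v (z + t *: w).
have [_ dv cdv] := C1v.
have dF (t : R) : t \in `[2^-1, 1] -> is_derive t (1 : R) (fun t : R => v (z + t *: w)) (f t).
  by move=> /It Qt; apply: (is_derive_ray oD dv cdv); exact: QD.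
have cf (t : R) : t \in `[2^-1, 1] -> {for t, continuous f}.
  move=> /It /QD Dt; apply: continuous_at_sum => j.
  apply: cvgM; first exact: cvg_cst.
  by apply: (continuous_comp (@continuous_ray _ _ z w t)); exact: cdv.
have := sqr_increment_le h1 dF cf.
have -> : v (z + 1 *: w) = V y.
  by rewrite scale1r /w addrC subrK /V patchE mem_set.
have -> : v (z + 2^-1 *: w) = V (m z y).
  by rewrite /V /m patchE mem_set//; apply: It; rewrite in_itv/= lexx ltW.
move=> /le_trans; apply.
apply: (@le_trans _ _ (\int[lebesgue_measure]_(t in `[2^-1%R, 1%R]) (f t ^+ 2)%:E)%E).
  apply: gee_pMl => //; first by apply: integral_ge0 => t _; rewrite lee_fin sqr_ge0.
  by rewrite lee_fin gerBl.
have cf2 (t : R) : t \in `[2^-1, 1] -> {for t, continuous (fun t => f t ^+ 2)}.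
  by move=> /cf cft; apply: cvgM.
apply: ge0_le_integral => //.
- by move=> t _; rewrite lee_fin sqr_ge0.
- exact: (measurable_int _ (continuous_on_itv_integrable cf2)).
- apply: measurable_funTS; apply: measurable_funeM.
  exact: (measurableT_comp (mGray z) (pair1_measurable y)).
- move=> t /It Qt; rewrite /G patchE mem_set// -EFinM lee_fin.
  apply: le_trans (sum_mul_sqr_le _ _) _.
  apply: ler_wpM2r; first exact: sqr_grad_ge0.
  rewrite /d2 mulr_natl -[X in _ *+ X]card_ord -sumr_const.
  apply: ler_sum => j _; have wa : `|w ord0 j| <= 2 * a.
    have /cubeP/(_ j) := Qy; have /cubeP/(_ j) := Qz; rewrite !mxE.
    by rewrite !ler_norml => /andP[? ?] /andP[? ?]; apply/andP; split; lra.
  by rewrite -real_normK ?num_real// lerXn2r// nnegrE (le_trans _ wa).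
Qed.

Let IG := (\int[mu]_y G y)%E.

(** After exchanging the integrals, the substitution y -> (1 - t) z + t y at fixed t costs t^(-n) <=
    2^n. The extension of the gradient by zero makes integration over the whole space harmless. *)
Let half_le z : Q z -> (\int[mu]_y F z y <= (d2 * 2 ^+ n)%:E * IG)%E.
Proof.
move=> Qz.
pose K (y : 'rV[R]_n) (t : RR) : \bar R :=
  ((\1_(`[2^-1, 1]%classic : set R) t * d2)%:E * G (z + t *: (y - z)))%E.
have K0 y t : (0 <= K y t)%E.
  by apply: mule_ge0 => //; rewrite lee_fin mulr_ge0// indicE.
have mK : measurable_fun setT (fun p : 'rV[R]_n * RR => K p.1 p.2).
  apply: emeasurable_funM; last exact: mGray.
  apply/measurable_EFinP; apply: measurable_funM => //.
  apply: (measurableT_comp _ (@measurable_snd _ _ 'rV[R]_n RR)).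
  by apply: measurable_indic; exact: measurable_itv.
have KE y : (\int[lebesgue_measure]_(t in `[2^-1%R, 1%R])
     (d2%:E * G (z + t *: (y - z))%R) = \int[lebesgue_measure]_t K y t)%E.
  rewrite integral_mkcond; apply: eq_integral => t _; rewrite patchE /K indicE.
  by case: ifPn => _; rewrite ?mul1r// mul0r mul0e.
apply: (@le_trans _ _ (\int[mu]_y \int[lebesgue_measure]_t K y t)%E).
  apply: ge0_le_integral => //.
  - exact: (measurableT_comp mF (pair1_measurable z)).
  - by apply: measurable_ge0_integral => //.
  - move=> y _; rewrite -KE /F.
    have [Qy|nQy] := pselect (Q y).
      rewrite /q !indicE !mem_set// mul1r mul1r; exact: ray_le.
    rewrite /q [\1_Q y]indicE memNset// mulr0 mul0r.
    by apply: integral_ge0 => t _; apply: mule_ge0; rewrite ?lee_fin.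
rewrite ge0_exchange_integral//.
apply: (@le_trans _ _ (\int[lebesgue_measure]_(t in `[2^-1%R, 1%R])
    ((d2 * 2 ^+ n)%:E * IG))%E).
  rewrite [leRHS]integral_mkcond; apply: ge0_le_integral => //.
  - by move=> t _; exact: integral_ge0.
  - apply: (@measurable_ge0_integral _ _ _ _ _ _ (fun t y => K y t)) => //.
    exact: (measurableT_comp mK (@measurable_swap _ _ _ _)).
  - by apply/(measurable_restrictT _ _).1.
  - move=> t _; rewrite patchE; case: ifPn => [|tI]; last first.
      rewrite integral0_eq// => y _.
      by rewrite /K indicE (negbTE tI) mul0r mul0e.
    move=> tI; have := tI; rewrite inE/= in_itv/= => /andP[t12 t1].
    have t0 : 0 < t by apply: lt_le_trans t12; rewrite invr_gt0.
    rewrite (eq_integral (fun y : 'rV[R]_n => d2%:E * G ((z - t *: z) + t *: y)%R)%E); last first.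
      move=> y _; rewrite /K indicE tI mul1r; congr (_ * G _)%E.
      by rewrite scalerBr addrA addrAC.
    rewrite (@ge0_integralZl _ _ _ mu setT measurableT
      (fun y : 'rV[R]_n => G ((z - t *: z) + t *: y)%R)).
    + rewrite (ge0_integral_leb_affine _ t0 mG G0) muleA -EFinM.
      apply: lee_wpmul2r; first exact: integral_ge0.
      rewrite lee_fin; apply: ler_wpM2l => //.
      rewrite -exprVn; apply: lerXn2r; rewrite ?nnegrE ?invr_ge0 ?(ltW t0)//.
      by rewrite invf_ple ?posrE.
    + by apply: (measurableT_comp mG); exact: measurable_affine_rV.
    + by move=> y _; exact: G0.
    + by rewrite lee_fin.
rewrite integral_cst// [X in (_ * X)%E](lebesgue_measure_itv `[2^-1, 1])/= lte_fin h1.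
rewrite -EFinB muleC; apply: gee_pMl => //.
  by apply: mule_ge0; [rewrite lee_fin mulr_ge0// exprn_ge0|exact: integral_ge0].
by rewrite lee_fin gerBl.
Qed.


Let q1 y : Q y -> q y = 1. Proof. by move=> Qy; rewrite /q indicE mem_set. Qed.

Let qn0 y : ~ Q y -> q y = 0. Proof. by move=> Qy; rewrite /q indicE memNset. Qed.

Let FF : (\int[mu]_z \int[mu]_y F z y <=
  ((2 * a) ^+ n * (d2 * 2 ^+ n))%:E * IG)%E.
Proof.
apply: (@le_trans _ _ (\int[mu]_(z in Q) ((d2 * 2 ^+ n)%:E * IG))%E).
  rewrite [leRHS]integral_mkcond; apply: ge0_le_integral => //.
  - by move=> z _; exact: integral_ge0.
  - exact: measurable_ge0_integral.
  - by apply/(measurable_restrictT _ _).1.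
  - move=> z _; rewrite patchE; case: ifPn => [/set_mem|/negP nQz]; first exact: half_le.
    rewrite integral0_eq// => y _; rewrite /F qn0 ?mul0r//.
    by move=> Qz; apply: nQz; exact/mem_set.
rewrite integral_cst// [X in (_ * X)%E](leb_cube x (ltW a0)) muleAC -EFinM.
by rewrite [X in (X%:E * _)%E]mulrC.
Qed.

Let H (z y : 'rV[R]_n) : R := q z * q y * (V y - V z) ^+ 2.

Let H0 z y : 0 <= H z y.
Proof. by apply: mulr_ge0; [exact: mulr_ge0|exact: sqr_ge0]. Qed.

(** Inserting the midpoint and using (p + q)^2 <= 2 p^2 + 2 q^2 bounds [H] by two copies of [F]. The
    midpoint is symmetric in its endpoints, so the second copy is the first with its arguments
    exchanged, and both have the same double integral. *)
Let HH : (\int[mu]_z \int[mu]_y (H z y)%:E <=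
  (4 * ((2 * a) ^+ n * (d2 * 2 ^+ n)))%:E * IG)%E.
Proof.
have mC z y : m z y = m y z.
  by rewrite /m; apply/rowP => j; rewrite !mxE; field.
have mF' : measurable_fun setT (fun p : 'rV[R]_n * 'rV[R]_n => F p.2 p.1).
  exact: (measurableT_comp mF (@measurable_swap _ _ _ _)).
have mFz z : measurable_fun setT (F z).
  exact: (measurableT_comp mF (pair1_measurable z)).
have mFy y : measurable_fun setT (F ^~ y).
  exact: (measurableT_comp mF (pair2_measurable y)).
have le2 z y : ((H z y)%:E <= 2%:E * F z y + 2%:E * F y z)%E.
  rewrite /F -!EFinM -EFinD lee_fin /H (mC y z).
  rewrite (_ : 2 * _ + _ = q z * q y * (2 * (V y - V (m z y)) ^+ 2 + 2 * (V z - V (m z y)) ^+ 2)).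
    apply: ler_wpM2l; first exact: mulr_ge0.
    by rewrite -subr_ge0; have := sqr_ge0 (V y + V z - 2 * V (m z y)); lra.
  by ring.
have i0 z : (0 <= \int[mu]_y F z y)%E by exact: integral_ge0.
have j0 z : (0 <= \int[mu]_y F y z)%E by exact: integral_ge0.
have mi : measurable_fun setT (fun z => \int[mu]_y F z y)%E.
  exact: measurable_ge0_integral.
have mj : measurable_fun setT (fun z => \int[mu]_y F y z)%E.
  exact: (@measurable_ge0_integral _ _ _ _ _ _ (fun z y => F y z)).
have mF2 z : measurable_fun setT (fun y => 2%:E * F z y)%E.
  exact: (measurable_funeM _ (mFz z)).
have mF2' z : measurable_fun setT (fun y => 2%:E * F y z)%E.
  exact: (measurable_funeM _ (mFy z)).
have mi2 : measurable_fun setT (fun z => 2%:E * \int[mu]_y F z y)%E.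
  exact: (measurable_funeM _ mi).
have mj2 : measurable_fun setT (fun z => 2%:E * \int[mu]_y F y z)%E.
  exact: (measurable_funeM _ mj).
have p2 : (0 <= 2%:E :> \bar R)%E by rewrite lee_fin.
apply: (@le_trans _ _ (\int[mu]_z (2%:E * \int[mu]_y F z y + 2%:E * \int[mu]_y F y z))%E).
  have mH : measurable_fun setT (fun p : 'rV[R]_n * 'rV[R]_n => (H p.1 p.2)%:E).
    apply/measurable_EFinP; apply: measurable_funM.
      by apply: measurable_funM; exact: (measurableT_comp mq).
    by apply: measurable_funX; apply: measurable_funB; exact: (measurableT_comp mV).
  apply: ge0_le_integral.
  - exact: measurableT.
  - by move=> z _; apply: integral_ge0 => y _; rewrite lee_fin.
  - by apply: (@measurable_ge0_integral _ _ _ _ _ _ (fun z y => (H z y)%:E)).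
  - exact: (emeasurable_funD mi2 mj2).
  - move=> z _.
    rewrite -(@ge0_integralZl _ _ _ mu setT measurableT _ (mFz z) 2%:E (fun y _ => F0 z y) p2).
    rewrite -(@ge0_integralZl _ _ _ mu setT measurableT _ (mFy z) 2%:E (fun y _ => F0 y z) p2).
    rewrite -(ge0_integralD _ measurableT _ (mF2 z) _ (mF2' z)); first last.
    + by move=> y _; apply: mule_ge0; [exact: p2|exact: F0].
    + by move=> y _; apply: mule_ge0; [exact: p2|exact: F0].
    apply: ge0_le_integral.
    + exact: measurableT.
    + by move=> y _; rewrite lee_fin.
    + exact: (measurableT_comp mH (pair1_measurable z)).
    + exact: (emeasurable_funD (mF2 z) (mF2' z)).
    + by move=> y _; exact: le2.
rewrite (ge0_integralD _ measurableT _ mi2 _ mj2); first last.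
- by move=> y _; apply: mule_ge0; [exact: p2|exact: j0].
- by move=> y _; apply: mule_ge0; [exact: p2|exact: i0].
rewrite (@ge0_integralZl _ _ _ mu setT measurableT _ mi 2%:E (fun z _ => i0 z) p2).
rewrite (@ge0_integralZl _ _ _ mu setT measurableT _ mj 2%:E (fun z _ => j0 z) p2).
rewrite [X in (_ + _ * X)%E](ge0_exchange_integral _ _ mF' (fun z y => F0 y z)).
set S := (\int[mu]_z \int[mu]_y F z y)%E.
rewrite -(ge0_muleDl _ p2 p2) -EFinD (_ : 2 + 2 = 4 :> R); last by ring.
rewrite (EFinM 4) -muleA; apply: lee_wpmul2l; last exact: FF.
by rewrite lee_fin.
Qed.

Let W y := V y ^+ 2.
Let A := (2 * a) ^+ n.

Let WE : W = (fun y => v y ^+ 2) \_ Q.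
Proof.
by apply/funext => y; rewrite /W /V !patchE; case: ifPn; rewrite ?expr0n.
Qed.

Let integrable_patch (f : 'rV[R]_n -> R) :
  (forall y, D y -> {for y, continuous f}) -> mu.-integrable setT (EFin \o (f \_ Q)).
Proof.
move=> cf; rewrite -restrict_EFin; apply/(integrable_mkcond _ mQ).
exact: (continuous_on_integrable oD (@compact_cube _ _ x a) QD (leb_cube_lty x a) cf).
Qed.

Let iV : mu.-integrable setT (EFin \o V).
Proof. exact: integrable_patch. Qed.

Let iW : mu.-integrable setT (EFin \o W).
Proof.
rewrite WE; apply: integrable_patch => y Dy.
have cvy := cv Dy; exact: (cvgM cvy cvy).
Qed.

Let qE : q = (cst 1 : 'rV[R]_n -> R) \_ Q.
Proof. by apply/funext => y; rewrite /q indicE patchE; case: ifPn. Qed.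

Let iq : mu.-integrable setT (EFin \o q).
Proof. by rewrite qE; apply: integrable_patch => y _; exact: (@cst_continuous _ _ (1 : R)). Qed.

Let Rq : \int[mu]_y q y = A.
Proof.
rewrite qE -Rintegral_mkcond Rintegral_cst// mul1r.
by rewrite [X in fine X](leb_cube x (ltW a0)).
Qed.

Let I := \int[mu]_y V y.
Let J := \int[mu]_y W y.

Let Rlin (c1 c2 c3 : R) (f1 f2 f3 : 'rV[R]_n -> R) :
  mu.-integrable setT (EFin \o f1) -> mu.-integrable setT (EFin \o f2) ->
  mu.-integrable setT (EFin \o f3) ->
  (\int[mu]_y (c1 * f1 y + c2 * f2 y + c3 * f3 y)%:E =
   (c1 * \int[mu]_y f1 y + c2 * \int[mu]_y f2 y + c3 * \int[mu]_y f3 y)%:E)%E.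
Proof.
move=> i1 i2 i3.
have iZ (c : R) (f : 'rV[R]_n -> R) : mu.-integrable setT (EFin \o f) ->
    mu.-integrable setT (EFin \o (fun y => c * f y)).
  by move=> if_; exact: (integrableZl measurableT c if_).
have j1 := iZ c1 _ i1; have j2 := iZ c2 _ i2; have j3 := iZ c3 _ i3.
have j12 : mu.-integrable setT (EFin \o (fun y => c1 * f1 y + c2 * f2 y)).
  exact: (integrableD measurableT j1 j2).
have j123 : mu.-integrable setT (EFin \o (fun y => c1 * f1 y + c2 * f2 y + c3 * f3 y)).
  exact: (integrableD measurableT j12 j3).
rewrite -[LHS]fineK; last exact: integrable_fin_num j123.
congr EFin; rewrite -[LHS]/(\int[mu]_y (c1 * f1 y + c2 * f2 y + c3 * f3 y)).
by rewrite (RintegralD _ j12 j3)// (RintegralD _ j1 j2)// !RintegralZl.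
Qed.

Let Vn0 y : ~ Q y -> V y = 0.
Proof. by move=> nQy; rewrite /V patchE memNset. Qed.

(** The variance identity, obtained by expanding the square with [A] the volume, [I] the integral
    and [J] the integral of the square. *)
Let HE : (\int[mu]_z \int[mu]_y (H z y)%:E = (2 * (A * J - I ^+ 2))%:E)%E.
Proof.
transitivity (\int[mu]_z (J * q z + (- 2 * I) * V z + A * W z)%:E)%E.
  apply: eq_integral => z _.
  rewrite (eq_integral (fun y => (q z * W y + (- 2 * V z) * V y + W z * q y)%:E)); last first.
    move=> y _; congr EFin; rewrite /H /W.
    have [Qz|nQz] := pselect (Q z); last first.
      by rewrite (qn0 nQz) (Vn0 nQz); ring.
    have [Qy|nQy] := pselect (Q y); last first.
      by rewrite (qn0 nQy) (Vn0 nQy); ring.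
    by rewrite (q1 Qz) (q1 Qy); ring.
  by rewrite Rlin// Rq -/I -/J; congr EFin; ring.
by rewrite Rlin// Rq -/I -/J; congr EFin; ring.
Qed.

(** Divide [HH] by 2 A: half of 4 n (2 a)^2 2^n is 8 n 2^n a^2. The mean stays as a separate term
    because it is the part that passes to the weak limit. *)
Lemma poincare_cube :
  \int[mu]_(y in Q) (v y ^+ 2) <=
  ((2 * a) ^+ n)^-1 * (\int[mu]_(y in Q) v y) ^+ 2 +
  8 * n%:R * 2 ^+ n * a ^+ 2 * \int[mu]_(y in Q) sqr_grad v y.
Proof.
have iG : mu.-integrable setT (EFin \o (sqr_grad v \_ Q)).
  by apply: integrable_patch => y; exact: (continuous_sqr_grad C1v).
have IGE : IG = (\int[mu]_(y in Q) sqr_grad v y)%:E.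
  rewrite Rintegral_mkcond fineK; last exact: integrable_fin_num iG.
  by rewrite /IG /G restrict_EFin.
have JE : \int[mu]_(y in Q) (v y ^+ 2) = J by rewrite Rintegral_mkcond -WE.
have IE : \int[mu]_(y in Q) v y = I by rewrite Rintegral_mkcond.
rewrite JE IE -/A.
move: HH; rewrite HE IGE -EFinM lee_fin -/A.
move: (\int[mu]_(y in Q) sqr_grad v y) => g.
have A0 : 0 < A by rewrite exprn_gt0// mulr_gt0.
move=> h; rewrite -(ler_pM2l A0) mulrDr mulrA mulfV ?gt_eqF// mul1r.
by move: h; rewrite /d2; move: A I J (2 ^+ n : R) => A' I' J' N; lra.
Qed.

End poincare.

(** * Integrals over spheres *)

Section spheres.
Context {R : realType} {N : nat}.
Local Notation E := 'rV[R]_N.+1.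
Local Notation mu := (leb N.+1).
Variables (D : set E) (x : E) (b : R).
Hypothesis oD : open D.
Hypothesis QD : cube x b `<=` D.
Local Notation Q := (cube x b).
Local Notation B := (eball (0 : E) 1).
Local Notation I := (`]0, b[%classic : set R).
Local Notation RR := (measurableTypeR R).

(** At the origin the inverse of 0 is 0, so the direction is 0 and not a unit vector; hence bounds
    by 1 below, where equality would fail. *)
Definition direction (y : E) : E := (enorm y)^-1 *: y.

Local Notation w := direction.

Lemma sqr_enorm (y : E) : enorm y ^+ 2 = \sum_j y ord0 j ^+ 2.
Proof. by rewrite sqr_sqrtr// sumr_ge0// => j _; exact: sqr_ge0. Qed.

Lemma sum_sqr_direction_le1 (y : E) : \sum_j w y ord0 j ^+ 2 <= 1.
Proof.
rewrite -sqr_enorm /direction enormZ ger0_norm ?invr_ge0 ?enorm_ge0//.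
have [->|e0] := eqVneq (enorm y) 0; first by rewrite mulr0 expr0n.
by rewrite mulVf// expr1n.
Qed.

Lemma direction_le1 (y : E) j : `|w y ord0 j| <= 1.
Proof.
have := sum_sqr_direction_le1 y; rewrite (bigD1 j)//= => h.
have h2 : 0 <= \sum_(i < N.+1 | i != j) w y ord0 i ^+ 2.
  by apply: sumr_ge0 => i _; exact: sqr_ge0.
rewrite -(@ler_pXn2r _ 2%N) ?nnegrE// expr1n real_normK ?num_real//.
by apply: le_trans h; rewrite lerDl.
Qed.

Lemma measurable_direction : measurable_fun setT w.
Proof.
apply: measurable_scale_rV => //.
exact: (measurableT_comp (@measurable_inv R) (@measurable_enorm R N.+1)).
Qed.

Lemma sphere_integralE r (h : E -> R) : sphere_integral x r h =
  N.+1%:R * r ^+ N * \int[mu]_(y in B) h (x + r *: w y).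
Proof.
by congr (_ * fine _); apply: eq_integral => y _; rewrite /w scalerA.
Qed.

Let rayQ r y : I r -> Q (x + r *: w y).
Proof.
rewrite /= in_itv/= => /andP[r0 rb]; apply/cubeP => j.
rewrite mxE addrAC subrr add0r mxE normrM gtr0_norm//.
by rewrite (le_trans (ler_wpM2l _ (direction_le1 y j))) ?mulr1 ?ltW.
Qed.

Let rayD r y : I r -> D (x + r *: w y).
Proof. by move=> /rayQ h; exact/QD/h. Qed.

Let mQ : measurable Q. Proof. exact: measurable_cube. Qed.

Let mB : measurable B. Proof. exact: measurable_eball. Qed.

Let Boo : (mu B < +oo)%E.
Proof.
apply: le_lt_trans (leb_cube_lty (0 : E) 1); apply: le_measure; rewrite ?inE//.
  exact: measurable_cube.
by move=> y /eball_closed_eball /closed_eball_cube.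
Qed.

Let mray r : measurable_fun setT (fun y => x + r *: w y).
Proof.
apply: measurable_add_rV => //; apply: measurable_scale_rV => //.
exact: measurable_direction.
Qed.

Let measurable_on_ray (h : E -> R) r : I r ->
  (forall y, D y -> {for y, continuous h}) ->
  measurable_fun B (fun y => h (x + r *: w y)).
Proof.
move=> Ir ch; have mhQ : measurable_fun setT (h \_ Q).
  apply/(measurable_restrictT _ _).1 => //.
  apply: (measurable_funS _ QD); first exact: open_measurable_rV.
  exact: continuous_on_measurable.
apply: measurable_funTS.
rewrite (_ : (fun y => _) = (h \_ Q) \o (fun y => x + r *: w y)).
  exact: (measurableT_comp mhQ).
by apply/funext => y /=; rewrite patchE mem_set//; exact: rayQ.
Qed.

(* What differentiation and continuity under the integral over [B] require. *)
Let regular (f : R -> E -> R) :=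
  [/\ forall r, I r -> measurable_fun B (f r),
      exists M, forall r y, I r -> `|f r y| <= M &
      forall r y, I r -> {for r, continuous (f ^~ y)}].

Let regular_ray (h : E -> R) : (forall y, D y -> {for y, continuous h}) ->
  regular (fun r y => h (x + r *: w y)).
Proof.
move=> ch; split.
- by move=> r Ir; exact: measurable_on_ray.
- have [M MP] := continuous_on_bounded (@compact_cube _ _ x b) QD ch.
  by exists M => r y Ir; apply: MP; exact: rayQ.
- move=> r y Ir; apply: (continuous_comp (@continuous_ray _ _ x (w y) r)).
  exact/ch/rayD.
Qed.

Let regular_weight (j : 'I_N.+1) f : regular f ->
  regular (fun r y => w y ord0 j * f r y).
Proof.
move=> [mf [M MP] cf]; split.
- move=> r Ir; apply: measurable_funM; last exact: mf.
  by apply: measurable_funTS; exact: (measurableT_comp (measurable_coord j) measurable_direction).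
- exists M => r y Ir; rewrite normrM -[leRHS]mul1r; apply: ler_pM => //.
    exact: direction_le1.
  exact: MP.
- by move=> r y Ir; apply: cvgM; [exact: cvg_cst|exact: cf].
Qed.

Let regular_sum (f : 'I_N.+1 -> R -> E -> R) : (forall j, regular (f j)) ->
  regular (fun r y => \sum_j f j r y).
Proof.
move=> rf; split.
- by move=> r Ir; apply: measurable_sum => j; have [mf _ _] := rf j; exact: mf.
- have /choice[M MP] : forall j, exists M, forall r y, I r -> `|f j r y| <= M.
    by move=> j; have [] := rf j.
  exists (\sum_j M j) => r y Ir; apply: le_trans (ler_norm_sum _ _ _) _.
  by apply: ler_sum => j _; exact: MP.
- by move=> r y Ir; apply: continuous_at_sum => j; have [_ _ cf] := rf j; exact: cf.
Qed.

Let integrable_regular f r : regular f -> I r -> mu.-integrable B (EFin \o f r).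
Proof.
move=> [mf [M MP] _] Ir; apply: measurable_bounded_integrable => //; first exact: mf.
by exists M; split => [|A /ltW MA y _]; [exact: num_real|exact: le_trans (MP r y Ir) MA].
Qed.

Let intB_cst c : mu.-integrable B (EFin \o (fun=> c : R)).
Proof.
apply: measurable_bounded_integrable => //.
by exists `|c|; split => [|A /ltW MA y _]; [exact: num_real|].
Qed.

Let continuous_regular f : regular f ->
  {in I, continuous (fun r : R => \int[mu]_(y in B) f r y)}.
Proof.
move=> rf; have [mf [M MP] cf] := rf.
apply: (@continuity_under_integral _ _ _ _ _ B mB 0 b _ _ (fun=> M)).
- by move=> r Ir; exact: integrable_regular.
- by apply: aeW => y _ r /set_mem Ir; exact: cf.
- exact: intB_cst.
- by move=> r Ir; apply: aeW => y _; exact: MP.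
Qed.

Lemma sphere_integral_continuous (h : E -> R) :
  (forall y, D y -> {for y, continuous h}) ->
  {in I, continuous (fun r : R => sphere_integral x r h)}.
Proof.
move=> ch r Ir; under eq_fun do rewrite sphere_integralE.
apply: cvgM; last exact: (continuous_regular (regular_ray ch)).
by apply: cvgM; [exact: cvg_cst|exact: exprn_continuous].
Qed.

(** Polar coordinates around [x], applied to [h] extended by zero outside the cube. The radii stay
    below [b], so the spheres lie in the cube and do not see the extension; the omitted radii
    contribute nonnegatively. *)
Lemma integral_sphere_integral_le (h : E -> R) r1 r2 : 0 < r1 -> r2 < b ->
  (forall y, 0 <= h y) -> (forall y, D y -> {for y, continuous h}) ->
  (\int[lebesgue_measure]_(r in `[r1, r2]) (sphere_integral x r h)%:E <=
   \int[mu]_(y in Q) (h y)%:E)%E.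
Proof.
(* The factor 1 casts the translation in the form required by the affine change of variables. *)
move=> r10 r2b h0 ch; pose H (z : E) := ((EFin \o h) \_ Q) (x + 1 *: z).
have mhQ : measurable_fun setT ((EFin \o h) \_ Q).
  apply/(measurable_restrictT _ _).1 => //; apply/measurable_EFinP.
  apply: (measurable_funS _ QD); first exact: open_measurable_rV.
  exact: continuous_on_measurable.
have hQ0 z : (0 <= ((EFin \o h) \_ Q) z)%E.
  by apply: erestrict_ge0 => y _; rewrite lee_fin.
have mH : measurable_fun setT H.
  by apply: (measurableT_comp mhQ); exact: measurable_affine_rV.
have H0 z : (0 <= H z)%E by exact: hQ0.
have -> : (\int[mu]_(y in Q) (h y)%:E = \int[mu]_z H z)%E.
  rewrite integral_mkcond (ge0_integral_leb_affine x ltr01 mhQ hQ0).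
  by rewrite expr1n invr1 mul1e.
rewrite -(polar_coordinates mH H0).
pose K (t : RR) (y : E) : \bar R :=
  ((\1_(`]0, +oo[%classic : set R) t * (N.+1%:R * t ^+ N) * \1_B y)%:E * H (t *: w y))%E.
have K0 t y : (0 <= K t y)%E.
  apply: mule_ge0; last exact: H0.
  rewrite lee_fin indicE; have [/set_mem|] := boolP (t \in _).
    rewrite /= in_itv/= andbT => t0.
    by rewrite !mulr_ge0// ?indicE// exprn_ge0// ltW.
  by rewrite !mul0r.
have mK : measurable_fun setT (fun p : RR * E => K p.1 p.2).
  apply: emeasurable_funM.
    apply/measurable_EFinP; apply: measurable_funM; first apply: measurable_funM.
    - apply: (measurableT_comp _ (@measurable_fst _ _ RR E)).
      by apply: measurable_indic; exact: measurable_itv.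
    - by apply: measurable_funM => //; exact: measurable_funX.
    - apply: (measurableT_comp _ (@measurable_snd _ _ RR E)).
      exact: measurable_indic.
  apply: (measurableT_comp mH); apply: measurable_scale_rV => //.
  exact: (measurableT_comp measurable_direction).
have KE t : 0 < t -> (\int[mu]_y K t y =
    \int[mu]_(y in B) ((N.+1%:R * t ^+ N)%:E * H ((t / enorm y) *: y)))%E.
  move=> t0; rewrite [RHS]integral_mkcond; apply: eq_integral => y _.
  rewrite patchE /K [\1_`]0, +oo[ t]indicE mem_set/= ?in_itv/= ?andbT// mul1r indicE.
  by case: ifPn => _; rewrite ?mulr1 ?mulr0 ?mul0e// scalerA.
have mI : measurable_fun setT (fun t : RR => \int[mu]_y K t y)%E.
  exact: measurable_ge0_integral.
apply: (@le_trans _ _ (\int[lebesgue_measure]_(t in `[r1, r2]) \int[mu]_y K t y)%E).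
  rewrite le_eqVlt; apply/orP; left; apply/eqP; apply: eq_integral => t /set_mem/=.
  rewrite in_itv/= => /andP[r1t tr2].
  have t0 : 0 < t by exact: lt_le_trans r1t.
  have It : I t by rewrite /= in_itv/= t0 (le_lt_trans tr2).
  have ih : mu.-integrable B (EFin \o (fun y => h (x + t *: w y))).
    exact: (integrable_regular (regular_ray ch) It).
  rewrite KE// sphere_integralE EFinM fineK; last exact: integrable_fin_num ih.
  rewrite -ge0_integralZl//; first last.
  - by rewrite lee_fin mulr_ge0// exprn_ge0// ltW.
  - by move=> y _; rewrite lee_fin.
  - exact: (measurable_int _ ih).
  apply: eq_integral => y _; congr (_ * _)%E.
  by rewrite /H scale1r patchE -scalerA mem_set//; exact: rayQ.
rewrite (_ : (\int[lebesgue_measure]_(t in `]0%R, +oo[) _ =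
    \int[lebesgue_measure]_(t in `]0%R, +oo[) \int[mu]_y K t y)%E); last first.
  apply: eq_integral => t /set_mem/=; rewrite in_itv/= andbT => t0.
  by rewrite KE.
apply: ge0_subset_integral => //.
- exact: measurable_funTS.
- by move=> t _; exact: integral_ge0.
- move=> t /=; rewrite !in_itv/= andbT => /andP[r1t _]; exact: lt_le_trans r1t.
Qed.

Variable v : E -> R.
Hypothesis C1v : C1_on D v.

Let cv y : D y -> {for y, continuous v}. Proof. by have [cv _ _] := C1v; exact: cv. Qed.

Let cv2 y : D y -> {for y, continuous (fun y => v y ^+ 2)}.
Proof. by move=> Dy; have cvy := cv Dy; exact: (cvgM cvy cvy). Qed.

Let k (j : 'I_N.+1) (y : E) := 2 * v y * partial j v y.

Let ck j y : D y -> {for y, continuous (k j)}.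
Proof.
move=> Dy; have [_ _ /(_ j y Dy) cdv] := C1v; have cvy := cv Dy.
have c2 : {for y, continuous (fun=> 2 : R)} by exact: (@cst_continuous _ _ (2 : R)).
exact: (cvgM (cvgM c2 cvy) cdv).
Qed.

Let dray r y := \sum_j w y ord0 j * k j (x + r *: w y).

Let regular_dray : regular dray.
Proof.
by apply: regular_sum => j; apply: regular_weight; apply: regular_ray => y; exact: ck.
Qed.

(** The product rule for (N+1) r^N times an integral over directions. The first summand is
    nonnegative, so only the second has to be compensated. *)
Definition sphere_integral_deriv r :=
  N.+1%:R * (N%:R * r ^+ N.-1) * \int[mu]_(y in B) v (x + r *: w y) ^+ 2 +
  N.+1%:R * r ^+ N * \int[mu]_(y in B) dray r y.

Let is_derive_sqr_ray r y : I r ->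
  is_derive r (1 : R) (fun s : R => v (x + s *: w y) ^+ 2) (dray r y).
Proof.
move=> Ir; have [_ dv cdv] := C1v.
have dr := is_derive_ray oD dv cdv (rayD y Ir).
apply: (is_derive_eq (is_deriveX 2 dr)).
rewrite /dray /GRing.scale/= expr1 mulr_sumr; apply: eq_bigr => j _.
by rewrite /k; ring.
Qed.

Let is_derive_int r : I r ->
  is_derive r (1 : R) (fun s : R => \int[mu]_(y in B) v (x + s *: w y) ^+ 2)
    (\int[mu]_(y in B) dray r y).
Proof.
move=> Ir; have rv2 := regular_ray cv2.
have [M MP] : exists M, forall r y, I r -> `|dray r y| <= M by case: regular_dray.
have intf s : I s -> mu.-integrable B (EFin \o (fun y => v (x + s *: w y) ^+ 2)).
  exact: integrable_regular rv2.
have M0 : 0 <= M by apply: le_trans (MP r 0 Ir).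
have d1 s y : I s -> ((fun s : R => v (x + s *: w y) ^+ 2)^`())%classic s = dray s y.
  by move=> Is; rewrite derive1E; have [_ ->] := is_derive_sqr_ray y Is.
have derf s y : I s -> B y -> derivable (fun s : R => v (x + s *: w y) ^+ 2) s 1.
  by move=> Is _; have [] := is_derive_sqr_ray y Is.
have ub s y : I s -> B y ->
    `|partial1of2 (fun (s : R) y => v (x + s *: w y) ^+ 2) s y| <= M.
  by move=> Is _; rewrite /partial1of2 d1//; exact: MP.
constructor.
  exact: (derivable_under_integral mB Ir intf derf (fun=> M0) (intB_cst M) ub).
rewrite -derive1E (differentiation_under_integral mB Ir intf derf (fun=> M0) (intB_cst M) ub).
by apply: eq_Rintegral => y _; rewrite /partial1of2 d1.
Qed.

Lemma is_derive_sphere_integral r : I r ->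
  is_derive r (1 : R) (fun s : R => sphere_integral x s (fun y => v y ^+ 2))
    (sphere_integral_deriv r).
Proof.
move=> Ir; under eq_fun do rewrite sphere_integralE.
have dp : is_derive r (1 : R) (fun s : R => s ^+ N) (N%:R * r ^+ N.-1).
  have := is_deriveX N (@is_derive_id _ R r 1).
  by rewrite /GRing.scale/= mulr1 exprfctE.
have dpn : is_derive r (1 : R) (fun s : R => N.+1%:R * s ^+ N) (N.+1%:R * (N%:R * r ^+ N.-1)).
  exact: is_deriveZ.
apply: (is_derive_eq (is_deriveM dpn (is_derive_int Ir))).
by rewrite /sphere_integral_deriv /GRing.scale/= addrC [X in X + _ = _]mulrC.
Qed.

Lemma continuous_sphere_integral_deriv : {in I, continuous sphere_integral_deriv}.
Proof.
move=> r Ir; apply: cvgD; apply: cvgM.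
- apply: cvgM; first exact: cvg_cst.
  by apply: cvgM; [exact: cvg_cst|exact: exprn_continuous].
- exact: (continuous_regular (regular_ray cv2)).
- by apply: cvgM; [exact: cvg_cst|exact: exprn_continuous].
- exact: (continuous_regular regular_dray).
Qed.

(* AM-GM: [2 v (Dv . w) >= - (p |Dv|^2 + v^2 / p)] since [|w| <= 1]. *)
Lemma sphere_integral_deriv_ge r p : I r -> 0 < p ->
  0 <= sphere_integral_deriv r + p * sphere_integral x r (sqr_grad v)
       + p^-1 * sphere_integral x r (fun y => v y ^+ 2).
Proof.
move=> Ir p0; have := Ir; rewrite /= in_itv/= => /andP[r0 _].
rewrite /sphere_integral_deriv !sphere_integralE.
set G2 := \int[mu]_(y in B) _ ^+ 2; set Gd := \int[mu]_(y in B) dray r y.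
set Gg := \int[mu]_(y in B) sqr_grad _ _.
have G20 : 0 <= G2 by apply: Rintegral_ge0 => y _; exact: sqr_ge0.
have rg := regular_ray (fun y => continuous_sqr_grad C1v).
suff h : 0 <= Gd + p * Gg + p^-1 * G2.
  rewrite -addrA -addrA; apply: addr_ge0.
    by rewrite !mulr_ge0// exprn_ge0// ltW.
  rewrite [leRHS](_ : _ = N.+1%:R * r ^+ N * (Gd + p * Gg + p^-1 * G2)); last by ring.
  by rewrite !mulr_ge0// exprn_ge0// ltW.
have i1 := integrable_regular regular_dray Ir.
have i2 := integrable_regular rg Ir; have i3 := integrable_regular (regular_ray cv2) Ir.
have j2 : mu.-integrable B (EFin \o (fun y => p * sqr_grad v (x + r *: w y))).
  exact: (integrableZl mB p i2).
have j3 : mu.-integrable B (EFin \o (fun y => p^-1 * v (x + r *: w y) ^+ 2)).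
  exact: (integrableZl mB p^-1 i3).
have j12 : mu.-integrable B (EFin \o (fun y => dray r y + p * sqr_grad v (x + r *: w y))).
  exact: (integrableD mB i1 j2).
rewrite /Gd /Gg /G2 -(RintegralZl _ mB i2) -(RintegralZl _ mB i3).
rewrite -(RintegralD mB i1 j2) -(RintegralD mB j12 j3).
apply: Rintegral_ge0 => y _; rewrite /dray /sqr_grad mulr_sumr -big_split/=.
set z := x + r *: w y.
(* The term v^2 / p is distributed over the coordinates with weights w_j^2, whose sum is at most 1.
   What remains is then a sum of squares, coordinate by coordinate. *)
apply: (@le_trans _ _ (\sum_j (p^-1 * v z ^+ 2 * (- w y ord0 j ^+ 2)) + p^-1 * v z ^+ 2)).
  rewrite -mulr_sumr sumrN mulrN addrC -[X in X - _]mulr1 -mulrBr.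
  apply: mulr_ge0; first by rewrite mulr_ge0 ?sqr_ge0// invr_ge0 ltW.
  by rewrite subr_ge0 sum_sqr_direction_le1.
rewrite lerD2r; apply: ler_sum => j _; rewrite /k -subr_ge0.
rewrite [leRHS](_ : _ = p^-1 * (v z * w y ord0 j + p * partial j v z) ^+ 2).
  by rewrite mulr_ge0 ?sqr_ge0// invr_ge0 ltW.
by field; rewrite gt_eqF.
Qed.

End spheres.

(** * Lower limits of extended real sequences, and two integration lemmas *)

Section limn_einf.
Context {R : realType}.
Implicit Types (u : (\bar R)^nat) (c : \bar R).

Lemma limn_einf_ereal_sup u : limn_einf u = ereal_sup (range (einfs u)).
Proof. by rewrite limn_einf_lim; apply: cvg_lim => //; exact: cvg_einfs_sup. Qed.

Lemma lt_limn_einf_near c u : (c < limn_einf u)%E ->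
  \forall i \near \oo, (c < u i)%E.
Proof.
rewrite limn_einf_ereal_sup => /ereal_sup_gt[_ [n _ <-] cn].
exists n => // i /= ni; apply: (lt_le_trans cn).
by apply: ereal_inf_lbound; exists i.
Qed.

Lemma near_le_limn_einf c u : (\forall i \near \oo, (c <= u i)%E) ->
  (c <= limn_einf u)%E.
Proof.
move=> [n _ nP]; rewrite limn_einf_ereal_sup.
apply: (@le_trans _ _ (einfs u n)); last by apply: ereal_sup_ubound; exists n.
by apply: le_ereal_inf_tmp => _ [i /= ni <-]; exact: nP.
Qed.

Lemma near_limn_einf_le c u : (\forall i \near \oo, (u i <= c)%E) ->
  (limn_einf u <= c)%E.
Proof.
move=> [n _ nP]; rewrite limn_einf_ereal_sup.
apply: ge_ereal_sup => _ [m _ <-].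
apply: (@le_trans _ _ (u (maxn m n))); last by apply: nP; exact: leq_maxr.
by apply: ereal_inf_lbound; exists (maxn m n) => //=; exact: leq_maxl.
Qed.

End limn_einf.

Lemma le_Rintegral_subset (R : realType) d (T : measurableType d)
    (mu : {measure set T -> \bar R}) (A B : set T) (f : T -> R) :
  measurable A -> measurable B -> A `<=` B -> mu.-integrable B (EFin \o f) ->
  (forall y, B y -> 0 <= f y) -> \int[mu]_(y in A) f y <= \int[mu]_(y in B) f y.
Proof.
move=> mA mB AB fi f0; apply: fine_le.
- exact/integrable_fin_num/(integrableS mB mA AB fi).
- exact: integrable_fin_num fi.
- by apply: ge0_subset_integral => //; exact: measurable_int fi.
Qed.

Lemma integrable_norm_powR (R : realType) n (D K : set 'rV[R]_n) (v : 'rV[R]_n -> R) p :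
  open D -> compact K -> K `<=` D -> (leb n K < +oo)%E -> 0 <= p ->
  (forall y, D y -> {for y, continuous v}) ->
  (leb n).-integrable K (EFin \o (fun y => `|v y| `^ p)).
Proof.
move=> oD cK KD Koo p0 cv.
have mK : measurable K.
  by apply: closed_measurable_rV; apply: compact_closed => //; exact: norm_hausdorff.
have mv : measurable_fun K v.
  apply: (measurable_funS _ KD); first exact: open_measurable_rV.
  exact: continuous_on_measurable.
apply: measurable_bounded_integrable => //.
  apply: (measurableT_comp (measurable_powR p)).
  exact: (measurableT_comp (@normr_measurable R setT)).
have [M MP] := continuous_on_bounded cK KD cv.
exists (M `^ p); split => [|A /ltW MA y Ky /=]; first exact: num_real.
apply: le_trans MA; rewrite ger0_norm ?powR_ge0// ge0_ler_powR ?nnegrE//.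
  by apply: le_trans (MP y Ky).
exact: MP.
Qed.

(** * Averaging the local energy over radii *)

Section concentration.
Context {R : realType} {N : nat}.
Local Notation E := 'rV[R]_N.+1.
Local Notation mu := (leb N.+1).
Variables (D : set E) (x : E) (rho : R).
Hypothesis oD : open D.
Hypothesis rho01 : 0 < rho <= 1.
Hypothesis QD : cube x (3 * rho) `<=` D.
Local Notation Q := (cube x (3 * rho)).
Variable p : R.
Hypothesis p0 : 0 <= p.

Let rho0 : 0 < rho. Proof. by case/andP : rho01. Qed.

Let Kitv (r : R) : r \in `[rho, 2 * rho] -> 0 < r < 3 * rho.
Proof.
by rewrite in_itv/= => /andP[r1 r2]; move: rho0 => r0; apply/andP; split; lra.
Qed.

Let KI (r : R) : r \in `[rho, 2 * rho] -> (`]0, 3 * rho[%classic : set R) r.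
Proof. by move=> /Kitv; rewrite /= in_itv. Qed.

Section one_function.
Variable v : E -> R.
Hypothesis C1v : C1_on D v.

Let P := \int[mu]_(y in Q) (`|v y| `^ p).
Let G := \int[mu]_(y in Q) sqr_grad v y.
Let J := \int[mu]_(y in Q) (v y ^+ 2).
Let S (r : R) := sphere_integral x r (fun y => v y ^+ 2).
Let T (r : R) := sphere_integral x r (sqr_grad v).
(** Bounds the two undifferentiated terms of the local energy for all radii between rho and 2 rho at
    once. *)
Let alpha := P + rho^-1 * J.

(* The derivative of [(2 rho - r) S r] plus terms making it nonnegative. *)
Definition averaged_energy (r : R) : R :=
  ((2 * rho - r) * sphere_integral_deriv x v r - S r) +
  (2 * S r + rho * alpha + rho ^+ 2 * T r).

Let cv y : D y -> {for y, continuous v}. Proof. by have [cv _ _] := C1v; exact: cv. Qed.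

Let cv2 y : D y -> {for y, continuous (fun y => v y ^+ 2)}.
Proof. by move=> Dy; have cvy := cv Dy; exact: (cvgM cvy cvy). Qed.

Let cg y : D y -> {for y, continuous (sqr_grad v)}.
Proof. exact: continuous_sqr_grad C1v. Qed.

Let mQ : measurable Q. Proof. exact: measurable_cube. Qed.

Let integrable_cont f : (forall y, D y -> {for y, continuous f}) ->
  mu.-integrable Q (EFin \o f).
Proof.
exact: (continuous_on_integrable oD (@compact_cube _ _ x _) QD (leb_cube_lty x _)).
Qed.

Let iP : mu.-integrable Q (EFin \o (fun y => `|v y| `^ p)).
Proof.
exact: (integrable_norm_powR oD (@compact_cube _ _ x _) QD (leb_cube_lty x _) p0 cv).
Qed.

Let P0 : 0 <= P. Proof. by apply: Rintegral_ge0 => y _; exact: powR_ge0. Qed.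
Let J0 : 0 <= J. Proof. by apply: Rintegral_ge0 => y _; exact: sqr_ge0. Qed.
Let G0 : 0 <= G. Proof. by apply: Rintegral_ge0 => y _; exact: sqr_grad_ge0. Qed.

Let alpha0 : 0 <= alpha.
Proof. by rewrite addr_ge0// mulr_ge0// invr_ge0 ltW. Qed.

Let sphere_ge0 (h : E -> R) r : 0 <= r -> (forall y, 0 <= h y) -> 0 <= sphere_integral x r h.
Proof.
by move=> r0 h0; rewrite !mulr_ge0 ?exprn_ge0//; apply: Rintegral_ge0.
Qed.

Let S0 (r : R) : r \in `[rho, 2 * rho] -> 0 <= S r.
Proof.
by move=> /Kitv /andP[r0 _]; apply: sphere_ge0 => [|y]; [exact: ltW|exact: sqr_ge0].
Qed.

Let T0 (r : R) : r \in `[rho, 2 * rho] -> 0 <= T r.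
Proof.
by move=> /Kitv /andP[r0 _]; apply: sphere_ge0 => [|y]; [exact: ltW|exact: sqr_grad_ge0].
Qed.

(** The AM-GM bound with parameter rho is multiplied by the weight, which lies between 0 and rho: it
    gives (2 rho - r) S' >= - S - rho^2 T. Of the two copies of [S] in [averaged_energy], one
    cancels the derivative of the weight and the other pays for this bound. *)
Let averaged_energy_lower (r : R) : r \in `[rho, 2 * rho] ->
  0 <= averaged_energy r /\
  (2 * rho - r) * (alpha + sphere_integral_deriv x v r) <= averaged_energy r.
Proof.
move=> rI; have Sr := S0 rI; have Tr := T0 rI.
have h := sphere_integral_deriv_ge oD QD C1v (KI rI) rho0.
rewrite -/(S r) -/(T r) in h; rewrite /averaged_energy.
move: (sphere_integral_deriv x v r) h => S' h.
have := rI; rewrite in_itv/= => /andP[r1 r2].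
have w0 : 0 <= 2 * rho - r by lra.
have w1 : 2 * rho - r <= rho by lra.
have hw := mulr_ge0 w0 h; rewrite !mulrDr in hw.
have e1 : (2 * rho - r) * (rho * T r) <= rho ^+ 2 * T r.
  by rewrite mulrA expr2 ler_wpM2r// ler_wpM2r// ltW.
have e2 : (2 * rho - r) * (rho^-1 * S r) <= S r.
  by rewrite mulrA; apply: ler_piMl => //; rewrite ler_pdivrMr// mul1r.
have e3 : (2 * rho - r) * alpha <= rho * alpha by rewrite ler_wpM2r.
have e4 := mulr_ge0 (ltW rho0) alpha0.
have e5 := mulr_ge0 (sqr_ge0 rho) Tr.
by split; lra.
Qed.

Let ball_integral_le (f : E -> R) r : r \in `[rho, 2 * rho] ->
  mu.-integrable Q (EFin \o f) -> (forall y, 0 <= f y) ->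
  \int[mu]_(y in eball x r) f y <= \int[mu]_(y in Q) f y.
Proof.
move=> /Kitv/andP[_ r3] fi f0; apply: le_Rintegral_subset => //.
  exact: measurable_eball.
by move=> y /eball_closed_eball /closed_eball_cube; apply: sub_cube; exact: ltW.
Qed.

Lemma averaged_energy_ge0 (r : R) : r \in `[rho, 2 * rho] -> 0 <= averaged_energy r.
Proof. by move=> /averaged_energy_lower[]. Qed.

Lemma averaged_energy_ge (r : R) : r \in `[rho, 2 * rho] ->
  (2 * rho - r) * (\int[mu]_(y in eball x r) (`|v y| `^ p)
    + derive1 (fun s => sphere_integral x s (fun y => v y ^+ 2)) r
    + r^-1 * \int[mu]_(y in eball x r) (v y ^+ 2)) <= averaged_energy r.
Proof.
move=> rI; have [_] := averaged_energy_lower rI; apply: le_trans.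
have := rI; rewrite in_itv/= => /andP[r1 r2].
apply: ler_wpM2l; first by rewrite subr_ge0.
rewrite derive1E; have [_ ->] := is_derive_sphere_integral oD QD C1v (KI rI).
rewrite addrAC lerD2r /alpha; apply: lerD.
  by apply: ball_integral_le => // y; exact: powR_ge0.
apply: ler_pM.
- by rewrite invr_ge0 (le_trans (ltW rho0)).
- by apply: Rintegral_ge0 => y _; exact: sqr_ge0.
- by rewrite lef_pV2 ?posrE// (lt_le_trans rho0).
- apply: ball_integral_le => //; first exact: integrable_cont.
  by move=> y; exact: sqr_ge0.
Qed.

Let continuous_on_annulus (h : E -> R) : (forall y, D y -> {for y, continuous h}) ->
  forall r : R, r \in `[rho, 2 * rho] ->
    {for r, continuous (fun r : R => sphere_integral x r h)}.
Proof.
move=> ch r /KI Ir; apply: (sphere_integral_continuous oD QD ch).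
exact: mem_set.
Qed.

Let Psi r := (2 * rho - r) * sphere_integral_deriv x v r - S r.

Let cPsi (r : R) : r \in `[rho, 2 * rho] -> {for r, continuous Psi}.
Proof.
move=> rI; apply: cvgB; last exact: continuous_on_annulus rI.
apply: cvgM; first by apply: cvgB; [exact: cvg_cst|exact: cvg_id].
by apply: (continuous_sphere_integral_deriv oD QD C1v); exact/mem_set/KI.
Qed.

Let dPsi (r : R) : r \in `[rho, 2 * rho] ->
  is_derive r (1 : R) (fun r : R => (2 * rho - r) * S r) (Psi r).
Proof.
move=> rI; have dS := is_derive_sphere_integral oD QD C1v (KI rI).
have dw : is_derive r (1 : R) (fun r : R => 2 * rho - r) (-1).
  apply: (is_derive_eq (is_deriveB (@is_derive_cst _ R R (2 * rho) r 1) (@is_derive_id _ R r 1))).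
  by rewrite sub0r.
apply: (is_derive_eq (is_deriveM dw dS)).
by rewrite /Psi /GRing.scale/= mulrN1.
Qed.

Let rest r := 2 * S r + rho * alpha + rho ^+ 2 * T r.

Let crest (r : R) : r \in `[rho, 2 * rho] -> {for r, continuous rest}.
Proof.
move=> rI; apply: cvgD; last first.
  by apply: cvgM; [exact: cvg_cst|exact: continuous_on_annulus rI].
apply: cvgD; last exact: cvg_cst.
by apply: cvgM; [exact: cvg_cst|exact: continuous_on_annulus rI].
Qed.

Lemma integrable_averaged_energy :
  lebesgue_measure.-integrable `[rho, 2 * rho] (EFin \o averaged_energy).
Proof.
apply: continuous_on_itv_integrable => r rI.
by apply: cvgD; [exact: cPsi|exact: crest].
Qed.

Let integral_sphere_le (h : E -> R) : (forall y, 0 <= h y) ->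
  (forall y, D y -> {for y, continuous h}) ->
  (\int[lebesgue_measure]_(r in `[rho, (2 * rho)%R]) (sphere_integral x r h)%:E <=
   (\int[mu]_(y in Q) h y)%:E)%E.
Proof.
move=> h0 ch; rewrite fineK; last exact/integrable_fin_num/integrable_cont.
by apply: (integral_sphere_integral_le oD QD) => //; move: rho0 => ?; lra.
Qed.

(** [Psi] is an exact derivative and [rest] integrates to at most 2 J + rho^2 alpha + rho^2 G. Since
    rho <= 1, rho^2 alpha is at most rho^2 P + J; the total coefficient 3 of J gives the
    constant. *)
Lemma integral_averaged_energy_le :
  (\int[lebesgue_measure]_(r in `[rho, (2 * rho)%R]) (averaged_energy r)%:E <=
   (3 * rho ^+ 2 * (P + G + (rho ^+ 2)^-1 * J))%:E)%E.
Proof.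
have r12 : rho < 2 * rho by move: rho0 => ?; lra.
have S2 := integral_sphere_le (fun y => sqr_ge0 (v y)) cv2.
have T2 := integral_sphere_le (sqr_grad_ge0 v) cg.
have mI : measurable (`[rho, 2 * rho]%classic : set (measurableTypeR R)).
  exact: measurable_itv.
have iS := continuous_on_itv_integrable (continuous_on_annulus cv2).
have iT := continuous_on_itv_integrable (continuous_on_annulus cg).
have i2S : lebesgue_measure.-integrable `[rho, 2 * rho] (EFin \o (fun r => 2 * S r)).
  exact: (integrableZl mI 2 iS).
have iC : lebesgue_measure.-integrable `[rho, 2 * rho] (EFin \o (fun _ : R => rho * alpha)).
  by apply: continuous_on_itv_integrable => r _; exact: cvg_cst.
have i2T : lebesgue_measure.-integrable `[rho, 2 * rho] (EFin \o (fun r => rho ^+ 2 * T r)).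
  exact: (integrableZl mI (rho ^+ 2) iT).
have iSC : lebesgue_measure.-integrable `[rho, 2 * rho]
    (EFin \o (fun r => 2 * S r + rho * alpha)).
  exact: (integrableD mI i2S iC).
rewrite (@integralD_EFin _ _ _ lebesgue_measure _ mI Psi rest); last 2 first.
- exact: continuous_on_itv_integrable cPsi.
- exact: continuous_on_itv_integrable crest.
rewrite (integral_is_derive r12 dPsi cPsi).
rewrite (@integralD_EFin _ _ _ lebesgue_measure _ mI _ _ iSC i2T).
rewrite (@integralD_EFin _ _ _ lebesgue_measure _ mI _ _ i2S iC).
have -> : (\int[lebesgue_measure]_(r in `[rho, (2 * rho)%R])
    (EFin \o (fun r : R => (2 * S r)%R)) r =
    2%:E * \int[lebesgue_measure]_(r in `[rho, (2 * rho)%R]) (S r)%:E)%E.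
  exact: (integralZl mI iS 2).
have -> : (\int[lebesgue_measure]_(r in `[rho, (2 * rho)%R])
    (EFin \o (fun r : R => (rho ^+ 2 * T r)%R)) r =
    (rho ^+ 2)%:E * \int[lebesgue_measure]_(r in `[rho, (2 * rho)%R]) (T r)%:E)%E.
  exact: (integralZl mI iT (rho ^+ 2)).
have -> : (\int[lebesgue_measure]_(r in `[rho, (2 * rho)%R]) (EFin \o (fun=> (rho * alpha)%R)) r =
    (rho ^+ 2 * alpha)%:E)%E.
  rewrite (@integral_cst _ _ _ lebesgue_measure _ mI).
  rewrite [X in (_ * X)%E](lebesgue_measure_itv `[rho, 2 * rho])/= lte_fin r12.
  by rewrite -EFinB -EFinM; congr EFin; ring.
apply: (@le_trans _ _ ((- (rho * S rho))%:E + (2%:E * J%:E + (rho ^+ 2 * alpha)%:E +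
    (rho ^+ 2)%:E * G%:E))%E).
  (* The boundary term: the weight is 0 at 2 rho and rho at rho. *)
  apply: leeD; first by rewrite lee_fin subrr mul0r sub0r lerN2; lra.
  apply: leeD; first by apply: leeD => //; apply: lee_wpmul2l => //; rewrite lee_fin.
  by apply: lee_wpmul2l => //; rewrite lee_fin sqr_ge0.
rewrite -!EFinM -!EFinD lee_fin.
have Srho : 0 <= rho * S rho.
  by rewrite mulr_ge0 ?(ltW rho0)// S0// in_itv/= lexx ltW.
have h1 : rho ^+ 2 * (rho^-1 * J) <= J.
  rewrite (_ : _ * _ = rho * J); last by field; rewrite gt_eqF.
  by apply: ler_piMl => //; case/andP: rho01.
have h2 : rho ^+ 2 * ((rho ^+ 2)^-1 * J) = J.
  by rewrite mulrA mulfV ?mul1r// expf_neq0// gt_eqF.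
have h3 := mulr_ge0 (sqr_ge0 rho) P0; have h4 := mulr_ge0 (sqr_ge0 rho) G0.
rewrite /alpha mulrDr -[3 * _ * _]mulrA [_ * (P + G + _)]mulrDr h2 [_ * (P + G)]mulrDr.
by move: J0 => ?; lra.
Qed.

End one_function.

(** Fatou is applied on [rho, 3/2 rho], where the weight is at least rho / 2. An eventual lower
    bound eps / 2 gives the integrand rho eps / 4 and the integral rho^2 eps / 8; the upper bound on
    the larger interval [rho, 2 rho] is 3 rho^2 beta, whence 24. *)
Lemma concentration_le (v_ : nat -> E -> R) eps beta : 0 < eps ->
  (forall i, C1_on D (v_ i)) ->
  (forall r : R, r \in `[rho, 2 * rho] ->
    (eps%:E <= limn_einf (fun i =>
      (\int[mu]_(y in eball x r) (`|v_ i y| `^ p)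
       + derive1 (fun s => sphere_integral x s (fun y => v_ i y ^+ 2)) r
       + r^-1 * \int[mu]_(y in eball x r) (v_ i y ^+ 2))%:E))%E) ->
  (\forall i \near \oo, \int[mu]_(y in Q) (`|v_ i y| `^ p)
    + \int[mu]_(y in Q) sqr_grad (v_ i) y
    + (rho ^+ 2)^-1 * \int[mu]_(y in Q) (v_ i y ^+ 2) <= beta) ->
  eps <= 24 * beta.
Proof.
move=> eps0 C1v lower upper; set F := fun i => averaged_energy (v_ i).
have mI : measurable (`[rho, 2 * rho]%classic : set (measurableTypeR R)).
  exact: measurable_itv.
have mI' : measurable (`[rho, 3 / 2 * rho]%classic : set (measurableTypeR R)).
  exact: measurable_itv.
have sub (r : R) : r \in `[rho, 3 / 2 * rho] -> r \in `[rho, 2 * rho].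
  by rewrite !in_itv/= => /andP[-> r2]; move: rho0 => ?; rewrite (le_trans r2)//; lra.
have mF i : measurable_fun `[rho, 2 * rho] (EFin \o F i).
  exact: measurable_int (integrable_averaged_energy (C1v i)).
have mF' i : measurable_fun `[rho, 3 / 2 * rho] (EFin \o F i).
  by apply: measurable_funS (mF i) => //; exact: sub.
have F0 i r : (`[rho, 3 / 2 * rho]%classic : set R) r -> (0 <= (EFin \o F i) r)%E.
  by move=> /sub rI; rewrite lee_fin; exact: averaged_energy_ge0.
have := fatou lebesgue_measure mI' mF' F0.
have h1 : ((rho ^+ 2 * eps / 8)%:E <=
    \int[lebesgue_measure]_(r in `[rho, (3 / 2 * rho)%R]) limn_einf (fun i => (EFin \o F i) r))%E.
  have -> : (rho ^+ 2 * eps / 8)%:E =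
      (\int[lebesgue_measure]_(r in `[rho, (3 / 2 * rho)%R]) (rho * eps / 4)%:E)%E.
    rewrite (@integral_cst _ _ _ lebesgue_measure _ mI').
    rewrite [X in (_ * X)%E](lebesgue_measure_itv `[rho, 3 / 2 * rho])/= lte_fin.
    have -> : rho < 3 / 2 * rho by move: rho0 => ?; lra.
    by rewrite -EFinB -EFinM; congr EFin; field.
  apply: ge0_le_integral => //.
  - by move=> r _; rewrite lee_fin !mulr_ge0// ltW.
  - apply: (measurableT_comp (@oppe_measurable R setT)).
    apply: (@measurable_fun_limn_esup _ _ _ _ (fun i r => - (EFin \o F i) r)%E) => i.
    exact: (measurableT_comp (@oppe_measurable R setT) (mF' i)).
  - move=> r rI; apply: near_le_limn_einf.
    have rI2 := sub _ rI.
    (* A value strictly below the lower limit is needed to get an inequality valid for all large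
       i. *)
    have e2 : ((eps / 2)%:E < eps%:E)%E by rewrite lte_fin; move: eps0 => ?; lra.
    have := lt_limn_einf_near (lt_le_trans e2 (lower r rI2)); apply: filterS => i.
    rewrite lte_fin => Ei; rewrite lee_fin.
    apply: le_trans (averaged_energy_ge (C1v i) rI2).
    have := rI; rewrite /= in_itv/= => /andP[r1 r2].
    apply: (@le_trans _ _ (rho / 2 * (eps / 2))); first by move: rho0 eps0 => ? ?; lra.
    by apply: ler_pM; [rewrite divr_ge0// ltW|rewrite divr_ge0// ltW|lra|exact: ltW].
move=> /(le_trans h1) h2.
have h3 : (limn_einf (fun i => \int[lebesgue_measure]_(r in `[rho, (3 / 2 * rho)%R])
    (EFin \o F i) r) <= (3 * rho ^+ 2 * beta)%:E)%E.
  apply: near_limn_einf_le; move: upper; apply: filterS => i ub.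
  apply: (@le_trans _ _ (\int[lebesgue_measure]_(r in `[rho, (2 * rho)%R]) (F i r)%:E)%E).
    apply: ge0_subset_integral; [exact: mI'|exact: mI|exact: mF| |exact: sub].
    by move=> r rI; rewrite lee_fin; exact: averaged_energy_ge0.
  apply: (le_trans (integral_averaged_energy_le (C1v i))).
  by rewrite lee_fin ler_wpM2l// mulr_ge0// sqr_ge0.
have := le_trans h2 h3; rewrite lee_fin.
rewrite -mulrA [3 * _]mulrC -[_ * 3 * beta]mulrA ler_pM2l ?exprn_gt0//; lra.
Qed.

End concentration.

Lemma smooth_on_C1 (R : realType) n (D : set 'rV[R]_n) f :
  smooth_on D f -> C1_on D f.
Proof.
move=> sf; split.
- by move=> y Dy; have [] := sf [::] y Dy.
- by move=> j y Dy; have [_] := sf [::] y Dy; exact.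
- by move=> j y Dy; have [] := sf [:: j] y Dy.
Qed.

(** * Consequences of the norm bound *)

Section norms.
Context {R : realType} {n : nat}.
Local Notation E := 'rV[R]_n.
Local Notation mu := (leb n).
Implicit Types (D K : set E) (u v : E -> R) (g : 'I_n -> E -> R).

Lemma norm_on_ge0 D p u : (0 <= norm_on D p u)%E.
Proof. exact: Lnorm_ge0. Qed.

Lemma integral_powR_norm_on D p u : p != 0 ->
  (\int[mu]_(x in D) (`|u x| `^ p)%:E = norm_on D p u `^ p)%E.
Proof.
move=> p0; rewrite /norm_on poweR_Lnorm// [LHS]integral_mkcond.
apply: eq_integral => x _; rewrite !patchE; case: ifPn => //= _.
by rewrite normr0 powR0.
Qed.

Lemma le_poweR (a b : \bar R) r : 0 <= r -> (0 <= a -> a <= b -> a `^ r <= b `^ r)%E.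
Proof.
move=> r0 a0 ab; apply: gt0_ler_poweR => //; rewrite in_itv/= ?leey ?andbT//.
exact: le_trans ab.
Qed.

Lemma integral_powR_le D p u (a : R) : 0 < p -> (norm_on D p u <= a%:E)%E ->
  (\int[mu]_(x in D) (`|u x| `^ p)%:E <= (a `^ p)%:E)%E.
Proof.
move=> p0 ua; rewrite integral_powR_norm_on ?gt_eqF// -poweR_EFin.
by apply: le_poweR => //; [exact: ltW|exact: norm_on_ge0].
Qed.

Lemma integral_sqr_le D u (a : R) : (norm_on D 2 u <= a%:E)%E ->
  (\int[mu]_(x in D) (u x ^+ 2)%:E <= (a ^+ 2)%:E)%E.
Proof.
move=> ua; have := integral_powR_le (ltr0Sn _ 1) ua.
have a0 : 0 <= a by rewrite -lee_fin (le_trans (norm_on_ge0 _ _ _) ua).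
rewrite powR_mulrn//; congr (_ <= _)%E; apply: eq_integral => x _.
by rewrite powR_mulrn// real_normK ?num_real.
Qed.

Let le_root (a b : \bar R) : (0 <= a -> a `^ 2 <= b -> a <= b `^ 2^-1)%E.
Proof.
move=> a0 ab; have <- : ((a `^ 2) `^ 2^-1)%E = a by rewrite -poweRrM mulfV// poweRe1.
by apply: le_poweR => //; exact: poweR_ge0.
Qed.

Lemma norm_on_le_H1 D u g : (norm_on D 2 u <= H1_norm D u g)%E.
Proof.
apply: le_root; first exact: norm_on_ge0.
by rewrite leeDl//; apply: sume_ge0 => j _; exact: poweR_ge0.
Qed.

Lemma norm_on_grad_le_H1 D u g j : (norm_on D 2 (g j) <= H1_norm D u g)%E.
Proof.
apply: le_root; first exact: norm_on_ge0.
rewrite (bigD1 j)//= addeCA leeDl// adde_ge0 ?poweR_ge0//.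
by apply: sume_ge0 => i _; exact: poweR_ge0.
Qed.

Lemma H1_norm_le D u g : (H1_norm D u g <= H1Lcrit_norm D u g)%E.
Proof. by rewrite leeDl// norm_on_ge0. Qed.

Lemma norm_on_crit_le D u g : (norm_on D (crit_exp n) u <= H1Lcrit_norm D u g)%E.
Proof. by rewrite leeDr// poweR_ge0. Qed.

(** On a set of finite measure |u| <= 1 + u^2 suffices. *)
Lemma in_L2_integrable D K u : measurable D -> measurable K -> K `<=` D ->
  (mu K < +oo)%E -> in_Lp D 2 u -> mu.-integrable K (EFin \o u).
Proof.
move=> mD mK KD Koo [mu_ noo].
have muK : measurable_fun K u by exact: measurable_funS mu_.
apply/integrableP; split; first exact/measurable_EFinP.
have sqoo : (\int[mu]_(x in K) (u x ^+ 2)%:E < +oo)%E.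
  have fn : norm_on D 2 u \is a fin_num by rewrite ge0_fin_numE// norm_on_ge0.
  have := @integral_sqr_le D u (fine (norm_on D 2 u)); rewrite fineK// => /(_ (lexx _)) h.
  apply: le_lt_trans (ltry _); apply: le_trans h.
  apply: ge0_subset_integral => //.
    by apply/measurable_EFinP; exact: measurable_funX.
  by move=> x _; rewrite lee_fin sqr_ge0.
apply: (@le_lt_trans _ _ (\int[mu]_(x in K) (1%:E + (u x ^+ 2)%:E))%E).
  apply: ge0_le_integral => //.
  - by apply: measurableT_comp => //; exact/measurable_EFinP.
  - by apply: emeasurable_funD => //; apply/measurable_EFinP; exact: measurable_funX.
  - move=> x _; rewrite -EFinD lee_fin -subr_ge0.
    have := sqr_ge0 (`|u x| - 1); have := sqr_ge0 (u x).
    by rewrite sqrrB real_normK ?num_real//; lra.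
rewrite ge0_integralD//; last 2 first.
- by move=> x _; rewrite lee_fin sqr_ge0.
- by apply/measurable_EFinP; exact: measurable_funX.
by rewrite lte_add_pinfty// integral_cst// mul1e.
Qed.

(** Young's inequality |u| <= a / 2 + u^2 / (2 a) replaces Cauchy-Schwarz. The constant is not
    optimal, but continuity of the functional is all that is wanted. *)
Lemma Rintegral_L2_le D K u (a : R) : measurable D -> measurable K -> K `<=` D ->
  (mu K < +oo)%E -> in_Lp D 2 u -> (norm_on D 2 u <= a%:E)%E -> 0 < a ->
  `|\int[mu]_(x in K) u x| <= a * ((fine (mu K) + 1) / 2).
Proof.
move=> mD mK KD Koo uL ua a0.
have iu := in_L2_integrable mD mK KD Koo uL.
have [mu_ _] := uL; have muK : measurable_fun K u by exact: measurable_funS mu_.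
apply: le_trans (le_normr_Rintegral mK iu) _.
have Kfin : mu K \is a fin_num by rewrite ge0_fin_numE.
rewrite -lee_fin fineK; last exact/integrable_fin_num/integrable_norm.
apply: (@le_trans _ _ (\int[mu]_(x in K) ((a / 2)%:E + ((2 * a)^-1)%:E * (u x ^+ 2)%:E))%E).
  apply: ge0_le_integral => //.
  - by apply/measurable_EFinP; exact: measurableT_comp.
  - apply: emeasurable_funD => //; apply: measurable_funeM.
    by apply/measurable_EFinP; exact: measurable_funX.
  - move=> x _; rewrite -EFinM -EFinD lee_fin -subr_ge0.
    rewrite [leRHS](_ : _ = (2 * a)^-1 * (`|u x| - a) ^+ 2).
      by rewrite mulr_ge0 ?sqr_ge0// invr_ge0 mulr_ge0// ltW.
    by rewrite sqrrB real_normK ?num_real//; field; rewrite gt_eqF.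
have m2 : measurable_fun K (fun x => (u x ^+ 2)%:E).
  by apply/measurable_EFinP; exact: measurable_funX.
rewrite ge0_integralD//; first last.
- exact: measurable_funeM.
- by move=> x _; rewrite mule_ge0// lee_fin ?sqr_ge0// invr_ge0 mulr_ge0// ltW.
- by move=> x _; rewrite lee_fin divr_ge0// ltW.
rewrite integral_cst// ge0_integralZl//; first last.
- by rewrite lee_fin invr_ge0 mulr_ge0// ltW.
- by move=> x _; rewrite lee_fin sqr_ge0.
apply: (@le_trans _ _ ((a / 2)%:E * mu K + ((2 * a)^-1)%:E * (a ^+ 2)%:E)%E).
  rewrite leeD2l// lee_wpmul2l ?lee_fin ?invr_ge0 ?mulr_ge0 ?(ltW a0)//.
  apply: le_trans (integral_sqr_le ua); apply: ge0_subset_integral => //.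
    by apply/measurable_EFinP; exact: measurable_funX.
  by move=> x _; rewrite lee_fin sqr_ge0.
rewrite -{1}[mu K]fineK// -!EFinM -EFinD lee_fin le_eqVlt; apply/orP; left.
by apply/eqP; field; rewrite gt_eqF.
Qed.

(** This makes means over fixed subsets of finite measure converge along the weakly convergent
    sequence. *)
Lemma bounded_functional_integral D K : measurable D -> measurable K -> K `<=` D ->
  (mu K < +oo)%E -> bounded_functional D (fun v => \int[mu]_(x in K) v x).
Proof.
move=> mD mK KD Koo; split=> [a v gv w gw [vL _ _ _] [wL _ _ _]|].
  have iv := in_L2_integrable mD mK KD Koo vL.
  have iw := in_L2_integrable mD mK KD Koo wL.
  have iav : mu.-integrable K (EFin \o (fun x => a * v x)) by exact: (integrableZl mK a iv).
  by rewrite (RintegralD mK iav iw) (RintegralZl _ mK iv).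
set k := (fine (mu K) + 1) / 2.
have k0 : 0 < k by rewrite divr_gt0// ltr_wpDl// fine_ge0.
exists k => v gv [vL gL _ cL].
have Hle : (norm_on D 2 v <= H1Lcrit_norm D v gv)%E.
  exact: le_trans (norm_on_le_H1 _ _ _) (H1_norm_le _ _ _).
have [Hoo|] := ltP (H1Lcrit_norm D v gv) +oo%E; last first.
  rewrite leye_eq => /eqP ->; rewrite gt0_muley ?lte_fin//; exact: leey.
have H0 : (0 <= H1Lcrit_norm D v gv)%E by exact: le_trans (norm_on_ge0 _ _ _) Hle.
have Hf : H1Lcrit_norm D v gv \is a fin_num by rewrite ge0_fin_numE.
(* The norm may be 0 while the previous estimate divides by its bound, so the bound is enlarged by
   [e / k]. *)
rewrite -(fineK Hf) -EFinM lee_fin; apply/ler_addgt0Pl => e e0.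
have he : 0 < fine (H1Lcrit_norm D v gv) + e / k.
  by apply: ltr_wpDl; [exact: fine_ge0|exact: divr_gt0].
apply: le_trans (Rintegral_L2_le mD mK KD Koo vL _ he) _.
  apply: le_trans Hle _; rewrite -{1}(fineK Hf) lee_fin lerDl divr_ge0// ltW//.
by rewrite -/k mulrDl divfK ?gt_eqF// mulrC addrC.
Qed.

End norms.

(** * Continuous cutoffs for vague convergence *)

Section test_functions.
Context {R : realType} {n : nat}.
Local Notation E := 'rV[R]_n.
Implicit Types (x y : E) (D K : set E) (d : R).

Lemma coord_le_norm y j : `|y ord0 j| <= `|y|.
Proof.
rewrite [leRHS]mx_normrE.
exact: (le_bigmax 0 (fun ij : 'I_1 * 'I_n => `|y ij.1 ij.2|) (ord0, j)).
Qed.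

Lemma norm_le_cube x d y : 0 <= d -> cube x d y -> `|y - x| <= d.
Proof.
move=> d0 /cubeP h; rewrite [leLHS]mx_normrE; apply: bigmax_le => // -[i j] _ /=.
by rewrite (ord1 i) !mxE; exact: h.
Qed.

(** Vague convergence tests only against continuous functions, so a piecewise linear profile in the
    maximum norm is enough; the transition takes place between half-sides [d] and [2 * d]. *)
Definition bump x d y : R := Num.max 0 (Num.min 1 (2 - `|y - x| / d)).

Lemma bump_ge0 x d y : 0 <= bump x d y.
Proof. by rewrite /bump le_max lexx. Qed.

Lemma bump_le1 x d y : bump x d y <= 1.
Proof. by rewrite /bump ge_max ler01 ge_min lexx. Qed.

Lemma bump1 x d y : 0 < d -> cube x d y -> bump x d y = 1.
Proof.
move=> d0 /(norm_le_cube (ltW d0)) yx; rewrite /bump min_l ?max_r//.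
have : `|y - x| / d <= 1 by rewrite ler_pdivrMr// mul1r.
by lra.
Qed.

Lemma bump0 x d y : 0 < d -> ~ cube x (2 * d) y -> bump x d y = 0.
Proof.
move=> d0 nyx; rewrite /bump max_l// ge_min; apply/orP; right.
rewrite subr_le0 ler_pdivlMr// leNgt; apply/negP => yx; apply: nyx.
apply/cubeP => j; apply: le_trans (ltW yx).
by have := coord_le_norm (y - x) j; rewrite !mxE.
Qed.

Lemma bump_continuous x d : continuous (bump x d).
Proof.
move=> y; have cn : {for y, continuous (fun z : E => `|z - x|)}.
  apply: (@cvg_comp _ _ _ (fun z : E => z - x) (fun z : E => `|z|) _ (nbhs (y - x))).
    by apply: (@cvgB _ 'rV[R]_n _ (nbhs y) _ id (cst x)) => //; exact: cvg_cst.
  exact: norm_continuous.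
have cs : {for y, continuous (fun z : E => 2 - `|z - x| / d)}.
  apply: (@cvgB _ _ _ (nbhs y)); first exact: cvg_cst.
  by apply: (@cvgM _ _ (nbhs y)) => //; exact: cvg_cst.
have c1 : {for y, continuous (fun z : E => 1 : R)} by exact: cst_continuous.
have c0 : {for y, continuous (fun z : E => 0 : R)} by exact: cst_continuous.
exact: (continuous_max c0 (continuous_min c1 cs)).
Qed.

Lemma compact_support_sub D K (f : E -> R) : compact K -> K `<=` D ->
  (forall y, ~ K y -> f y = 0) -> compact_support_in D f.
Proof.
move=> cK KD f0; have fK : [set y | f y != 0] `<=` K.
  by move=> y /eqP fy; apply: contrapT => /f0.
have clK : closed K by apply: compact_closed => //; exact: norm_hausdorff.
have sK : closure [set y | f y != 0] `<=` K.
  by have /closure_id -> := clK; exact: closure_subset.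
split; last exact: subset_trans KD.
by apply: subclosed_compact sK => //; exact: closed_closure.
Qed.

(** [f] lies between the indicators of [A] and [K]. Finiteness of [m K] ensures that the real-valued
    integral is not the default value of an infinite one. *)
Lemma test_function_between (m : {measure set E -> \bar R}) D A K (f : E -> R) :
  measurable D -> measurable A -> measurable K -> A `<=` D -> K `<=` D ->
  (m K < +oo)%E -> measurable_fun D f -> (forall y, 0 <= f y <= 1) ->
  (forall y, A y -> f y = 1) -> (forall y, ~ K y -> f y = 0) ->
  (m A <= (\int[m]_(y in D) f y)%:E <= m K)%E.
Proof.
move=> mD mA mK AD KD Koo mf f01 f1 f0.
have h0 : (0 <= \int[m]_(y in D) (f y)%:E)%E.
  by apply: integral_ge0 => y _; rewrite lee_fin; case/andP: (f01 y).
have mE : measurable_fun D (fun y => (f y)%:E) by exact/measurable_EFinP.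
have hK : (\int[m]_(y in D) (f y)%:E <= m K)%E.
  rewrite -[leRHS]mul1e -(integral_cst m mK 1%E) -[K](setIidr KD) integral_mkcondr.
  apply: ge0_le_integral => //.
  - by move=> y _; rewrite lee_fin; case/andP: (f01 y).
  - by apply/(measurable_restrict _ _ _).1 => //; exact: measurableI.
  - move=> y Dy; rewrite patchE; case: ifPn => [_|/negP yK].
      by rewrite lee_fin; case/andP: (f01 y).
    by rewrite f0// => Ky; apply: yK; exact: mem_set.
rewrite fineK; last by rewrite ge0_fin_numE// (le_lt_trans hK).
rewrite hK andbT -[leLHS]mul1e -(integral_cst m mA 1%E).
apply: (@le_trans _ _ (\int[m]_(y in A) (f y)%:E)%E).
  rewrite le_eqVlt; apply/orP; left; apply/eqP; apply: eq_integral => y /set_mem Ay.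
  by rewrite f1.
apply: ge0_subset_integral => // y _; rewrite lee_fin; by case/andP: (f01 y).
Qed.

(* The maximum of the bumps around the points of a finite set. *)
Lemma finite_test_function D (s : seq E) : open D -> (forall x, x \in s -> D x) ->
  exists f : E -> R, [/\ continuous f, (forall y, 0 <= f y <= 1),
    (forall x, x \in s -> f x = 1) &
    exists K, [/\ compact K, K `<=` D & forall y, ~ K y -> f y = 0]].
Proof.
move=> oD; elim: s => [_|x s IH sD].
  exists (fun=> 0); split => //; first exact: cst_continuous.
    by move=> y; rewrite lexx ler01.
  by exists set0; split => //; exact: compact0.
have [|f [cf f01 f1 [K [cK KD f0]]]] := IH.
  by move=> y ys; apply: sD; rewrite inE ys orbT.
have [d d0 dD] := cube_in_open oD (sD x (mem_head _ _)).
have d20 : 0 < d / 2 by exact: divr_gt0.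
have d2E : 2 * (d / 2) = d by rewrite mulrC divfK.
exists (fun y => Num.max (f y) (bump x (d / 2) y)); split.
- by move=> y; exact: (continuous_max (cf y) (@bump_continuous x (d / 2) y)).
- move=> y; have /andP[h1 h2] := f01 y.
  by rewrite le_max h1 ge_max h2 bump_le1.
- move=> y; rewrite inE => /predU1P[->|ys].
    rewrite bump1//; last exact/cube_center/ltW.
    by rewrite max_r//; case/andP: (f01 x).
  by rewrite f1// max_l// bump_le1.
- exists (K `|` cube x d); split.
  + by apply: compactU => //; exact: compact_cube.
  + by move=> y [/KD|/dD].
  + move=> y /not_orP[nK nC]; rewrite f0// bump0 ?d2E//.
    by rewrite max_l.
Qed.

End test_functions.

(** * The energy density and the critical exponent *)

Section energy.
Context {R : realType} {N : nat}.
Hypothesis N2 : (2 <= N)%N.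
Local Notation n := N.+1.
Local Notation E := 'rV[R]_n.
Local Notation mu := (leb n).
Local Notation p := (@crit_exp R n).
Local Notation kappa := ((n%:R - 2) / (2 * n%:R) : R).

Let n3 : 3 <= n%:R :> R. Proof. by rewrite (ler_nat R 3 n). Qed.

Lemma crit_exp_gt1 : 1 < p.
Proof. by rewrite /crit_exp ltr_pdivlMr; move: n3 => ?; lra. Qed.

Lemma crit_exp_gt0 : 0 < p. Proof. exact: lt_trans ltr01 crit_exp_gt1. Qed.

(** For n >= 3 the weight is at least 1/6; 8 is a convenient round constant, which also covers the
    weight 1/2 of the gradient. *)
Lemma energy_weight_ge : 1 <= 8 * kappa.
Proof. by rewrite mulrA ler_pdivlMr; move: n3 => ?; lra. Qed.

Lemma energy_weight_gt0 : 0 < kappa.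
Proof. by rewrite divr_gt0// subr_gt0; move: n3 => ?; lra. Qed.

Lemma energy_density_ge0 (u : E -> R) g y : 0 <= energy_density u g y.
Proof.
rewrite addr_ge0// mulr_ge0 ?powR_ge0// ?invr_ge0// ?(ltW energy_weight_gt0)//.
by apply: sumr_ge0 => j _; exact: sqr_ge0.
Qed.

Lemma powR_le_energy_density (u : E -> R) g y :
  `|u y| `^ p <= 8 * energy_density u g y.
Proof.
have h : 0 <= 8 * (2^-1 * \sum_j g j y ^+ 2).
  by rewrite !mulr_ge0 ?invr_ge0//; apply: sumr_ge0 => j _; exact: sqr_ge0.
rewrite /energy_density mulrDr [8 * (kappa * _)]mulrA.
apply: (@le_trans _ _ (8 * kappa * `|u y| `^ p)); last by rewrite lerDr.
by rewrite ler_peMl ?powR_ge0// energy_weight_ge.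
Qed.

Lemma measurable_energy_density (D : set E) (u : E -> R) g : measurable_fun D u ->
  (forall j, measurable_fun D (g j)) -> measurable_fun D (energy_density u g).
Proof.
move=> mu_ mg; apply: measurable_funD; apply: measurable_funM => //.
  by apply: measurable_sum => j; exact: measurable_funX.
apply: (measurableT_comp (measurable_powR p)).
exact: (measurableT_comp (@normr_measurable R setT)).
Qed.

(** Each of the n partial derivatives is separately bounded by the full norm, hence n L^2 for the
    gradient. *)
Definition energy_bound (L : R) : R := 2^-1 * (n%:R * L ^+ 2) + kappa * L `^ p.

Lemma integral_energy_density_le (D : set E) (u : E -> R) g (L : R) :
  measurable D -> measurable_fun D u -> (forall j, measurable_fun D (g j)) ->
  (H1Lcrit_norm D u g <= L%:E)%E ->
  (\int[mu]_(y in D) (energy_density u g y)%:E <= (energy_bound L)%:E)%E.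
Proof.
move=> mD mu_ mg uL.
have mgj j : measurable_fun D (fun y => (g j y ^+ 2)%:E).
  by apply/measurable_EFinP; exact: measurable_funX.
have ms : measurable_fun D (fun y => (\sum_j g j y ^+ 2)%:E).
  by apply/measurable_EFinP; apply: measurable_sum => j; exact: measurable_funX.
have mp : measurable_fun D (fun y => (`|u y| `^ p)%:E).
  apply/measurable_EFinP; apply: (measurableT_comp (measurable_powR p)).
  exact: (measurableT_comp (@normr_measurable R setT)).
have s0 y : (0 <= (\sum_j g j y ^+ 2)%:E :> \bar R)%E.
  by rewrite lee_fin; apply: sumr_ge0 => j _; exact: sqr_ge0.
have q0 y : (0 <= (`|u y| `^ p)%:E :> \bar R)%E by rewrite lee_fin powR_ge0.
have k0 : (0 <= kappa%:E)%E by rewrite lee_fin ltW// energy_weight_gt0.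
have i20 : (0 <= 2^-1%:E :> \bar R)%E by rewrite lee_fin invr_ge0.
rewrite (eq_integral (fun y => 2^-1%:E * (\sum_j g j y ^+ 2)%:E +
  kappa%:E * (`|u y| `^ p)%:E)%E); last by move=> y _; rewrite -!EFinM -EFinD.
rewrite (ge0_integralD _ mD _ (measurable_funeM _ ms) _ (measurable_funeM _ mp)); first last.
- by move=> y _; apply: mule_ge0; [exact: k0|exact: q0].
- by move=> y _; apply: mule_ge0; [exact: i20|exact: s0].
rewrite (ge0_integralZl _ mD ms (fun y _ => s0 y) i20).
rewrite (ge0_integralZl _ mD mp (fun y _ => q0 y) k0).
have uH : (H1_norm D u g <= L%:E)%E by exact: le_trans (H1_norm_le _ _ _) uL.
rewrite /energy_bound EFinD !EFinM; apply: leeD; apply: lee_wpmul2l => //; last first.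
  apply: integral_powR_le; first exact: crit_exp_gt0.
  exact: le_trans (norm_on_crit_le _ _ _) uL.
under eq_integral do rewrite -sumEFin.
rewrite ge0_integral_sum//; last by move=> j y _; rewrite lee_fin sqr_ge0.
apply: (@le_trans _ _ (\sum_(j < n) (L ^+ 2)%:E)%E).
  apply: lee_sum => j _; apply: integral_sqr_le.
  exact: le_trans (norm_on_grad_le_H1 _ _ _ _) uH.
by rewrite sumEFin sumr_const card_ord -!EFinM -expr2 mulr_natl.
Qed.

(** Truncation at height [M]: above it, t = t^(1-p) t^p and the exponent 1 - p is negative. The free
    height plays the part of Hölder's inequality. *)
Lemma powR_split (M t : R) : 0 < M -> 0 <= t -> t <= M + M `^ (1 - p) * t `^ p.
Proof.
move=> M0 t0; have [tM|Mt] := leP t M.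
  by rewrite (le_trans tM)// lerDl mulr_ge0 ?powR_ge0.
apply: (@le_trans _ _ (M `^ (1 - p) * t `^ p)); last by rewrite lerDr ltW.
have tp : 0 < t by exact: lt_trans Mt.
have {1}-> : t = t `^ (1 - p) * t `^ p.
  by rewrite -powRD ?subrK ?powRr1// (gt_eqF tp) implybT.
apply: ler_wpM2r; first exact: powR_ge0.
rewrite -[1 - p]opprB !powRN lef_pV2 ?posrE ?powR_gt0//.
by rewrite ge0_ler_powR ?nnegrE ?subr_ge0 ?(ltW M0) ?(ltW Mt) ?(ltW crit_exp_gt1).
Qed.

(* Splitting at height [tau * rho ^ (- (n - 2) / 2)]. *)
Lemma scaled_mean_sqr_le (D : set E) (u : E -> R) x (rho tau : R) :
  measurable D -> cube x (3 * rho) `<=` D -> in_Lp D 2 u -> in_Lp D p u ->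
  0 < rho -> 0 < tau ->
  ((6 * rho) ^+ n)^-1 * (rho ^+ 2)^-1 * (\int[mu]_(y in cube x (3 * rho)) u y) ^+ 2 <=
  (6 ^+ n)^-1 * (6 ^+ n * tau +
    tau `^ (1 - p) * \int[mu]_(y in cube x (3 * rho)) (`|u y| `^ p)) ^+ 2.
Proof.
move=> mD QD u2 up rho0 tau0; set Q := cube x (3 * rho).
have mQ : measurable Q by exact: measurable_cube.
have Qoo : (mu Q < +oo)%E by exact: leb_cube_lty.
have iu := in_L2_integrable mD mQ QD Qoo u2.
have [mu_ poo] := up; have muQ : measurable_fun Q u by exact: measurable_funS mu_.
have mpQ : measurable_fun Q (fun y => `|u y| `^ p).
  apply: (measurableT_comp (measurable_powR p)).
  exact: (measurableT_comp (@normr_measurable R setT)).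
have ip : mu.-integrable Q (EFin \o (fun y => `|u y| `^ p)).
  apply/integrableP; split; first exact/measurable_EFinP.
  have fn : norm_on D p u \is a fin_num by rewrite ge0_fin_numE// norm_on_ge0.
  have := @integral_powR_le _ _ D p u (fine (norm_on D p u)) crit_exp_gt0.
  rewrite fineK// => /(_ (lexx _)) h; apply: le_lt_trans (ltry _).
  apply: le_trans h; apply: (@le_trans _ _ (\int[mu]_(y in Q) (`|u y| `^ p)%:E)%E).
    rewrite le_eqVlt; apply/orP; left; apply/eqP; apply: eq_integral => y _ /=.
    by rewrite ger0_norm ?powR_ge0.
  apply: ge0_subset_integral => //.
  apply/measurable_EFinP; apply: (measurableT_comp (measurable_powR p)).
  exact: (measurableT_comp (@normr_measurable R setT)).
set Z := \int[mu]_(y in Q) (`|u y| `^ p); set I := \int[mu]_(y in Q) u y.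
(* With s the square root of rho, the height tau rho^(-(n-2)/2) becomes an integral power, since
   [N.-1] is n - 2. *)
pose s := Num.sqrt rho; have s0 : 0 < s by rewrite sqrtr_gt0.
have s2 : s ^+ 2 = rho by rewrite sqr_sqrtr// ltW.
pose M := tau * s ^- N.-1.
have M0 : 0 < M by rewrite mulr_gt0// invr_gt0 exprn_gt0.
(* The exponent is (n - 2)(p - 1) = n + 2, which is [N.+3]. *)
have Mp : M `^ (1 - p) = tau `^ (1 - p) * s ^+ N.+3.
  rewrite powRM ?(ltW tau0) ?invr_ge0 ?exprn_ge0 ?(ltW s0)//; congr (_ * _).
  rewrite -powR_mulrn ?(ltW s0)// -powRN -powRrM -powR_mulrn ?(ltW s0)//.
  congr (_ `^ _); rewrite /crit_exp.
  have n2 : n%:R - 2 != 0 :> R by rewrite gt_eqF// subr_gt0; move: n3 => ?; lra.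
  have -> : N.-1%:R = n%:R - 2 :> R.
    by rewrite -[n%:R]natr1 -subn1 natrB ?(ltnW N2)//; ring.
  have -> : N.+3%:R = n%:R + 2 :> R by rewrite -natrD addn2.
  by move: (n%:R : R) n2 => m m2; field.
have le1 : `|I| <= M * (6 * rho) ^+ n + M `^ (1 - p) * Z.
  have i1 : mu.-integrable Q (EFin \o (fun=> M)).
    by apply: measurable_bounded_integrable => //; exact: bounded_cst.
  have i2 : mu.-integrable Q (EFin \o (fun y => M `^ (1 - p) * `|u y| `^ p)).
    exact: (integrableZl mQ _ ip).
  apply: le_trans (le_normr_Rintegral mQ iu) _.
  have -> : M * (6 * rho) ^+ n + M `^ (1 - p) * Z =
      \int[mu]_(y in Q) (M + M `^ (1 - p) * `|u y| `^ p).
    rewrite (RintegralD mQ i1 i2) (RintegralZl _ mQ ip) Rintegral_cst//.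
    rewrite [X in fine X](leb_cube x _) ?mulr_ge0 ?(ltW rho0)//=.
    by congr (_ * _ ^+ _ + _); ring.
  apply: le_Rintegral => //.
  - exact: integrable_norm.
  - exact: (integrableD mQ i1 i2).
  - by move=> y _; exact: powR_split.
have MQ : M * (6 * rho) ^+ n + M `^ (1 - p) * Z =
    s ^+ N.+3 * (6 ^+ n * tau + tau `^ (1 - p) * Z).
  rewrite Mp mulrDr; congr (_ + _); last by ring.
  have ndbl m : (2 <= m)%N -> (2 * m.+1)%N = (m.-1 + m.+3)%N.
    by case: m => // m _; rewrite mul2n -addnn !addSn !addnS.
  rewrite /M exprMn -s2 -exprM (ndbl _ N2).
  rewrite exprD; field; rewrite expf_neq0// gt_eqF//.
have Z0 : 0 <= Z by apply: Rintegral_ge0 => y _; exact: powR_ge0.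
set W := 6 ^+ n * tau + _ in MQ *.
have W0 : 0 <= W by rewrite addr_ge0// mulr_ge0 ?powR_ge0// ?exprn_ge0// ltW.
have I2 : I ^+ 2 <= (s ^+ N.+3 * W) ^+ 2.
  rewrite -[I ^+ 2]real_normK ?num_real// -MQ lerXn2r ?nnegrE// MQ.
  by rewrite mulr_ge0// exprn_ge0// ltW.
have B0 : 0 <= ((6 * rho) ^+ n)^-1 * (rho ^+ 2)^-1.
  by rewrite mulr_ge0 ?invr_ge0 ?exprn_ge0 ?mulr_ge0 ?(ltW rho0).
apply: (le_trans (ler_wpM2l B0 I2)).
rewrite le_eqVlt; apply/orP; left; apply/eqP.
(* The square produces rho^(n+2), which cancels the volume factor rho^n and the factor rho^2: the
   estimate is scale invariant. *)
rewrite [(s ^+ _ * W) ^+ 2]exprMn -exprM mulnC exprM s2 exprMn.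
rewrite (_ : rho ^+ N.+3 = rho ^+ n * rho ^+ 2); last by rewrite -exprD addn2.
by field; rewrite !expf_neq0 ?gt_eqF.
Qed.

End energy.

(** * Measures and integrals on finite sets *)

Section finite_sets.
Context {R : realType} {n : nat}.
Local Notation E := 'rV[R]_n.
Implicit Types (A : set E) (m : {measure set E -> \bar R}).

Lemma finite_set_closed_rV A : finite_set A -> closed A.
Proof.
by apply: (iffLR accessible_finite_set_closed); exact/hausdorff_accessible/norm_hausdorff.
Qed.

Lemma finite_set_measurable_rV A : finite_set A -> measurable A.
Proof. by move=> fA; apply: closed_measurable_rV; exact: finite_set_closed_rV. Qed.

Lemma measurable_fun_finite_set A (f : E -> R) : finite_set A -> measurable_fun A f.
Proof. by move=> fA _ Y _; apply: finite_set_measurable_rV; exact: finite_setIl. Qed.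

Lemma integral_finite_set m A (f : E -> R) : finite_set A ->
  (forall x, A x -> 0 <= f x) ->
  (\int[m]_(x in A) (f x)%:E = \sum_(x \in A) (f x)%:E * m [set x])%E.
Proof.
move=> fA f0; rewrite fsbig_finite//.
have AE : A = \big[setU/set0]_(x <- fset_set A) [set x].
  by rewrite -bigcup_fset bigcup_imset1 image_id fset_setK.
have m1 (x : E) : measurable [set x] by exact: finite_set_measurable_rV.
rewrite [in LHS]AE ge0_integral_bigsetU//.
- apply: eq_bigr => x _; rewrite -(integral_cst m (m1 x) (f x)%:E).
  by apply: eq_integral => y /set_mem ->.
- by move=> x y _ _ [z [-> ->]].
- by rewrite -AE; apply/measurable_EFinP; exact: measurable_fun_finite_set.
- by rewrite -AE => x Ax; rewrite lee_fin; exact: f0.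
Qed.

Lemma measure_finite_set m A : finite_set A -> m A = (\sum_(x \in A) m [set x])%E.
Proof.
move=> fA; have mA := finite_set_measurable_rV fA.
rewrite -[LHS]mul1e -(integral_cst m mA 1%E).
rewrite (@integral_finite_set m A (fun=> 1) fA)//.
by apply: eq_fsbigr => x _; rewrite mul1e.
Qed.

Lemma hausdorff0_set1 (x : E) : (hausdorff0 [set x] = 1 :> \bar R)%E.
Proof. by rewrite hausdorff0E /counting asboolT// fset_set1 cardfs1. Qed.

(** Finite sets are discrete, which makes every function on them upper semicontinuous. *)
Lemma finite_set_isolated A (x : E) : finite_set A -> \forall y \near x, A y -> y = x.
Proof.
move=> fA; have cA : closed (A `\ x).
  by apply: finite_set_closed_rV; exact: finite_setD.
have : nbhs x (~` (A `\ x)).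
  by apply: open_nbhs_nbhs; split; [exact: closed_openC|case=> _; exact].
by apply: filterS => y nAy Ay; apply: contrapT => yx; exact: nAy.
Qed.

End finite_sets.

(** * Atoms of the limit measure *)

Section atoms.
Context {R : realType} {N : nat}.
Hypothesis N2 : (2 <= N)%N.
Local Notation n := N.+1.
Local Notation E := 'rV[R]_n.
Local Notation mu := (leb n).
Local Notation p := (@crit_exp R n).
Local Notation kappa := ((n%:R - 2) / (2 * n%:R) : R).

(** 72 n 2^n is the Poincaré constant 8 n 2^n a^2 at a = 3 rho, divided by rho^2. The outer 8
    absorbs the weights of the energy density. *)
Definition concentration_const : R := 8 * (1 + 72 * n%:R * 2 ^+ n).
Local Notation C2 := concentration_const.

Lemma concentration_const_gt0 : 0 < C2.
Proof. by rewrite mulr_gt0// ltr_pwDl// !mulr_ge0. Qed.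

(** The coefficient of the squared mean in the Poincaré inequality on the cube of side 6 rho,
    divided by rho^2. *)
Definition mean_weight (rho : R) : R := ((6 * rho) ^+ n)^-1 * (rho ^+ 2)^-1.

Lemma mean_weight_gt0 rho : 0 < rho -> 0 < mean_weight rho.
Proof. by move=> r0; rewrite mulr_gt0// invr_gt0 exprn_gt0// mulr_gt0. Qed.

Lemma energy_density_integrable (D K : set E) (v : E -> R) : open D -> C1_on D v ->
  compact K -> K `<=` D -> (mu K < +oo)%E ->
  mu.-integrable K (EFin \o energy_density v (fun j => partial j v)).
Proof.
move=> oD C1v cK KD Koo; have [cv _ _] := C1v.
have mK : measurable K.
  by apply: closed_measurable_rV; apply: compact_closed => //; exact: norm_hausdorff.
have iP := integrable_norm_powR oD cK KD Koo (ltW (crit_exp_gt0 N2)) cv.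
have iG : mu.-integrable K (EFin \o sqr_grad v).
  apply: (continuous_on_integrable oD) => // y; exact: continuous_sqr_grad.
exact: (integrableD mK (integrableZl mK 2^-1 iG) (integrableZl mK kappa iP)).
Qed.

Lemma cube_energy_le (D : set E) (v : E -> R) x (rho : R) :
  open D -> C1_on D v -> 0 < rho -> cube x (3 * rho) `<=` D ->
  \int[mu]_(y in cube x (3 * rho)) (`|v y| `^ p)
    + \int[mu]_(y in cube x (3 * rho)) sqr_grad v y
    + (rho ^+ 2)^-1 * \int[mu]_(y in cube x (3 * rho)) (v y ^+ 2) <=
  C2 * \int[mu]_(y in cube x (3 * rho)) energy_density v (fun j => partial j v) y +
  mean_weight rho * (\int[mu]_(y in cube x (3 * rho)) v y) ^+ 2.
Proof.
move=> oD C1v rho0 QD; set Q := cube x (3 * rho).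
have r3 : 0 < 3 * rho by rewrite mulr_gt0.
have mQ : measurable Q by exact: measurable_cube.
have cQ : compact Q by exact: compact_cube.
have Qoo : (mu Q < +oo)%E by exact: leb_cube_lty.
have [cv _ _] := C1v.
have iP := integrable_norm_powR oD cQ QD Qoo (ltW (crit_exp_gt0 N2)) cv.
have iG : mu.-integrable Q (EFin \o sqr_grad v).
  by apply: (continuous_on_integrable oD) => // y; exact: continuous_sqr_grad.
have -> : \int[mu]_(y in Q) energy_density v (fun j => partial j v) y =
    2^-1 * \int[mu]_(y in Q) sqr_grad v y + kappa * \int[mu]_(y in Q) (`|v y| `^ p).
  rewrite -(RintegralZl _ mQ iG) -(RintegralZl _ mQ iP).
  by rewrite -(RintegralD mQ (integrableZl mQ 2^-1 iG) (integrableZl mQ kappa iP)).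
have := poincare_cube oD C1v r3 QD; rewrite -/Q.
have := energy_weight_ge (R := R) N2; set k := kappa.
have G0 : 0 <= \int[mu]_(y in Q) sqr_grad v y.
  by apply: Rintegral_ge0 => y _; exact: sqr_grad_ge0.
have P0 : 0 <= \int[mu]_(y in Q) (`|v y| `^ p).
  by apply: Rintegral_ge0 => y _; exact: powR_ge0.
move: G0 P0; set G := Rintegral _ _ (sqr_grad v).
set P := Rintegral _ _ (fun y => `|v y| `^ p); set J := Rintegral _ _ (fun y => v y ^+ 2).
set I := Rintegral _ _ v => G0 P0 k1 hJ.
have i0 : 0 <= (rho ^+ 2)^-1 by rewrite invr_ge0 exprn_ge0// ltW.
pose q : R := 72 * n%:R * 2 ^+ n; have q0 : 0 <= q by rewrite !mulr_ge0.
have hJ2 : (rho ^+ 2)^-1 * J <= mean_weight rho * I ^+ 2 + q * G.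
  apply: le_trans (ler_wpM2l i0 hJ) _; rewrite le_eqVlt; apply/orP; left; apply/eqP.
  have -> : 2 * (3 * rho) = 6 * rho by ring.
  rewrite mulrDr; congr (_ + _); first by rewrite mulrCA mulrA.
  rewrite /q exprMn; move: (2 ^+ n : R) (n%:R : R) => b m; field.
  by rewrite gt_eqF.
apply: (@le_trans _ _ (P + G + (mean_weight rho * I ^+ 2 + q * G))).
  by rewrite lerD2l.
rewrite addrCA addrC lerD2r /concentration_const -/q.
have kP : P <= 8 * (k * P) by rewrite mulrA ler_peMl.
have qP : 0 <= q * P by exact: mulr_ge0.
have qkP : q * P <= q * (8 * (k * P)) by exact: ler_wpM2l.
have qG : 0 <= q * G by exact: mulr_ge0.
by move: kP qP qkP qG G0; set kp := k * P; nra.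
Qed.

Variables (Omega : set E) (u_ : nat -> E -> R) (u : E -> R) (gu : 'I_n -> E -> R).
Variables (eta_ : nat -> {measure set E -> \bar R}) (eta nu : {measure set E -> \bar R}).
Variable Lambda : R.
Hypothesis oOm : open Omega.
Hypothesis C1u : forall i, C1_on Omega (u_ i).
Hypothesis ubound : forall i,
  (H1Lcrit_norm Omega (u_ i) (fun j => partial j (u_ i)) <= Lambda%:E)%E.
Hypothesis ulim : in_H1Lcrit Omega u gu.
Hypothesis uw : weakly_converges Omega u_ u.
Hypothesis dens : forall i, has_density_on Omega (eta_ i)
  (energy_density (u_ i) (fun j => partial j (u_ i))).
Hypothesis radon_eta : radon_on Omega eta.
Hypothesis vague : vaguely_converges Omega eta_ eta.
Hypothesis etaE : forall A, measurable A ->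
  eta A = (\int[mu]_(x in A `&` Omega) (energy_density u gu x)%:E + nu A)%E.

Let mOm : measurable Omega. Proof. exact: open_measurable_rV. Qed.

Lemma energy_measure_le i A : measurable A -> (eta_ i A <= (@energy_bound R N Lambda)%:E)%E.
Proof.
move=> mA; have [cu _ cpu] := C1u i.
have mu_i : measurable_fun Omega (u_ i) by exact: continuous_on_measurable.
have mpu j : measurable_fun Omega (partial j (u_ i)).
  by apply: continuous_on_measurable => // y; exact: cpu.
rewrite dens//; apply: le_trans (integral_energy_density_le N2 mOm mu_i mpu (ubound i)).
apply: ge0_subset_integral => //.
- exact: measurableI.
- by apply/measurable_EFinP; exact: measurable_energy_density.
- by move=> y _; rewrite lee_fin energy_density_ge0.
Qed.

(** The cutoff equals 1 on the inner cube and vanishes off the doubled one, hence the two different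
    sizes. *)
Lemma cube_energy_near_le x (rho d : R) : 0 < rho -> cube x (6 * rho) `<=` Omega -> 0 < d ->
  \forall i \near \oo,
    \int[mu]_(y in cube x (3 * rho))
      energy_density (u_ i) (fun j => partial j (u_ i)) y <=
    fine (eta (cube x (6 * rho))) + d.
Proof.
move=> rho0 KO d0; set Q := cube x (3 * rho); set K := cube x (6 * rho).
have r3 : 0 < 3 * rho by rewrite mulr_gt0.
have KE : cube x (2 * (3 * rho)) = K by rewrite /K; congr cube; ring.
have mQ : measurable Q by exact: measurable_cube.
have mK : measurable K by exact: measurable_cube.
have cK : compact K by exact: compact_cube.
have QK : Q `<=` K by apply: sub_cube; rewrite ler_pM2r// ler_nat.
have QO : Q `<=` Omega by exact: subset_trans KO.
pose phi := bump x (3 * rho).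
have cphi : continuous phi by exact: bump_continuous.
have f01 y : 0 <= phi y <= 1 by rewrite bump_ge0 bump_le1.
have f1 y : Q y -> phi y = 1 by exact: bump1.
have f0 y : ~ K y -> phi y = 0 by rewrite -KE; exact: bump0.
have mphi : measurable_fun Omega phi.
  by apply: measurable_funTS; exact: continuous_measurable_rV.
have sphi : compact_support_in Omega phi.
  apply: (compact_support_sub cK KO f0).
have etaK : (eta K < +oo)%E by apply: radon_eta.2 => //; exact: compact_cube.
have hl := vague cphi sphi.
have /andP[_ he] := test_function_between mOm mQ mK QO KO etaK mphi f01 f1 f0.
have etaKfin : eta K \is a fin_num by rewrite ge0_fin_numE.
have hK : \int[eta]_(y in Omega) phi y <= fine (eta K).
  by rewrite -lee_fin (fineK etaKfin).
have : \forall i \near \oo, \int[eta_ i]_(y in Omega) phi y < fine (eta K) + d.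
  by apply: (cvgr_lt _ hl); rewrite (le_lt_trans hK)// ltrDl.
apply: filterS => i hi; apply: le_trans (ltW hi).
have iK : (eta_ i K < +oo)%E by exact: le_lt_trans (energy_measure_le i mK) (ltry _).
have /andP[ha _] := test_function_between mOm mQ mK QO KO iK mphi f01 f1 f0.
have iQ := energy_density_integrable oOm (C1u i) (@compact_cube _ _ _ _) QO (leb_cube_lty x _).
rewrite -lee_fin; apply: le_trans ha.
rewrite dens// setIidl// [in leLHS]/Rintegral fineK//.
exact: integrable_fin_num iQ.
Qed.

Lemma concentration_cube_le x (r0 eps rho : R) : 0 < eps ->
  concentration_set Omega u_ r0 eps x -> 0 < rho <= 1 -> 2 * rho < r0 ->
  cube x (6 * rho) `<=` Omega ->
  eps <= 24 * (C2 * fine (eta (cube x (6 * rho))) +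
    mean_weight rho * (\int[mu]_(y in cube x (3 * rho)) u y) ^+ 2).
Proof.
move=> eps0 cx rho01 rr0 KO; have /andP[rho0 rho1] := rho01.
set Q := cube x (3 * rho); set K := cube x (6 * rho).
have w0 := mean_weight_gt0 rho0; have c0 := concentration_const_gt0.
have QO : Q `<=` Omega.
  by apply: subset_trans KO; apply: sub_cube; rewrite ler_pM2r// ler_nat.
(* [d] is the slack granted to both the energy and the squared mean; its total contribution is
   exactly [e]. *)
apply/ler_addgt0Pr => e e0; pose d := e / (24 * (C2 + mean_weight rho)).
have d0 : 0 < d by rewrite divr_gt0// mulr_gt0// addr_gt0.
have -> : 24 * (C2 * fine (eta K) + mean_weight rho * (\int[mu]_(y in Q) u y) ^+ 2) + e =
    24 * (C2 * (fine (eta K) + d) + mean_weight rho * ((\int[mu]_(y in Q) u y) ^+ 2 + d)).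
  rewrite !mulrDr -!addrA; congr (_ + _); rewrite addrCA; congr (_ + _).
  rewrite -!mulrDr -mulrDl /d; field.
  by rewrite gt_eqF// addr_gt0.
apply: (concentration_le oOm rho01 QO (ltW (crit_exp_gt0 N2)) eps0 C1u).
  move=> r; rewrite in_itv/= => /andP[r1 r2].
  (* The concentration condition binds only when the closed ball lies in [Omega]; this holds since r
     <= 2 rho puts it inside the cube of half-side 6 rho. *)
  have rI : (`]0, r0[%classic : set R) r.
    by rewrite /= in_itv/=; apply/andP; split; lra.
  have [_] := cx r rI; apply; apply: subset_trans KO.
  apply: subset_trans (@closed_eball_cube _ _ _ _) _; apply: sub_cube; lra.
have hI : \forall i \near \oo,
    (\int[mu]_(y in Q) u_ i y) ^+ 2 < (\int[mu]_(y in Q) u y) ^+ 2 + d.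
  have bf := bounded_functional_integral mOm (measurable_cube x _) QO (leb_cube_lty x _).
  have hl := uw bf.
  have hl2 : (\int[mu]_(y in Q) u_ i y) ^+ 2 @[i --> \oo] --> (\int[mu]_(y in Q) u y) ^+ 2.
    exact: (cvgM hl hl).
  by apply: (cvgr_lt _ hl2); rewrite ltrDl.
have hE := cube_energy_near_le rho0 KO d0.
apply: filterS2 hI hE => i hI hE.
apply: le_trans (cube_energy_le oOm (C1u i) rho0 QO) _.
by apply: lerD; apply: ler_wpM2l; rewrite ?(ltW c0) ?(ltW w0) ?hE ?(ltW hI).
Qed.


Let mdens : measurable_fun Omega (fun y => (energy_density u gu y)%:E).
Proof.
have [[mu_ _] gL _ _] := ulim.
apply/measurable_EFinP; apply: measurable_energy_density => // j.
by have [] := gL j.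
Qed.

Lemma cube_measure_lty x (a : R) : cube x a `<=` Omega -> (eta (cube x a) < +oo)%E.
Proof. by move=> ?; apply: radon_eta.2 => //; exact: compact_cube. Qed.

Lemma atom_eq x : eta [set x] = nu [set x].
Proof.
rewrite etaE; last exact: measurable_set1_rV.
have m1 : measurable ([set x] `&` Omega).
  by apply: measurableI mOm; exact: measurable_set1_rV.
rewrite null_set_integral ?add0e//; first exact: measurable_funS mdens.
apply/eqP; rewrite eq_le measure_ge0 andbT -(leb_set1 x).
by apply: le_measure; rewrite ?inE//; exact: measurable_set1_rV.
Qed.

Lemma atom_fin x : Omega x -> nu [set x] \is a fin_num.
Proof.
move=> Ox; rewrite ge0_fin_numE// -atom_eq.
by apply: radon_eta.2; [exact: compact_set1|move=> _ ->].
Qed.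

Lemma atom_cube_near x (a e : R) : Omega x -> 0 < a -> 0 < e ->
  exists rho, [/\ 0 < rho <= a, cube x rho `<=` Omega &
    fine (eta (cube x rho)) <= fine (nu [set x]) + e].
Proof.
move=> Ox a0 e0; have [b b0 bO] := cube_in_open oOm Ox.
pose d := Num.min a b; have d0 : 0 < d by rewrite lt_min a0.
have dO : cube x d `<=` Omega.
  by apply: subset_trans bO; apply: sub_cube; rewrite ge_min lexx orbT.
(* Continuity from above needs finite measure of the first set, so the sequence starts at a cube
   contained in [Omega]. *)
pose F k := cube x (d * k.+1%:R^-1).
have mF k : measurable (F k) by exact: measurable_cube.
have FE : \bigcap_k F k = [set x].
  apply/seteqP; split => [y h|_ -> k _]; last first.
    by apply: cube_center; rewrite mulr_ge0// ltW.
  rewrite -[X in X y](bigcap_cube x) => k _.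
  have e1 : 0 < k.+1%:R^-1 / d by rewrite divr_gt0// invr_gt0.
  have [m _ hm] := near_infty_natSinv_lt (PosNum e1).
  apply: (sub_cube _ (h m I)); have := hm m (leqnn m).
  by rewrite /= ltr_pdivlMr// mulrC => /ltW.
have F0 : (eta (F 0%N) < +oo)%E.
  by apply: cube_measure_lty; rewrite /F invr1 mulr1.
have hF : {homo F : k m / (k <= m)%N >-> (m <= k)%O}.
  move=> k m km; apply/subsetPset; apply: sub_cube; rewrite ler_pM2l//.
  by rewrite lef_pV2 ?posrE// ler_nat.
have := nonincreasing_cvg_mu F0 mF _ hF; rewrite FE atom_eq -(fineK (atom_fin Ox)).
move=> /(_ (measurable_set1_rV _))/fine_cvg hc.
have h : \forall k \near \oo, fine (eta (F k)) < fine (nu [set x]) + e.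
  by apply: (cvgr_lt _ hc); rewrite ltrDl.
have [k _ hk] := h; exists (d * k.+1%:R^-1); split.
- rewrite divr_gt0//= ler_pdivrMr// (le_trans (_ : d <= a))//.
    by rewrite ge_min lexx.
  by rewrite ler_peMr ?ler1n// ltW.
- apply: subset_trans dO; apply: sub_cube.
  by rewrite ler_pdivrMr// ler_peMr ?ler1n// ltW.
- exact/ltW/(hk k (leqnn k)).
Qed.

(** The energy of u on the larger cube is eta minus nu, and nu is at least its atom at x. Once eta
    of the cube is close to nu({x}), the critical integral is small; no separate absolute continuity
    argument is made. *)
Lemma crit_mass_le x (a b : R) : 0 <= a <= b -> cube x b `<=` Omega ->
  \int[mu]_(y in cube x a) (`|u y| `^ p) <=
  8 * (fine (eta (cube x b)) - fine (nu [set x])).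
Proof.
move=> /andP[a0 ab] KO; set Q := cube x a; set K := cube x b.
have mQ : measurable Q by exact: measurable_cube.
have mK : measurable K by exact: measurable_cube.
have QK : Q `<=` K by exact: sub_cube.
have xK : K x by apply: cube_center; exact: le_trans ab.
have [[mu_ _] _ _ _] := ulim.
have mpO : measurable_fun Omega (fun y => (`|u y| `^ p)%:E).
  apply/measurable_EFinP; apply: (measurableT_comp (measurable_powR p)).
  exact: (measurableT_comp (@normr_measurable R setT)).
have mpQ : measurable_fun Q (fun y => (`|u y| `^ p)%:E).
  by apply: measurable_funS mpO => //; exact: subset_trans KO.
have mdQ : measurable_fun Q (fun y => (energy_density u gu y)%:E).
  by apply: measurable_funS mdens => //; exact: subset_trans KO.
have mdK : measurable_fun K (fun y => (energy_density u gu y)%:E).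
  exact: measurable_funS mdens.
have d0 y : (0 <= (energy_density u gu y)%:E)%E by rewrite lee_fin energy_density_ge0.
have etaK := cube_measure_lty KO.
have nuK : (nu [set x] <= nu K)%E.
  by apply: le_measure; rewrite ?inE//; [exact: measurable_set1_rV|move=> _ ->].
have nux := atom_fin (KO _ xK).
have I0 : (0 <= \int[mu]_(y in K) (energy_density u gu y)%:E)%E by exact: integral_ge0.
have hK : (\int[mu]_(y in K) (energy_density u gu y)%:E + nu [set x] <= eta K)%E.
  by rewrite (etaE mK) setIidl//; exact: leeD2l.
have hQ : (\int[mu]_(y in Q) (`|u y| `^ p)%:E <=
    8%:E * \int[mu]_(y in K) (energy_density u gu y)%:E)%E.
  have e8 : (0 <= 8%:E :> \bar R)%E by rewrite lee_fin.
  apply: (@le_trans _ _ (8%:E * \int[mu]_(y in Q) (energy_density u gu y)%:E)%E).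
    rewrite -(ge0_integralZl mu mQ mdQ (fun y _ => d0 y) e8).
    apply: ge0_le_integral => //.
    - exact: measurable_funeM.
    - by move=> y _; rewrite -EFinM lee_fin; exact: powR_le_energy_density.
  by apply: lee_wpmul2l => //; exact: ge0_subset_integral.
have Ifin : (\int[mu]_(y in K) (energy_density u gu y)%:E)%E \is a fin_num.
  rewrite ge0_fin_numE//; apply: le_lt_trans etaK; apply: le_trans hK.
  by rewrite leeDl.
move: hK hQ; rewrite -(fineK nux) -(fineK Ifin) -EFinD -EFinM => hK hQ.
have Qfin : (\int[mu]_(y in Q) (`|u y| `^ p)%:E)%E \is a fin_num.
  rewrite ge0_fin_numE; first exact: le_lt_trans hQ (ltry _).
  by apply: integral_ge0 => y _; rewrite lee_fin powR_ge0.
have eKfin : eta K \is a fin_num by rewrite ge0_fin_numE.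
move: hK; rewrite -(fineK eKfin) lee_fin => hK.
move: hQ; rewrite -(fineK Qfin) lee_fin => hQ.
apply: le_trans hQ _; rewrite ler_pM2l// lerBrDr.
exact: hK.
Qed.

Lemma concentration_atom_le x (r0 eps : R) : 0 < r0 -> 0 < eps ->
  Omega x -> concentration_set Omega u_ r0 eps x ->
  eps <= 24 * (C2 * fine (nu [set x])).
Proof.
move=> r00 eps0 Ox cx; have c0 := concentration_const_gt0.
set th := fine (nu [set x]).
apply/ler_addgt0Pr => e e0.
have [u2 _ _ up] := ulim; have p0 := crit_exp_gt0 (R := R) N2.
pose b : R := 6 ^+ n; have b0 : 0 < b by exact: exprn_gt0.
(* Makes 24 times the bound 4 b tau^2 of the mean term equal to e / 2. It is fixed before rho,
   because [t1] is large when [tau] is small. *)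
pose tau := Num.sqrt (e / (192 * b)).
have tau0 : 0 < tau by rewrite sqrtr_gt0 divr_gt0// mulr_gt0.
have tau2 : tau ^+ 2 = e / (192 * b).
  by rewrite sqr_sqrtr// ltW// divr_gt0// mulr_gt0.
pose t1 := tau `^ (1 - p); have t10 : 0 < t1 by exact: powR_gt0.
(* The first entry gives t1 Z <= b tau through Z <= 8 h; the second gives 24 C2 h <= e / 2. *)
pose h := Num.min (b * tau / (8 * t1)) (e / (48 * C2)).
have h0 : 0 < h by rewrite lt_min !divr_gt0 ?mulr_gt0.
(* 6 rho <= min(1, r0) yields both rho <= 1 and 2 rho < r0. *)
have a0 : 0 < Num.min 1 r0 by rewrite lt_min ltr01.
have [rho' [/andP[r'0 r'1] KO hK]] := atom_cube_near Ox a0 h0.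
pose rho := rho' / 6; have r6 : rho' = 6 * rho by rewrite mulrCA divff// mulr1.
rewrite r6 in KO hK.
have rho0 : 0 < rho by rewrite divr_gt0.
move: r'1; rewrite le_min r6 => /andP[r1 r2].
have rho01 : 0 < rho <= 1 by rewrite rho0/=; lra.
have rr0 : 2 * rho < r0 by lra.
have hc := concentration_cube_le eps0 cx rho01 rr0 KO.
have ab : 0 <= 3 * rho <= 6 * rho by apply/andP; split; lra.
have QO : cube x (3 * rho) `<=` Omega by apply: subset_trans KO; apply: sub_cube; lra.
have hZ := crit_mass_le ab KO.
have hm := scaled_mean_sqr_le N2 mOm QO u2 up rho0 tau0.
have Z0 : 0 <= \int[mu]_(y in cube x (3 * rho)) (`|u y| `^ p).
  by apply: Rintegral_ge0 => y _; exact: powR_ge0.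
move: hc hZ hm Z0; rewrite /mean_weight -/th -/b -/t1.
set Z := \int[mu]_(y in _) (`|u y| `^ p).
set S := _ * _ ^+ 2; set eK := fine _ => hc hZ hm Z0.
have hh : eK - th <= h by rewrite lerBlDl.
have t1Z : t1 * Z <= b * tau.
  apply: (@le_trans _ _ (t1 * (8 * h))).
    by rewrite ler_pM2l// (le_trans hZ)// ler_pM2l.
  rewrite mulrA [t1 * 8]mulrC -ler_pdivlMl ?mulr_gt0// [leRHS]mulrC.
  by rewrite ge_min lexx.
have Ch : 24 * (C2 * h) <= e / 2.
  have -> : 24 * (C2 * h) = (24 * C2) * h by rewrite mulrA.
  rewrite -ler_pdivlMl ?mulr_gt0// ge_min; apply/orP; right.
  rewrite le_eqVlt; apply/orP; left; apply/eqP; field.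
  by rewrite gt_eqF.
have S2 : 24 * S <= e / 2.
  have : S <= b^-1 * (b * tau + b * tau) ^+ 2.
    apply: (le_trans hm); rewrite ler_pM2l ?invr_gt0// lerXn2r ?nnegrE ?lerD2l//.
      by rewrite addr_ge0 ?mulr_ge0// ltW.
    by rewrite addr_ge0 ?mulr_ge0// ltW.
  have -> : b^-1 * (b * tau + b * tau) ^+ 2 = 4 * b * tau ^+ 2.
    by field; rewrite gt_eqF.
  rewrite tau2; have -> : 4 * b * (e / (192 * b)) = e / 48.
    by field; rewrite gt_eqF.
  lra.
have CeK : C2 * eK <= C2 * th + C2 * h.
  by rewrite -mulrDr ler_pM2l//; lra.
by move: hc Ch CeK S2; lra.
Qed.

(** A cutoff equal to 1 on [A] has integral at most the energy bound against every [eta_ i], and the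
    bound survives the vague limit. *)
Lemma finite_measure_le (A : set E) : finite_set A -> A `<=` Omega ->
  (eta A <= (@energy_bound R N Lambda)%:E)%E.
Proof.
move=> fA AO; have [|f [cf f01 f1 [K [cK KO f0]]]] :=
    finite_test_function (s := fset_set A) oOm.
  by move=> x; rewrite in_fset_set// inE => /AO.
have mK : measurable K.
  by apply: closed_measurable_rV; apply: compact_closed => //; exact: norm_hausdorff.
have mA := finite_set_measurable_rV fA.
have mf : measurable_fun Omega f.
  by apply: measurable_funTS; exact: continuous_measurable_rV.
have etaK := radon_eta.2 K cK KO.
have fA1 y : A y -> f y = 1 by move=> Ay; apply: f1; rewrite in_fset_set// inE.
have /andP[hA _] := test_function_between mOm mA mK AO KO etaK mf f01 fA1 f0.
apply: (le_trans hA); rewrite lee_fin.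
have sf : compact_support_in Omega f by exact: (compact_support_sub cK KO f0).
apply: (cvgr_to_le (vague cf sf)); apply: nearW => i.
have iK : (eta_ i K < +oo)%E by exact: le_lt_trans (energy_measure_le i mK) (ltry _).
(* Only the upper half of the comparison is wanted here, so the inner set is empty. *)
have f01' y : set0 y -> f y = 1 by [].
have /andP[_ hK] := test_function_between mOm measurable0 mK (@sub0set _ _) KO iK mf f01 f01' f0.
by rewrite -lee_fin; apply: (le_trans hK); exact: energy_measure_le.
Qed.

Lemma concentration_finite (S : set E) (r0 eps : R) : 0 < r0 -> 0 < eps ->
  S `<=` Omega -> S `<=` concentration_set Omega u_ r0 eps -> finite_set S.
Proof.
move=> r00 eps0 SO Sc; apply: contrapT => iS; have c0 := concentration_const_gt0.
(* q + 1 atoms of mass at least eps / (24 C2) weigh more than [L] in total. *)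
pose L := @energy_bound R N Lambda; pose q := Num.truncn (24 * C2 * L / eps).
have [B BS qB] := infinite_set_fset q.+1 iS.
have fB : finite_set [set` B] by exact: finite_fset.
have BO : [set` B] `<=` Omega by exact: subset_trans SO.
have := finite_measure_le fB BO; rewrite (measure_finite_set eta fB).
rewrite fsbig_finite// set_fsetK => hL.
have : ((\sum_(x <- B) (eps / (24 * C2))%:E) <= L%:E)%E.
  apply: le_trans hL; rewrite big_seq [leRHS]big_seq; apply: lee_sum => x xB.
  have Ox := BO x xB; rewrite [leRHS]atom_eq -(fineK (atom_fin Ox)) lee_fin.
  rewrite ler_pdivrMr ?mulr_gt0// mulrC -mulrA.
  exact: (concentration_atom_le r00 eps0 Ox (Sc x (BS x xB))).
rewrite sumEFin lee_fin big_const_seq count_predT iter_addr_0 -[leLHS]mulr_natl.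
rewrite mulrA ler_pdivrMr ?mulr_gt0// => h.
have : (q.+1%:R : R) <= 24 * C2 * L / eps.
  rewrite ler_pdivlMr// [leRHS]mulrC; apply: le_trans h.
  by rewrite ler_pM2r// ler_nat.
by rewrite leNgt truncnS_gt.
Qed.

(** Finiteness of [Sigma] settles measurability and semicontinuity, and turns the density formula
    into a sum over points of [hausdorff0]-mass 1. Doubling 24 to 48 makes the lower bound strict;
    the absolute value and the summand 1 make the upper constant positive and its inequality
    strict. *)
Lemma concentration_measure (Sigma : set E) (r0 eps : R) : 0 < r0 -> 0 < eps ->
  Sigma `<=` Omega -> Sigma = concentration_set Omega u_ r0 eps ->
  Sigma `<=` support_in Omega nu /\
  exists Theta : E -> R,
    [/\ measurable_fun Sigma Theta, upper_semicontinuous_on Sigma Theta,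
        forall A, measurable A -> A `<=` Sigma ->
          nu A = (\int[hausdorff0]_(x in A) (Theta x)%:E)%E &
        {ae hausdorff0, forall x, Sigma x ->
          (48 * C2)^-1 * eps < Theta x < `|@energy_bound R N Lambda| + 1}].
Proof.
move=> r00 eps0 SO SE; have c0 := concentration_const_gt0.
have Sc : Sigma `<=` concentration_set Omega u_ r0 eps by rewrite SE.
have fS := concentration_finite r00 eps0 SO Sc.
have nuS x (Sx : Sigma x) := fineK (atom_fin (SO x Sx)).
have lower x : Sigma x -> (48 * C2)^-1 * eps < fine (nu [set x]).
  move=> Sx; have := concentration_atom_le r00 eps0 (SO x Sx) (Sc x Sx).
  rewrite ltr_pdivrMl ?mulr_gt0// => h; apply: (le_lt_trans h).
  have : 0 < C2 * fine (nu [set x]) by lra.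
  by rewrite -[48 * C2 * _]mulrA; move: (C2 * _) => t t0; lra.
have pos x : Sigma x -> 0 < fine (nu [set x]).
  by move=> /lower; apply: le_lt_trans; rewrite mulr_ge0 ?invr_ge0 ?mulr_ge0 ?ltW.
split.
  move=> x Sx; split=> [|U oU Ux]; first exact: SO.
  apply: (@lt_le_trans _ _ (nu [set x])); first by rewrite -(nuS x Sx) lte_fin pos.
  apply: le_measure; rewrite ?inE.
  - exact: measurable_set1_rV.
  - by apply: measurableI mOm; exact: open_measurable_rV.
  - by move=> _ ->; split => //; exact: SO.
exists (fun x => fine (nu [set x])); split.
- exact: measurable_fun_finite_set.
- move=> x Sx b hb; have h := finite_set_isolated x fS.
  by apply: filterS h => y h /h ->.
- move=> A mA AS; have fA := sub_finite_set AS fS.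
  rewrite (integral_finite_set hausdorff0 fA); last by move=> x /AS /pos /ltW.
  rewrite (measure_finite_set nu fA); apply: eq_fsbigr => x /set_mem /AS Sx.
  rewrite nuS// -[LHS]mule1; congr (_ * _)%E.
  by symmetry; exact: hausdorff0_set1.
- apply: aeW => x Sx; rewrite lower//=.
  have xO : [set x] `<=` Omega by move=> _ ->; exact: SO.
  have := finite_measure_le (finite_set1 x) xO.
  rewrite atom_eq -(nuS x Sx) lee_fin => h; apply: (le_lt_trans h).
  by rewrite ltr_pwDr// ler_norm.
Qed.

End atoms.

(** * Assembly of the result *)

Theorem lemma1p4 (R : realType) (n : nat) (Omega : set 'rV[R]_n) :
  (3 <= n)%N -> open Omega ->
  exists2 c : R, 0 < c &
  forall Lambda : R,
  exists2 C : R, 0 < C &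
  forall (u_ : nat -> 'rV[R]_n -> R)
         (u : 'rV[R]_n -> R) (gu : 'I_n -> 'rV[R]_n -> R)
         (eta_ : nat -> {measure set 'rV[R]_n -> \bar R})
         (eta nu : {measure set 'rV[R]_n -> \bar R})
         (Sigma : set 'rV[R]_n) (r0 eps0 delta : R) (x0 : 'rV[R]_n),
    (forall i, smooth_on Omega (u_ i) /\ solves_on Omega (u_ i)) ->
    (forall i, (H1Lcrit_norm Omega (u_ i) (fun j => partial j (u_ i))
                  <= Lambda%:E)%E) ->
    in_H1Lcrit Omega u gu ->
    weakly_converges Omega u_ u ->
    (forall i, has_density_on Omega (eta_ i)
                 (energy_density (u_ i) (fun j => partial j (u_ i)))) ->
    radon_on Omega eta ->
    vaguely_converges Omega eta_ eta ->
    radon_on Omega nu ->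
    (forall A, measurable A ->
       eta A = (\int[leb n]_(x in A `&` Omega) (energy_density u gu x)%:E
                + nu A)%E) ->
    0 < r0 -> 0 < eps0 -> singular_set Omega u_ u r0 eps0 Sigma ->
    0 < delta -> eball x0 delta `<=` Omega ->
    Sigma `<=` support_in Omega nu /\
    exists Theta : 'rV[R]_n -> R,
      [/\ measurable_fun Sigma Theta,
          upper_semicontinuous_on Sigma Theta,
          forall A, measurable A -> A `<=` Sigma ->
            nu A = (\int[hausdorff0]_(x in A) (Theta x)%:E)%E &
          {ae hausdorff0, forall x, Sigma x -> c * eps0 < Theta x < C}].
Proof.
(* The dimension is put in successor form, in which polar coordinates and null singletons are
   stated. *)
case: n Omega => // N Omega; rewrite ltnS => N2 oOm.
exists (48 * @concentration_const R N)^-1.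
  by rewrite invr_gt0 mulr_gt0// concentration_const_gt0.
move=> Lambda; exists (`|@energy_bound R N Lambda| + 1); first exact: ltr_wpDl.
move=> u_ u gu eta_ eta nu Sigma r0 eps0 delta x0 sol ub ul uw dens re vg rn etaE r00 e0.
move=> [[F cF SF] _ SE] _ _.
have C1u i : C1_on Omega (u_ i) by apply: smooth_on_C1; case: (sol i).
apply: (concentration_measure N2 oOm C1u ub ul uw dens re vg etaE r00 e0 _ SE).
by rewrite SF => y [].
Qed.
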